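(* Let $\Gamma_1,\Gamma_2\subset\widetilde G$ and $u\in\mathbb D$ satisfy Condition ( * ), and let $P\subset\widetilde L$ be the associated polytope (all notation as defined in the context). Then the boundary $\partial P$ of $P$ in $\widetilde L$ is invariant under the action of $\Gamma_1\times\Gamma_2$. For $g\in\Gamma_1\Gamma_2=\{g_1g_2: g_1\in\Gamma_1,\ g_2\in\Gamma_2\}$, the subset $$F_g=\operatorname{Cl}_{\partial P}\bigl(\operatorname{Int}(\partial H_g\cap\partial P)\bigr)$$ (interior taken in $\partial P$) is a fundamental domain for the action of $\Gamma_1\times\Gamma_2$ on $\partial P$. The family $(F_{g_1g_2})_{g_1\in\Gamma_1,\,g_2\in\Gamma_2}$ is locally finite in $\partial P$. The projection $\theta:\widetilde L\to\widetilde G$ induces a $\Gamma_1\times\Gamma_2$-equivariant homeomorphism $\partial P\to\widetilde G$. The image $\mathcal F_g$ of $F_g$ under this projection is a fundamental domain for the action of $\Gamma_1\times\Gamma_2$ on $\widetilde G$. The family $(\mathcal F_{g_1g_2})_{g_1\in\Gamma_1,\,g_2\in\Gamma_2}$ is locally finite. For all $g_1,h_1\in\Gamma_1$ and $g_2,h_2\in\Gamma_2$ with $g_1g_2\neq h_1h_2$, the intersection $\mathcal F_{g_1g_2}\cap\mathcal F_{h_1h_2}$ lies in a totally geodesic submanifold of $\widetilde G$.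
   Context: Spaces. On $\mathbb C^2$ use the symmetric real bilinear form $\langle(z_1,w_1),(z_2,w_2)\rangle=\operatorname{Re}(z_1\bar z_2-w_1\bar w_2)$ of signature $(2,2)$. Let $G=\{a\in\mathbb C^2:\langle a,a\rangle=-1\}=\{(z,w):|z|^2-|w|^2=-1\}$ and $L=\mathbb R_+\cdot G=\{(z,w):|z|<|w|\}$, where $\mathbb R_+=(0,\infty)$. Identify $G$ with the Lie group $\mathrm{SU}(1,1)$ by letting $(z,w)\in G$ correspond to the matrix $\begin{pmatrix}\bar w&z\\ \bar z&w\end{pmatrix}$. Let $\widetilde L=\{(z,\alpha,r)\in\mathbb C\times\mathbb R\times\mathbb R_+:|z|<r\}$, with universal covering $\pi:\widetilde L\to L$, $\pi(z,\alpha,r)=(z,re^{i\alpha})$, and $\widetilde G=\pi^{-1}(G)=\{(z,\alpha,r)\in\widetilde L:|z|^2=r^2-1\}$, the universal covering group $\widetilde{\mathrm{SU}}(1,1)$ of $G$ with identity $e=(0,0,1)$. The form induces a Lorentz metric on $G$, and by pull-back on $\widetilde G$; it is biinvariant. The projection $\theta:\widetilde L\to\widetilde G$ is $\theta(z,\alpha,r)=(\lambda^{-1}z,\alpha,\lambda^{-1}r)$ with $\lambda=\sqrt{r^2-|z|^2}$; $(\theta,\lambda)$ gives the trivialization $\widetilde L\cong\widetilde G\times\mathbb R_+$. The group $\widetilde G\times\widetilde G$ acts on $\widetilde G$ by $(g,h)\cdot x=gxh^{-1}$ and on $\widetilde L\cong\widetilde G\times\mathbb R_+$ by this action on the first factor.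 $\widetilde G$ acts on the unit disc $\mathbb D\subset\mathbb C$ (model of the hyperbolic plane) through $\widetilde G\to G=\mathrm{SU}(1,1)\to\mathrm{PSU}(1,1)$ by Möbius transformations. The kernel of $\widetilde G\to\mathrm{PSU}(1,1)$ is the centre $Z$ of $\widetilde G$, an infinite cyclic group. The level of a discrete subgroup $\Gamma\subset\widetilde G$ is the index of $\Gamma\cap Z$ in $Z$. Condition ( * ). $\Gamma_1$ is a discrete subgroup and $\Gamma_2$ a discrete cyclic subgroup of $\widetilde G$, both of finite level $k$. Their images $\overline\Gamma_1,\overline\Gamma_2$ in $\mathrm{PSU}(1,1)$ have a joint fixed point $u\in\mathbb D$, i.e. $u$ is fixed by a nontrivial element of $\overline\Gamma_1$ and by a nontrivial element of $\overline\Gamma_2$. Let $p_i$ be the order of the (finite cyclic) isotropy group $(\overline\Gamma_i)_u$ and $p=\operatorname{lcm}(p_1,p_2)$. Assume $p>k$. Half-spaces. For $g\in\widetilde G$ with $\bar g=\pi(g)$, let $E_g$, resp. $I_g$, be the connected component containing $g$ of $\pi^{-1}(\{a\in L:\langle\bar g,a\rangle=-1\})$, resp. $\pi^{-1}(\{a\in L:\langle\bar g,a\rangle\le-1\})$. $E_g$ divides $\widetilde L$ into two connected components; the closure of one of them is $I_g$, and $H_g$ denotes the closure of the other. $\partial H_g=\partial I_g=E_g$. Polytope. For $x$ in the orbit $\Gamma_1(u)$ let $T(x)=\{(g_1,g_2)\in\Gamma_1\times\Gamma_2: g_1(u)=x\}$, $Q_x=\bigcap_{(g_1,g_2)\in T(x)}H_{g_1g_2}$,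 and $P=\bigcup_{x\in\Gamma_1(u)}Q_x\subset\widetilde L$. Terminology. The translate of $F_g$ by $(g_1,g_2)$ is $F_{g_1gg_2^{-1}}$. That $F_g$ is a fundamental domain means: its translates have no common inner points, i.e. $\operatorname{Int}(F_h)\cap F_{h'}=\emptyset$ for $h\ne h'$ in $\Gamma_1\Gamma_2$, and $\operatorname{Cl}\bigl(\bigcup_{h\in\Gamma_1\Gamma_2}\operatorname{Int}F_h\bigr)=\partial P$ (interiors and closures in $\partial P$); analogously for $\mathcal F_g$ in $\widetilde G$. A family of subsets is locally finite if every point has a neighbourhood meeting only finitely many of the sets; here the sets $F_{g_1g_2}$ (resp. $\mathcal F_{g_1g_2}$) are counted once for each element $g_1g_2\in\Gamma_1\Gamma_2$. *)

(* Defs.v *)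
From HB Require Import structures.
From mathcomp Require Import all_boot all_order all_algebra.
From mathcomp Require Import complex ring.
From mathcomp Require Import all_classical all_reals all_analysis.

Set Implicit Arguments.
Unset Strict Implicit.
Unset Printing Implicit Defensive.

Import Order.TTheory GRing.Theory Num.Theory.
Import numFieldNormedType.Exports.
Import ComplexField.Normc.

Local Open Scope classical_set_scope.
Local Open Scope ring_scope.
Local Open Scope complex_scope.

(* The type [subspace X] has the points of the whole space, with the points
   outside X isolated; for A contained in X the two operations below are the
   closure and the interior of A in the topological space X. *)
Definition closure_in (T : topologicalType) (X A : set T) : set T :=
  @closure (subspace X) A.

Definition interior_in (T : topologicalType) (X A : set T) : set T :=
  @interior (subspace X) A.

Definition boundary_in (T : topologicalType) (X A : set T) : set T :=
  closure_in X A `\` interior_in X A.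

Definition homeomorphism_on (T U : topologicalType) (X : set T) (Y : set U)
    (f : T -> U) : Prop :=
  [/\ set_bij X Y f, {within X, continuous f} &
      exists f' : U -> T,
        {within Y, continuous f'} /\ (forall x, X x -> f' (f x) = x)].

Definition locally_finite_in (T : topologicalType) (I : Type) (X : set T)
    (D : set I) (F : I -> set T) : Prop :=
  forall x, X x -> exists2 U : set T, nbhs x U &
    finite_set [set i | D i /\ F i `&` U !=set0].

Definition C2 (R : realType) : Type := (R[i] * R[i])%type.

Definition form (R : realType) (a b : C2 R) : R :=
  complex.Re (a.1 * b.1^* - a.2 * b.2^*).

Definition G (R : realType) : set (C2 R) := [set a | form a a = -1].

Definition su (R : realType) (a : C2 R) : 'M[R[i]]_2 :=
  \matrix_(i < 2, j < 2)
    if i == 0 then (if j == 0 then a.2^* else a.1)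
    else (if j == 0 then a.1^* else a.2).

(* The second column of the matrix product, see [su_mul]. *)
Definition mulSU (R : realType) (a b : C2 R) : C2 R :=
  (a.2^* * b.1 + a.1 * b.2, a.1^* * b.1 + a.2 * b.2).

Lemma su_mul (R : realType) (a b : C2 R) : su (mulSU a b) = su a *m su b.
Proof.
apply/matrixP => i j; rewrite !mxE !big_ord_recl big_ord0 !mxE /= addr0.
case: (i == 0); case: (j == 0) => //=.
- by rewrite !(rmorphD, rmorphM) /= conjcK addrC.
- by rewrite !(rmorphD, rmorphM) /= conjcK addrC.
Qed.

Definition mobius (R : realType) (a : C2 R) (x : R[i]) : R[i] :=
  (su a 0 0 * x + su a 0 1) / (su a 1 0 * x + su a 1 1).

(* The class {a, -a} of a in PSU(1,1) = SU(1,1) / {1, -1}. *)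
Definition psu (R : realType) (a : C2 R) : set (C2 R) := [set a; - a].

Definition disc (R : realType) : set R[i] := [set x | `|x| < 1].

(* The real vector space C x R x R. As R[i] carries no topology in the libraries,
   the factor C is R x R here: the point ((x, y), alpha, r) stands for
   (z, alpha, r) with z = x + iy. *)
Definition V (R : realType) : normedModType R := ((R * R) * R * R)%type.

Definition vz (R : realType) (p : V R) : R[i] := p.1.1.1 +i* p.1.1.2.
Definition valpha (R : realType) (p : V R) : R := p.1.2.
Definition vr (R : realType) (p : V R) : R := p.2.
Definition mkV (R : realType) (z : R[i]) (alpha r : R) : V R :=
  ((complex.Re z, complex.Im z), alpha, r).

Definition expi (R : realType) (t : R) : R[i] := cos t +i* sin t.

Definition Lt (R : realType) : set (V R) :=
  [set p | 0 < vr p /\ normc (vz p) < vr p].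

Definition pi_cov (R : realType) (p : V R) : C2 R :=
  (vz p, (vr p)%:C * expi (valpha p)).

Definition Gt (R : realType) : set (V R) :=
  @Lt R `&` [set p | G (pi_cov p)].

(* The group law of the universal covering group: the unique lift of the law of
   SU(1,1) which is continuous and has neutral element (0, 0, 1). As
     w = conj z1 * z2 + w1 * w2 = w1 * w2 * (1 + conj z1 * z2 / (w1 * w2))
   and the last factor has positive real part on the group, its argument is the
   arctangent of the quotient of the imaginary and real parts. *)
Definition arg_right (R : realType) (q : R[i]) : R :=
  atan (complex.Im q / complex.Re q).

Definition mulG (R : realType) (p q : V R) : V R :=
  let a := pi_cov p in let b := pi_cov q in let c := mulSU a b in
  mkV c.1
      (valpha p + valpha q + arg_right (1 + a.1^* * b.1 / (a.2 * b.2)))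
      (normc c.2).

Lemma expiD (R : realType) (a b : R) : expi (a + b) = expi a * expi b.
Proof. by rewrite /expi cosD sinD; congr (_ +i* _); rewrite addrC mulrC. Qed.

Lemma normc_expi (R : realType) (a : R) : normc (expi a) = 1.
Proof. by rewrite /normc /expi cos2Dsin2 sqrtr1. Qed.

Lemma normc_real (R : realType) (r : R) : 0 <= r -> normc r%:C = r.
Proof. by move=> r0; rewrite /normc /= expr0n addr0 sqrtr_sqr ger0_norm. Qed.

Lemma normc_conj (R : realType) (z : R[i]) : normc z^* = normc z.
Proof. by case: z => a b; rewrite /normc /= sqrrN. Qed.

Lemma arg_rightP (R : realType) (q : R[i]) : 0 < complex.Re q ->
  (normc q)%:C * expi (arg_right q) = q.
Proof.
case: q => x y /= x0; rewrite /arg_right /expi /=.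
set t := y / x.
have c0 : 0 < cos (atan t) by rewrite cos_atan invr_gt0 sqrtr_gt0 ltr_wpDr ?sqr_ge0.
have st : sin (atan t) = t * cos (atan t).
  by have := atanK t; rewrite /tan => h; rewrite -[X in X * _]h divfK // gt_eqF.
have nE : Num.sqrt (x ^+ 2 + y ^+ 2) = x * Num.sqrt (1 + t ^+ 2).
  have -> : x ^+ 2 + y ^+ 2 = x ^+ 2 * (1 + t ^+ 2).
    by rewrite mulrDr mulr1 -exprMn /t mulrCA divff ?mulr1 // gt_eqF.
  by rewrite sqrtrM ?sqr_ge0 // sqrtr_sqr gtr0_norm.
have s0 : Num.sqrt (1 + t ^+ 2) != 0 by rewrite gt_eqF // sqrtr_gt0 ltr_wpDr ?sqr_ge0.
have nc : Num.sqrt (x ^+ 2 + y ^+ 2) * cos (atan t) = x by rewrite nE cos_atan mulfK.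
apply/eqP; rewrite eq_complex; apply/andP; split; apply/eqP => /=; rewrite ?st !mul0r ?subr0 ?addr0 ?nc //.
by rewrite mulrCA nc /t divfK // gt_eqF.
Qed.

Lemma Re_gt0 (R : realType) (s : R[i]) : normc s < 1 -> 0 < complex.Re (1 + s).
Proof.
case: s => a b; rewrite /normc /= => h.
have : `|a| < 1.
  by apply: le_lt_trans h; rewrite -sqrtr_sqr ler_sqrt ?addr_ge0 ?sqr_ge0 // lerDl sqr_ge0.
by rewrite ltr_norml => /andP[] ; rewrite addrC -ltrBlDr sub0r.
Qed.

Lemma pi_mulG (R : realType) (p q : V R) : Gt p -> Gt q ->
  pi_cov (mulG p q) = mulSU (pi_cov p) (pi_cov q).
Proof.
move=> [[r0 zr] _] [[s0 ws] _].
set a := pi_cov p; set b := pi_cov q.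
have na : normc a.2 = vr p by rewrite normcM normc_expi mulr1 normc_real // ltW.
have nb : normc b.2 = vr q by rewrite normcM normc_expi mulr1 normc_real // ltW.
have ab0 : a.2 * b.2 != 0.
  apply/eqP => h; have := congr1 (@normc R) h; rewrite (normcM a.2) na nb normc0 => /eqP.
  by rewrite gt_eqF // mulr_gt0.
set s := a.1^* * b.1 / (a.2 * b.2).
have ns : normc s < 1.
  rewrite /s normcM normcV (normcM a.1^*) (normcM a.2) na nb normc_conj ltr_pdivrMr ?mulr_gt0 // mul1r.
  have z0 (z : R[i]) : 0 <= normc z by case: z => *; exact: sqrtr_ge0.
  by apply: ltr_pM.
have E : (mulSU a b).2 = a.2 * b.2 * (1 + s).
  by rewrite mulrDr mulr1 /s [X in _ + X]mulrC divfK // addrC.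
rewrite (_ : pi_cov (mulG p q) = ((mulSU a b).1, (normc (mulSU a b).2)%:C *
    expi (valpha p + valpha q + arg_right (1 + s)))); last first.
  by rewrite [LHS]/pi_cov /vz /= -/a -/b -/s; congr pair; set m := _ + _; case: m.
rewrite [RHS]surjective_pairing; congr pair.
rewrite E normcM (normcM a.2) na nb rmorphM !expiD.
rewrite -[X in _ = _ * X](arg_rightP (Re_gt0 ns)) /a /b /pi_cov /=.
ring.
Qed.

Definition oneG (R : realType) : V R := mkV 0 0 1.

Definition invG (R : realType) (p : V R) : V R :=
  mkV (- vz p) (- valpha p) (vr p).

Definition scaleV (R : realType) (s : R) (p : V R) : V R :=
  mkV (s%:C * vz p) (valpha p) (s * vr p).

Definition lambda (R : realType) (p : V R) : R :=
  Num.sqrt (vr p ^+ 2 - normc (vz p) ^+ 2).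

Definition theta (R : realType) (p : V R) : V R := scaleV (lambda p)^-1 p.

Definition actG (R : realType) (g h x : V R) : V R := mulG (mulG g x) (invG h).

(* The action on the first factor of the trivialization (theta, lambda), whose
   inverse is (x, s) |-> s x. *)
Definition actL (R : realType) (g h p : V R) : V R :=
  scaleV (lambda p) (actG g h (theta p)).

Definition subgroup (R : realType) (Gam : set (V R)) : Prop :=
  [/\ Gam `<=` @Gt R, Gam (oneG R),
      (forall x y, Gam x -> Gam y -> Gam (mulG x y)) &
      (forall x, Gam x -> Gam (invG x))].

Definition discrete_subgroup (R : realType) (Gam : set (V R)) : Prop :=
  subgroup Gam /\ Gam `<=` isolated Gam.

Definition cyclic_subgroup (R : realType) (Gam : set (V R)) : Prop :=
  subgroup Gam /\ exists2 c, Gam c & forall x, Gam x ->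
    exists n : nat, x = iter n (mulG c) (oneG R)
                 \/ x = iter n (mulG (invG c)) (oneG R).

Definition centre (R : realType) : set (V R) :=
  [set z | Gt z /\ forall x, Gt x -> mulG z x = mulG x z].

Definition has_level (R : realType) (Gam : set (V R)) (k : nat) : Prop :=
  ([set mulG z @` (Gam `&` @centre R) | z in @centre R]
     #= `I_k)%card.

Definition actD (R : realType) (g : V R) (x : R[i]) : R[i] :=
  mobius (pi_cov g) x.

Definition psu_image (R : realType) (A : set (V R)) : set (set (C2 R)) :=
  [set psu (pi_cov g) | g in A].

Definition stabilizer (R : realType) (Gam : set (V R)) (u : R[i]) : set (V R) :=
  [set g | Gam g /\ actD g u = u].

Definition isotropy (R : realType) (Gam : set (V R)) (u : R[i]) :
  set (set (C2 R)) := psu_image (stabilizer Gam u).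

Definition fixed_by_nontrivial (R : realType) (Gam : set (V R)) (u : R[i]) :
    Prop :=
  exists2 c, isotropy Gam u c & c <> psu (pi_cov (oneG R)).

Definition condition_star (R : realType) (Gam1 Gam2 : set (V R)) (u : R[i])
    (k p1 p2 : nat) : Prop :=
  [/\ [/\ discrete_subgroup Gam1, discrete_subgroup Gam2 & cyclic_subgroup Gam2],
      has_level Gam1 k /\ has_level Gam2 k,
      [/\ disc u, fixed_by_nontrivial Gam1 u & fixed_by_nontrivial Gam2 u],
      (isotropy Gam1 u #= `I_p1)%card /\ (isotropy Gam2 u #= `I_p2)%card &
      (k < lcmn p1 p2)%N].

Definition Eset (R : realType) (g : V R) : set (V R) :=
  connected_component
    (@Lt R `&` [set a | form (pi_cov g) (pi_cov a) = -1]) g.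

Definition Iset (R : realType) (g : V R) : set (V R) :=
  connected_component
    (@Lt R `&` [set a | form (pi_cov g) (pi_cov a) <= -1]) g.

(* The closure of the component of the complement of E_g whose closure is not
   I_g. *)
Definition Hset (R : realType) (g : V R) : set (V R) :=
  [set a | exists y, let C := connected_component (@Lt R `\` Eset g) y in
    [/\ (@Lt R `\` Eset g) y, closure_in (@Lt R) C <> Iset g &
        closure_in (@Lt R) C a]].

Definition Qset (R : realType) (Gam1 Gam2 : set (V R)) (u x : R[i]) :
    set (V R) :=
  [set a | forall g1 g2, Gam1 g1 -> Gam2 g2 -> actD g1 u = x ->
     Hset (mulG g1 g2) a].

Definition Pset (R : realType) (Gam1 Gam2 : set (V R)) (u : R[i]) :
    set (V R) :=
  \bigcup_(x in [set actD g u | g in Gam1]) Qset Gam1 Gam2 u x.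

Definition bdP (R : realType) (Gam1 Gam2 : set (V R)) (u : R[i]) : set (V R) :=
  boundary_in (@Lt R) (Pset Gam1 Gam2 u).

Definition prodset (R : realType) (Gam1 Gam2 : set (V R)) : set (V R) :=
  [set mulG g1 g2 | g1 in Gam1 & g2 in Gam2].

Definition Fset (R : realType) (Gam1 Gam2 : set (V R)) (u : R[i]) (g : V R) :
    set (V R) :=
  let B := bdP Gam1 Gam2 u in
  closure_in B (interior_in B (boundary_in (@Lt R) (Hset g) `&` B)).

(* F g as a fundamental domain of X for Gam1 x Gam2; its translates are the
   sets F h with h in Gam1 Gam2. *)
Definition fundamental_domain (R : realType) (Gam1 Gam2 : set (V R))
    (act : V R -> V R -> V R -> V R) (X : set (V R)) (F : V R -> set (V R))
    (g : V R) : Prop :=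
  [/\ forall g1 g2, Gam1 g1 -> Gam2 g2 ->
        act g1 g2 @` F g = F (mulG (mulG g1 g) (invG g2)),
      forall h h', prodset Gam1 Gam2 h -> prodset Gam1 Gam2 h' -> h <> h' ->
        interior_in X (F h) `&` F h' = set0 &
      closure_in X (\bigcup_(h in prodset Gam1 Gam2) interior_in X (F h)) = X].

(* C^k maps on an open subset U, by iterated directional derivatives. *)
Fixpoint differentiable_class (R : realType) (W W' : normedModType R) (k : nat)
    (U : set W) (f : W -> W') : Prop :=
  match k with
  | 0 => forall x, U x -> {for x, continuous f}
  | k'.+1 => (forall x, U x -> differentiable f x) /\
             forall v : W, differentiable_class k' U ('D_v f)
  end.

Definition smooth_on (R : realType) (W W' : normedModType R) (U : set W)
    (f : W -> W') : Prop :=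
  forall k, differentiable_class k U f.

(* Embedded submanifolds of the 4-dimensional space V, as local zero sets of
   smooth submersions. *)
Definition submanifold (R : realType) (d : nat) (S : set (V R)) : Prop :=
  (d <= 4)%N /\ forall x, S x ->
    exists (U : set (V R)) (f : V R -> 'rV[R]_(4 - d)),
      [/\ open U, U x, smooth_on U f, S `&` U = [set y | U y /\ f y = 0] &
          forall y, S y -> U y ->
            forall c : 'rV[R]_(4 - d), exists v : V R, 'd f y v = c].

Definition tangent (R : realType) (S : set (V R)) (x v : V R) : Prop :=
  exists c : R -> V R,
    [/\ c 0 = x, \forall t \near (0 : R), S (c t), derivable c 0 1 &
        derive1 c 0 = v].

Definition deriveC (R : realType) (f : R -> R[i]) (t : R) : R[i] :=
  derive1 (fun s => complex.Re (f s)) t +i* derive1 (fun s => complex.Im (f s)) t.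

Definition deriveC2 (R : realType) (f : R -> C2 R) (t : R) : C2 R :=
  (deriveC (fun s => (f s).1) t, deriveC (fun s => (f s).2) t).

(* Germ at 0 of a geodesic of the covering group for the pulled-back metric. As G
   is a level set of the form in the flat space C^2, the Levi-Civita connection of
   G is the tangential part of the flat derivative: a curve is a geodesic if and
   only if its acceleration in C^2 is normal to G. *)
Definition geodesic_at0 (R : realType) (c : R -> V R) : Prop :=
  \forall t \near (0 : R),
    [/\ Gt (c t), derivable c t 1, derivable (derive1 c) t 1 &
        forall v : C2 R, form (pi_cov (c t)) v = 0 ->
          form (deriveC2 (deriveC2 (fun s => pi_cov (c s))) t) v = 0].

(* Every geodesic of the ambient group which starts tangentially to S stays in S
   for small times. This makes sense also if the metric is degenerate on S. *)
Definition totally_geodesic (R : realType) (d : nat) (S : set (V R)) : Prop :=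
  [/\ S `<=` @Gt R, submanifold d S &
      forall c : R -> V R, geodesic_at0 c -> S (c 0) ->
        tangent S (c 0) (derive1 c 0) -> \forall t \near (0 : R), S (c t)].

(* Main.v *)
From Pilot Require Import Defs.
From mathcomp Require Import all_boot all_order all_algebra.
From mathcomp Require Import complex ring lra.
From mathcomp Require Import all_classical all_reals all_analysis.
Set Implicit Arguments.
Unset Strict Implicit.
Unset Printing Implicit Defensive.
Import Order.TTheory GRing.Theory Num.Theory.
Import numFieldNormedType.Exports.
Import ComplexField.Normc.
Local Open Scope classical_set_scope.
Local Open Scope ring_scope.
Import Pilot.Defs.

(** Each half-space is a sublevel set of one function. The form with the image of g
    is positive where the angle differs from that of g by a half turn, so the sheets
    on which it is negative are separated there. Hence psi g, which is minus the form
    on the sheet through g and zero on the others, is continuous and homogeneous of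
    degree one along rays, and the sets E, I and H of g are psi g = 1, psi g >= 1 and
    psi g <= 1 (EsetE, IsetE, HsetE). The biinvariance of the metric appears as the
    invariance of psi under two-sided translations (psi_act).

    In the coordinates (theta, lambda) the polytope therefore is the set where
    lambda * minmax theta <= 1; here minmax b is the least value, over the points x of
    the orbit, of the greatest value of psi h b, over the products h = g1 g2 of the
    pairs (g1, g2) in T(x) (PsetE). It has to be shown that minmax is positive,
    continuous and invariant, and that near a point finitely many h realize it.
    Then the boundary of P is the graph of lambda = 1 / minmax, theta maps it
    homeomorphically onto the group, and the image of the face of h is the closure of
    the interior of the set where psi h = minmax.

    Condition (star) enters as follows. The second group is abelian and contains a
    nontrivial rotation about u, so it consists of rotations about u (abelian_fixes).
    The rotations about u in the i-th group are those by the multiples of k pi / p_i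
    (level_centre, isotropy_angles), so the two groups together provide all multiples
    of k pi / p, and k pi / p < pi because p > k (small_angle). The products over T(x)
    thus contain elements which differ by steps shorter than a half turn about u, and
    one of them points towards b within less than a quarter turn; turns are measured by
    the coordinate alpha, so the disc is rotated twice as far. This bounds the
    maximum of psi h b from above by rad and from below by kappa * rad, where rad is
    the hyperbolic cosine of half the distance from x to b(u) (psi_le_rad,
    block_large). Only the x with small rad compete for the minimum, and among their
    products only those with psi h b > 0 for the maximum; both bounds together
    confine h to a compact set, which contains finitely many products since the
    groups are discrete (discrete_finite, prodset_finite).

    If psi g and psi h agree and are positive near a point of the group, the
    difference of the images of g and h is orthogonal to an open piece of the group
    and hence zero, and then g = h because both sheets contain that point
    (psi_inj_near). So the interiors of distinct cells are disjoint. A neighbourhood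
    of a point is covered by finitely many of the closed sets psi h = minmax; an open
    set so covered meets the interior of one of them, which gives the covering
    property and local finiteness. On the intersection of the cells of g and h the
    forms with the images of g and h agree, so it lies in a hyperplane section
    form w x = 0 of the group. A geodesic X of the group satisfies X'' = c X with a
    scalar function c, so form w X solves a linear equation of second order and
    vanishes if it does so to first order: the section is totally geodesic
    (geodesic_hyperplane). *)

(** * The group law on the universal cover *)
Section Group.
Variable R : realType.
Local Open Scope complex_scope.
Implicit Types (p q x y g h : V R) (z : R[i]) (a b c : C2 R).

Lemma normc_sqr z : normc z ^+ 2 = complex.Re z ^+ 2 + complex.Im z ^+ 2.
Proof. by case: z => a b; rewrite /normc /= sqr_sqrtr // addr_ge0 // sqr_ge0. Qed.

Lemma normc_ge0 z : 0 <= normc z.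
Proof. by case: z => *; exact: sqrtr_ge0. Qed.

Lemma mkVK p : mkV (vz p) (valpha p) (vr p) = p.
Proof. by case: p => [[[a b] c] d]. Qed.

Lemma vz_mkV z (t r : R) : vz (mkV z t r) = z.
Proof. by case: z. Qed.

Lemma valpha_mkV z (t r : R) : valpha (mkV z t r) = t. Proof. by []. Qed.

Lemma vr_mkV z (t r : R) : vr (mkV z t r) = r. Proof. by []. Qed.

Definition mkVE := (vz_mkV, valpha_mkV, vr_mkV).

Lemma V_ext p q : vz p = vz q -> valpha p = valpha q -> vr p = vr q -> p = q.
Proof. by move=> h1 h2 h3; rewrite -(mkVK p) -(mkVK q) h1 h2 h3. Qed.

Lemma formE a b : form a b =
  complex.Re a.1 * complex.Re b.1 + complex.Im a.1 * complex.Im b.1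
  - complex.Re a.2 * complex.Re b.2 - complex.Im a.2 * complex.Im b.2.
Proof. by case: a => [[? ?] [? ?]]; case: b => [[? ?] [? ?]] /=; rewrite /form /=; ring. Qed.

Lemma form_pi p q : form (pi_cov p) (pi_cov q) =
  complex.Re (vz p) * complex.Re (vz q) + complex.Im (vz p) * complex.Im (vz q)
  - vr p * vr q * cos (valpha q - valpha p).
Proof. by rewrite formE /pi_cov /= cosB; ring. Qed.

Lemma form_piN p : form (pi_cov p) (pi_cov p) = normc (vz p) ^+ 2 - vr p ^+ 2.
Proof. by rewrite form_pi subrr cos0 normc_sqr; ring. Qed.

Lemma GtP p : Gt p <-> 0 < vr p /\ vr p ^+ 2 = 1 + normc (vz p) ^+ 2.
Proof.
split=> [[[r0 _] e]|[r0 e]].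
  have {}e : form (pi_cov p) (pi_cov p) = -1 := e.
  by move: e; rewrite form_piN => e; split => //; lra.
split; last by change (form (pi_cov p) (pi_cov p) = -1); rewrite form_piN e; lra.
have r1 := ltW r0; split => //; rewrite -(@ltr_pXn2r _ 2) ?nnegrE ?normc_ge0 //.
by rewrite e; lra.
Qed.

Lemma Gt_Lt p : Gt p -> Lt p. Proof. by case. Qed.
Lemma Gt_r0 p : Gt p -> 0 < vr p. Proof. by case=> -[]. Qed.
Lemma Gt_zr p : Gt p -> normc (vz p) < vr p. Proof. by case=> -[]. Qed.

Lemma Gt_r1 p : Gt p -> 1 <= vr p.
Proof.
move=> /GtP[r0 e]; have r1 := ltW r0; rewrite -(@ler_pXn2r _ 2) ?nnegrE // e expr1n.
by rewrite lerDl sqr_ge0.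
Qed.

Lemma Gt_one : Gt (oneG R).
Proof. by apply/GtP; rewrite /oneG !mkVE normc0 expr0n addr0 expr1n. Qed.

Lemma Gt_inv p : Gt p -> Gt (invG p).
Proof. by move=> /GtP[r0 e]; apply/GtP; rewrite /invG !mkVE normcN. Qed.

Lemma mulSU_form a b c :
  form (mulSU a b) (mulSU a c) = - form a a * form b c.
Proof.
move: a b c => [[? ?] [? ?]] [[? ?] [? ?]] [[? ?] [? ?]].
by rewrite !formE /mulSU /=; ring.
Qed.

Lemma mulSU_formr a b c :
  form (mulSU b a) (mulSU c a) = - form a a * form b c.
Proof.
move: a b c => [[? ?] [? ?]] [[? ?] [? ?]] [[? ?] [? ?]].
by rewrite !formE /mulSU /=; ring.
Qed.

Lemma mulSUA a b c : mulSU a (mulSU b c) = mulSU (mulSU a b) c.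
Proof.
move: a b c => [[? ?] [? ?]] [[? ?] [? ?]] [[? ?] [? ?]].
rewrite /mulSU /=; congr pair; apply/eqP; rewrite eq_complex /=; apply/andP; split; apply/eqP; ring.
Qed.

Lemma Gt_form p : Gt p -> form (pi_cov p) (pi_cov p) = -1.
Proof. by case. Qed.

Lemma normc_pi2 p : Gt p -> normc (pi_cov p).2 = vr p.
Proof. by move=> /Gt_r0 r0; rewrite normcM normc_expi mulr1 normc_real // ltW. Qed.

Lemma vr_mulG p q : vr (mulG p q) = normc (mulSU (pi_cov p) (pi_cov q)).2.
Proof. by []. Qed.

Lemma vz_mulG p q : vz (mulG p q) = (mulSU (pi_cov p) (pi_cov q)).1.
Proof. by rewrite vz_mkV. Qed.

Lemma Gt_mul p q : Gt p -> Gt q -> Gt (mulG p q).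
Proof.
move=> Gp Gq; have := mulSU_form (pi_cov p) (pi_cov q) (pi_cov q).
rewrite -!pi_mulG // (Gt_form Gp) (Gt_form Gq) opprK mul1r => f.
apply/GtP; move: (f); rewrite form_piN => f'.
have e : vr (mulG p q) ^+ 2 = 1 + normc (vz (mulG p q)) ^+ 2 by lra.
split => //; rewrite lt_neqAle normc_ge0 andbT eq_sym; apply/eqP => r0.
by move: e; rewrite r0; have := sqr_ge0 (normc (vz (mulG p q))); lra.
Qed.

(** The angle of the second component is additive up to this correction, which is
    the argument of a number with positive real part. *)
Definition cocycle p q : R :=
  arg_right (1 + (pi_cov p).1^* * (pi_cov q).1 / ((pi_cov p).2 * (pi_cov q).2)).

Lemma valpha_mulG p q : valpha (mulG p q) = valpha p + valpha q + cocycle p q.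
Proof. by []. Qed.

Lemma cocycle_lt p q : `|cocycle p q| < pi / 2.
Proof. by rewrite /cocycle /arg_right ltr_norml atan_gtNpi2 atan_ltpi2. Qed.

Lemma expi_inj (s t : R) : expi s = expi t -> `|s - t| < 2 * pi -> s = t.
Proof.
move=> e lt.
have c1 : cos (s - t) = 1.
  move: e => [ce se]; rewrite cosB ce se -!expr2; exact: cos2Dsin2.
have p0 := pi_gt0 R.
have : sin ((s - t) / 2) ^+ 2 = 0.
  have -> : sin ((s - t) / 2) ^+ 2 = (1 - cos (s - t)) / 2.
    have -> : s - t = (s - t) / 2 + (s - t) / 2 by field.
    rewrite cosD -!expr2.
    rewrite (_ : ((s - t) / 2 + (s - t) / 2) / 2 = (s - t) / 2); last by field.
    by have := cos2Dsin2 ((s - t) / 2) => h; lra.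
  by rewrite c1; lra.
move/eqP; rewrite expf_eq0 /= => /eqP s0.
have : (s - t) / 2 = 0; last by lra.
apply/eqP; apply/negPn/negP => n0.
have : 0 < `|sin ((s - t) / 2)|; last by rewrite s0 normr0 ltxx.
case: (ltgtP ((s - t) / 2) 0) => [n|n|/eqP]; last by rewrite (negbTE n0).
  rewrite -normrN -sinN gtr0_norm sin_gt0_pi //; apply/andP; split; first by lra.
    by move: lt; rewrite ltr_norml => /andP[] *; lra.
  by lra.
  by move: lt; rewrite ltr_norml => /andP[] *; lra.
rewrite gtr0_norm sin_gt0_pi // n; by move: lt; rewrite ltr_norml => /andP[] *; lra.
Qed.

(** A point of the covering group is determined by its image together with its
    angle up to an error smaller than one full turn. Every identity of the group
    law below follows from the identity in the matrix group, because the cocycles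
    that occur add up to less than a full turn. *)
Lemma lift_uniq p q : Gt p -> Gt q -> pi_cov p = pi_cov q ->
  `|valpha p - valpha q| < 2 * pi -> p = q.
Proof.
move=> Gp Gq e lt.
have er : vr p = vr q by rewrite -!normc_pi2 // e.
apply: V_ext => //; first by have := congr1 fst e.
apply: expi_inj => //.
have := congr1 snd e; rewrite /pi_cov /= er => /mulfI; apply.
by rewrite -[0]/(0%:C) (inj_eq (@complexI R)) gt_eqF // Gt_r0.
Qed.

Lemma pi_one : pi_cov (oneG R) = (0, 1).
Proof. by rewrite /pi_cov /oneG !mkVE /expi cos0 sin0 mul1r. Qed.

Lemma pi_inv p : pi_cov (invG p) = (- (pi_cov p).1, (pi_cov p).2^*).
Proof.
rewrite /pi_cov /invG !mkVE /expi cosN sinN; congr pair.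
by apply/eqP; rewrite eq_complex /=; apply/andP; split; apply/eqP; ring.
Qed.

Ltac cocycle_bounds := rewrite ?valpha_mulG;
  repeat match goal with |- context [cocycle ?p ?q] =>
    let c := fresh "c" in have := cocycle_lt p q; move: (cocycle p q) => c end;
  have := pi_gt0 R; rewrite !ltr_norml.

Lemma mulGA p q x : Gt p -> Gt q -> Gt x ->
  mulG p (mulG q x) = mulG (mulG p q) x.
Proof.
move=> Gp Gq Gx; have ? := Gt_mul Gp Gq; have ? := Gt_mul Gq Gx.
apply: lift_uniq; rewrite ?pi_mulG ?mulSUA //; do ?exact: Gt_mul.
by cocycle_bounds => ? /andP[? ?] /andP[? ?] /andP[? ?] /andP[? ?]; lra.
Qed.

Lemma mul1G p : Gt p -> mulG (oneG R) p = p.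
Proof.
move=> Gp; have ? := Gt_one; apply: lift_uniq => //; first exact: Gt_mul.
  rewrite pi_mulG // pi_one /mulSU /= mul0r addr0 raddf0 mul0r add0r.
  by rewrite rmorph1 !mul1r.
by cocycle_bounds => ? /andP[? ?]; rewrite /valpha /=; apply/andP; split; lra.
Qed.

Lemma mulG1 p : Gt p -> mulG p (oneG R) = p.
Proof.
move=> Gp; have ? := Gt_one; apply: lift_uniq => //; first exact: Gt_mul.
  rewrite pi_mulG // pi_one /mulSU /= !mulr0 !add0r !mulr1.
  by [].
by cocycle_bounds => ? /andP[? ?]; rewrite /valpha /=; apply/andP; split; lra.
Qed.

Lemma invGK p : invG (invG p) = p.
Proof. by case: p => [[[a b] c] d]; rewrite /invG /mkV /vz /valpha /vr /= !opprK. Qed.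

Lemma mulVG p : Gt p -> mulG (invG p) p = oneG R.
Proof.
move=> Gp; have ? := Gt_one; have Gi := Gt_inv Gp.
apply: lift_uniq => //; first exact: Gt_mul.
  have := Gt_form Gp; rewrite pi_mulG // pi_one pi_inv formE /mulSU /=.
  case: (pi_cov p) => [[a b] [c d]] /= e; congr pair; apply/eqP; rewrite eq_complex /=; apply/andP; split; apply/eqP; lra.
by cocycle_bounds => ? /andP[? ?]; rewrite /valpha /=; apply/andP; split; lra.
Qed.

Lemma mulGV p : Gt p -> mulG p (invG p) = oneG R.
Proof. by move=> Gp; rewrite -{1}(invGK p) mulVG //; exact: Gt_inv. Qed.

Lemma mulKG p q : Gt p -> Gt q -> mulG (invG p) (mulG p q) = q.
Proof. by move=> Gp Gq; have ? := Gt_inv Gp; rewrite mulGA // mulVG // mul1G. Qed.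

Lemma mulKVG p q : Gt p -> Gt q -> mulG p (mulG (invG p) q) = q.
Proof. by move=> Gp Gq; have ? := Gt_inv Gp; rewrite mulGA // mulGV // mul1G. Qed.

Lemma mulGK p q : Gt p -> Gt q -> mulG (mulG p q) (invG q) = p.
Proof. by move=> Gp Gq; have ? := Gt_inv Gq; rewrite -mulGA // mulGV // mulG1. Qed.

Lemma mulGKV p q : Gt p -> Gt q -> mulG (mulG p (invG q)) q = p.
Proof. by move=> Gp Gq; have ? := Gt_inv Gq; rewrite -mulGA // mulVG // mulG1. Qed.

Lemma invG_uniq p q : Gt p -> Gt q -> mulG p q = oneG R -> invG p = q.
Proof.
by move=> Gp Gq e; rewrite -[RHS](mulKG Gp) // e mulG1 //; exact: Gt_inv.
Qed.

Lemma invMG p q : Gt p -> Gt q -> invG (mulG p q) = mulG (invG q) (invG p).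
Proof.
move=> Gp Gq; have ? := Gt_inv Gp; have ? := Gt_inv Gq; have ? := Gt_mul Gp Gq.
apply: invG_uniq => //; first exact: Gt_mul.
by rewrite mulGA // mulGK // mulGV.
Qed.

(** The rotations about the centre of the disc. As turn t rotates the disc by the angle
    -2t, the turns by multiples of pi act trivially; they form the centre. *)
Definition turn (t : R) : V R := mkV 0 t 1.

Lemma Gt_turn t : Gt (turn t).
Proof. by apply/GtP; rewrite /turn !mkVE normc0 expr0n addr0 expr1n. Qed.

Lemma pi_turn t : pi_cov (turn t) = (0, expi t).
Proof. by rewrite /pi_cov /turn !mkVE mul1r. Qed.

Lemma cocycle_turnl t p : cocycle (turn t) p = 0.
Proof.
rewrite /cocycle pi_turn /= raddf0 !mul0r addr0 /arg_right /= mul0r.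
exact: atan0.
Qed.

Lemma mulG_turnl t p : Gt p ->
  mulG (turn t) p = mkV ((expi t)^* * vz p) (t + valpha p) (vr p).
Proof.
move=> Gp; apply: V_ext.
- by rewrite vz_mulG vz_mkV pi_turn /mulSU /= mul0r addr0.
- by rewrite valpha_mulG cocycle_turnl addr0.
- have e : (mulSU (pi_cov (turn t)) (pi_cov p)).2 = expi t * (pi_cov p).2.
    by rewrite pi_turn /mulSU /= raddf0 mul0r add0r.
  by rewrite vr_mulG e normcM normc_expi mul1r normc_pi2.
Qed.

Lemma cocycle_turnr t p : cocycle p (turn t) = 0.
Proof.
rewrite /cocycle pi_turn /= mulr0 mul0r addr0 /arg_right /= mul0r.
exact: atan0.
Qed.

Lemma mulG_turnr t p : Gt p ->
  mulG p (turn t) = mkV (vz p * expi t) (valpha p + t) (vr p).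
Proof.
move=> Gp; apply: V_ext.
- by rewrite vz_mulG vz_mkV pi_turn /mulSU /= mulr0 add0r.
- by rewrite valpha_mulG cocycle_turnr addr0.
- have e : (mulSU (pi_cov p) (pi_cov (turn t))).2 = (pi_cov p).2 * expi t.
    by rewrite pi_turn /mulSU /= mulr0 add0r.
  by rewrite vr_mulG e normcM normc_expi mulr1 normc_pi2.
Qed.

Lemma turnD s t : mulG (turn s) (turn t) = turn (s + t).
Proof. by rewrite mulG_turnl ?vz_mkV ?mulr0 //; exact: Gt_turn. Qed.

Lemma turn0 : turn 0 = oneG R. Proof. by []. Qed.

Lemma turnN t : invG (turn t) = turn (- t).
Proof. by rewrite /invG vz_mkV oppr0. Qed.

Lemma turn_inj : injective turn.
Proof. by move=> s t /(congr1 (@valpha R)). Qed.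

Lemma vz0_turn p : Gt p -> vz p = 0 -> p = turn (valpha p).
Proof.
move=> /GtP[r0 e] z0; apply: V_ext; rewrite ?vz_mkV //.
move: e; rewrite z0 normc0 expr0n addr0 => /eqP.
by rewrite sqrf_eq1 => /orP[/eqP //|/eqP e]; lra.
Qed.

Lemma cos_intmul_pi (n : int) : cos (n%:~R * pi : R) ^+ 2 = 1 /\ sin (n%:~R * pi : R) = 0.
Proof.
have s0 : sin (n%:~R * pi : R) = 0.
  have natc (m : nat) : sin (m%:R * pi : R) = 0.
    elim: m => [|m IH]; first by rewrite mul0r sin0.
    by rewrite -natr1 mulrDl mul1r sinDpi IH oppr0.
  by case: n => m; rewrite ?NegzE ?mulrNz ?mulNr ?sinN ?natc ?oppr0 //; apply: natc.
by split=> //; have := cos2Dsin2 (n%:~R * pi : R); rewrite s0 expr0n addr0.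
Qed.

Lemma sin0_intmul_pi (t : R) : sin t = 0 -> exists n : int, t = n%:~R * pi.
Proof.
move=> st; have p0 := pi_gt0 R.
have [n /andP[n1 n2]] : exists n : int, (n%:~R <= t / pi) && (t / pi < n%:~R + 1).
  by exists (Num.floor (t / pi)); rewrite -intrD1 floor_itv.
exists n; apply/eqP; rewrite -subr_eq0; apply/negPn/negP => ne.
have : 0 < sin (t - n%:~R * pi).
  move: n1 n2; rewrite ler_pdivlMr // ltr_pdivrMr // => n1 n2.
  apply: sin_gt0_pi; rewrite lt_neqAle eq_sym ne /=; lra.
by rewrite sinB st (cos_intmul_pi n).2 mul0r mulr0 subrr ltxx.
Qed.

Lemma expi_pi_conj (n : int) : ((expi (n%:~R * pi : R))^*)%R = expi (n%:~R * pi).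
Proof. by rewrite /expi (cos_intmul_pi n).2; congr (_ +i* _); exact: oppr0. Qed.

Lemma turn_pi_comm (n : int) p : Gt p ->
  mulG (turn (n%:~R * pi)) p = mulG p (turn (n%:~R * pi)).
Proof.
by move=> Gp; rewrite mulG_turnl // mulG_turnr // expi_pi_conj mulrC [_ + valpha p]addrC.
Qed.

(** An element that commutes with the quarter turn has vanishing z, so it is a turn;
    as it also commutes with an element with z = 1, the sine of its angle vanishes. *)
Lemma centreP p : centre p <-> exists n : int, p = turn (n%:~R * pi).
Proof.
split=> [[Gp com]|[n ->]]; last by split; [exact: Gt_turn|exact: turn_pi_comm].
have z0 : vz p = 0.
  have := congr1 (@vz R) (com _ (Gt_turn (pi / 2))).
  rewrite mulG_turnl // mulG_turnr // !vz_mkV /expi cos_pihalf sin_pihalf.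
  by case: (vz p) => a b /= [e1 e2]; apply/eqP; rewrite eq_complex /=; apply/andP; split; apply/eqP; lra.
have e := vz0_turn Gp z0.
pose q := mkV 1 0 (Num.sqrt 2) : V R.
have Gq : Gt q.
  apply/GtP; rewrite !mkVE sqrtr_gt0 ltr0n; split => //.
  by rewrite sqr_sqrtr ?ler0n // normc_sqr /=; ring.
have [|n en] := @sin0_intmul_pi (valpha p); last by exists n; rewrite -en.
have := congr1 (@vz R) (com q Gq); rewrite e mulG_turnl // mulG_turnr // !vz_mkV.
by rewrite mulr1 mul1r => -[]; lra.
Qed.

End Group.

(** * Continuity in the coordinates *)
Section Continuity.
Variable R : realType.
Local Open Scope complex_scope.
Implicit Types (p q x y g h a b : V R).

Lemma near_eq_to (T : Type) (U : topologicalType) (F : set_system T) (FF : Filter F)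
  (f g : T -> U) (l : U) :
  (\forall x \near F, f x = g x) -> g @ F --> l -> f @ F --> l.
Proof.
move=> e; apply: cvg_trans; apply: near_eq_cvg.
by apply: filterS e => x ->.
Qed.

Lemma near_lt (T : topologicalType) (f : T -> R) (a : T) c :
  {for a, continuous f} -> f a < c -> nbhs a [set b | f b < c].
Proof.
move=> h l; apply: (h [set t | t < c]); apply: open_nbhs_nbhs.
by split => //; exact: open_lt.
Qed.

Lemma near_gt (T : topologicalType) (f : T -> R) (a : T) c :
  {for a, continuous f} -> c < f a -> nbhs a [set b | c < f b].
Proof.
move=> h l; apply: (h [set t | c < t]); apply: open_nbhs_nbhs.
by split => //; exact: open_gt.
Qed.

Lemma cvg_vzRe (T : Type) (F : set_system T) {FF : Filter F} (f : T -> V R) p :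
  f @ F --> p -> (fun t => complex.Re (vz (f t))) @ F --> complex.Re (vz p).
Proof.
move=> h; have h1 : (fun t => (f t).1) @ F --> p.1 by apply: cvg_comp h _; exact: cvg_fst.
have h2 : (fun t => (f t).1.1) @ F --> p.1.1 by apply: cvg_comp h1 _; exact: cvg_fst.
by apply: cvg_comp h2 _; exact: cvg_fst.
Qed.

Lemma cvg_vzIm (T : Type) (F : set_system T) {FF : Filter F} (f : T -> V R) p :
  f @ F --> p -> (fun t => complex.Im (vz (f t))) @ F --> complex.Im (vz p).
Proof.
move=> h; have h1 : (fun t => (f t).1) @ F --> p.1 by apply: cvg_comp h _; exact: cvg_fst.
have h2 : (fun t => (f t).1.1) @ F --> p.1.1 by apply: cvg_comp h1 _; exact: cvg_fst.
by apply: cvg_comp h2 _; exact: cvg_snd.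
Qed.

Lemma cvg_valpha (T : Type) (F : set_system T) {FF : Filter F} (f : T -> V R) p :
  f @ F --> p -> (fun t => valpha (f t)) @ F --> valpha p.
Proof.
move=> h; have h1 : (fun t => (f t).1) @ F --> p.1 by apply: cvg_comp h _; exact: cvg_fst.
by apply: cvg_comp h1 _; exact: cvg_snd.
Qed.

Lemma cvg_vr (T : Type) (F : set_system T) {FF : Filter F} (f : T -> V R) p :
  f @ F --> p -> (fun t => vr (f t)) @ F --> vr p.
Proof. by move=> h; apply: cvg_comp h _; exact: cvg_snd. Qed.

Lemma cvg_coords (T : Type) (F : set_system T) (FF : Filter F) (f : T -> V R) p :
  f @ F --> p -> [/\ (fun t => complex.Re (vz (f t))) @ F --> complex.Re (vz p),
  (fun t => complex.Im (vz (f t))) @ F --> complex.Im (vz p),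
  (fun t => valpha (f t)) @ F --> valpha p &
  (fun t => vr (f t)) @ F --> vr p].
Proof. by move=> h; split; [exact: cvg_vzRe|exact: cvg_vzIm|exact: cvg_valpha|exact: cvg_vr]. Qed.

Lemma cvg_V (T : Type) (F : set_system T) {FF : Filter F} (f : T -> V R) p :
  (fun t => complex.Re (vz (f t))) @ F --> complex.Re (vz p) ->
  (fun t => complex.Im (vz (f t))) @ F --> complex.Im (vz p) ->
  (fun t => valpha (f t)) @ F --> valpha p ->
  (fun t => vr (f t)) @ F --> vr p -> f @ F --> p.
Proof.
move=> h1 h2 h3 h4.
have -> : f = fun t => ((complex.Re (vz (f t)), complex.Im (vz (f t))), valpha (f t), vr (f t)).
  by apply/funext => t; case: (f t) => [[[? ?] ?] ?].
have -> : p = ((complex.Re (vz p), complex.Im (vz p)), valpha p, vr p).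
  by case: p {h1 h2 h3 h4} => [[[? ?] ?] ?].
exact: (cvg_pair (cvg_pair (cvg_pair h1 h2) h3) h4).
Qed.

Lemma cvg_normc (T : Type) (F : set_system T) {FF : Filter F} (f : T -> R[i]) z :
  (fun t => complex.Re (f t)) @ F --> complex.Re z ->
  (fun t => complex.Im (f t)) @ F --> complex.Im z ->
  (fun t => normc (f t)) @ F --> normc z.
Proof.
move=> h1 h2.
have -> : (fun t => normc (f t)) =
    fun t => Num.sqrt (complex.Re (f t) ^+ 2 + complex.Im (f t) ^+ 2).
  by apply/funext => t; case: (f t).
have -> : normc z = Num.sqrt (complex.Re z ^+ 2 + complex.Im z ^+ 2) by case: z {h1 h2}.
apply: (@cvg_comp _ _ _ _ Num.sqrt _ (nbhs (complex.Re z ^+ 2 + complex.Im z ^+ 2))); last exact: sqrt_continuous.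
by apply: cvgD; rewrite expr2; under eq_fun do rewrite expr2; apply: cvgM.
Qed.

Lemma cvg_form g (T : Type) (F : set_system T) {FF : Filter F} (f : T -> V R) p :
  f @ F --> p ->
  (fun t => form (pi_cov g) (pi_cov (f t))) @ F --> form (pi_cov g) (pi_cov p).
Proof.
move=> h; under eq_fun do rewrite form_pi; rewrite form_pi.
have [h1 h2 h3 h4] := cvg_coords FF h.
apply: cvgB; first by apply: cvgD; apply: cvgM => //; exact: cvg_cst.
apply: cvgM; first by apply: cvgM => //; exact: cvg_cst.
have h5 : (fun t => valpha (f t) - valpha g) @ F --> valpha p - valpha g.
  by apply: cvgB => //; exact: cvg_cst.
by apply: cvg_comp h5 _; exact: continuous_cos.
Qed.

Lemma scaleVE (s : R) p : scaleV s p = ((s * p.1.1.1, s * p.1.1.2), p.1.2, s * p.2).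
Proof.
case: p => [[[a b] c] d]; rewrite /scaleV /mkV /vz /valpha /vr /=.
by rewrite !mul0r subr0 addr0.
Qed.

Lemma vz_scale (s : R) p : vz (scaleV s p) = s%:C * vz p.
Proof. by rewrite vz_mkV. Qed.
Lemma vr_scale (s : R) p : vr (scaleV s p) = s * vr p. Proof. by []. Qed.
Lemma valpha_scale (s : R) p : valpha (scaleV s p) = valpha p. Proof. by []. Qed.

Lemma scaleVA (s t : R) p : scaleV s (scaleV t p) = scaleV (s * t) p.
Proof. by rewrite !scaleVE /= !mulrA. Qed.

Lemma scaleV1 p : scaleV 1 p = p.
Proof. by rewrite scaleVE !mul1r; case: p => [[[? ?] ?] ?]. Qed.

Lemma Lt_scale (s : R) p : 0 < s -> Lt p -> Lt (scaleV s p).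
Proof.
move=> s0 [r0 zr]; split; first by rewrite vr_scale mulr_gt0.
by rewrite vr_scale vz_scale normcM normc_real ?ltW // ltr_pM2l.
Qed.

Lemma form_scale g (s : R) p :
  form (pi_cov g) (pi_cov (scaleV s p)) = s * form (pi_cov g) (pi_cov p).
Proof.
rewrite !form_pi vz_scale vr_scale valpha_scale.
by case: (vz p) => a b /=; ring.
Qed.

Lemma cvg_scaleV (T : Type) (F : set_system T) {FF : Filter F}
  (c : T -> R) (f : T -> V R) d p : c @ F --> d -> f @ F --> p ->
  (fun t => scaleV (c t) (f t)) @ F --> scaleV d p.
Proof.
move=> hc h.
have [h1 h2 h3 h4] := cvg_coords FF h.
have e1 (s : R) q : complex.Re (vz (scaleV s q)) = s * complex.Re (vz q) by rewrite scaleVE.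
have e2 (s : R) q : complex.Im (vz (scaleV s q)) = s * complex.Im (vz q) by rewrite scaleVE.
apply: cvg_V; rewrite ?e1 ?e2 ?vr_scale.
- by under eq_fun do rewrite e1; apply: cvgM.
- by under eq_fun do rewrite e2; apply: cvgM.
- by [].
- by under eq_fun do rewrite vr_scale; apply: cvgM.
Qed.

Lemma open_Lt : open (@Lt R).
Proof.
have -> : @Lt R = (fun p => vr p) @^-1` [set r | 0 < r] `&`
    (fun p => vr p - normc (vz p)) @^-1` [set r | 0 < r].
  by apply/seteqP; split=> p [/= ? ?]; split => //=; rewrite ?subr_gt0 // -subr_gt0.
apply: openI; apply: open_comp; try exact: open_gt; move=> p _; first exact: cvg_vr.
apply: cvgB; first exact: cvg_vr.
by apply: cvg_normc; [exact: cvg_vzRe|exact: cvg_vzIm].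
Qed.

Lemma nbhs_Lt p : Lt p -> nbhs p (@Lt R).
Proof. by move=> Lp; apply: open_nbhs_nbhs; split => //; exact: open_Lt. Qed.

(** The function whose level one is the boundary of the half-space of g, namely
    minus the form on the sheet through g and zero on the other sheets. The form
    is positive where the angles differ by a half turn, so the sheets where it is
    negative are separated by these angles. *)
Definition psi g a : R :=
  if `|valpha a - valpha g| < pi
  then Num.max 0 (- form (pi_cov g) (pi_cov a)) else 0.

Lemma psi_ge0 g a : 0 <= psi g a.
Proof. by rewrite /psi; case: ifP => // _; rewrite le_max lexx. Qed.

Lemma psi_scale g (s : R) a : 0 <= s -> psi g (scaleV s a) = s * psi g a.
Proof.
move=> s0; rewrite /psi valpha_scale form_scale; case: ifP => _; last by rewrite mulr0.
by rewrite maxr_pMr // mulr0 mulrN.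
Qed.

Lemma psi_gt0 g a : 0 < psi g a <->
  `|valpha a - valpha g| < pi /\ form (pi_cov g) (pi_cov a) < 0.
Proof.
rewrite /psi; case: ifP => h; last by rewrite ltxx; split => // -[].
by rewrite lt_max ltxx /= oppr_gt0; split => [|[]].
Qed.

Lemma psi_form g a : 0 < psi g a -> psi g a = - form (pi_cov g) (pi_cov a).
Proof.
move=> /psi_gt0[h1 h2]; rewrite /psi h1; apply/max_idPr; lra.
Qed.

Lemma Re_mul_le (z w : R[i]) :
  `|complex.Re z * complex.Re w + complex.Im z * complex.Im w| <= normc z * normc w.
Proof.
have n0 : 0 <= normc z * normc w by rewrite mulr_ge0 // normc_ge0.
rewrite -(@ler_pXn2r _ 2) ?nnegrE // exprMn !normc_sqr real_normK ?num_real //.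
by case: z {n0} => a b; case: w => c d /=; have := sqr_ge0 (a * d - b * c); nra.
Qed.

Lemma form_opposite g a : Lt g -> Lt a ->
  `|valpha a - valpha g| = pi -> 0 < form (pi_cov g) (pi_cov a).
Proof.
move=> [g0 zg] [a0 za] e; rewrite form_pi.
have -> : cos (valpha a - valpha g) = -1.
  by rewrite -cos_norm e cospi.
have := Re_mul_le (vz g) (vz a); rewrite ler_norml => /andP[h _].
have : normc (vz g) * normc (vz a) < vr g * vr a.
  have g1 := normc_ge0 (vz g); have a1 := normc_ge0 (vz a).
  by apply: ltr_pM.
by lra.
Qed.

Lemma cvg_psi g a : Lt g -> Lt a -> {for a, continuous (psi g)}.
Proof.
move=> Lg La.
have ca : (fun b => `|valpha b - valpha g|) @ a --> `|valpha a - valpha g|.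
  by apply: cvg_norm; apply: cvgB; [exact: cvg_valpha|exact: cvg_cst].
have cf : (fun b => form (pi_cov g) (pi_cov b)) @ a --> form (pi_cov g) (pi_cov a).
  exact: cvg_form.
have fS (P Q : set (V R)) : P `<=` Q -> nbhs a P -> nbhs a Q.
  by move=> PQ; apply: filterS.
have zero : (\forall b \near a, psi g b = 0) -> {for a, continuous (psi g)}.
  move=> z; rewrite /continuous_at /prop_for (nbhs_singleton z).
  by apply: (near_eq_to (nbhs_filter a) z); exact: cvg_cst.
case: (ltrgtP `|valpha a - valpha g| pi) => h.
- have e : \forall b \near a, psi g b = Num.max 0 (- form (pi_cov g) (pi_cov b)).
    by move: (near_lt ca h); apply: fS => b /= hb; rewrite /psi hb.
  rewrite /continuous_at /prop_for (nbhs_singleton e).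
  apply: (near_eq_to (nbhs_filter a) e).
  apply: (@continuous_max R _ (cst 0) (fun b => - form (pi_cov g) (pi_cov b))).
    exact: cvg_cst.
  exact: cvgN.
- apply: zero; move: (near_gt ca h); apply: fS => b /= hb.
  by rewrite /psi ltNge ltW.
- apply: zero; move: (near_gt cf (form_opposite Lg La h)); apply: fS => b /= hb.
  by rewrite /psi; case: ifP => // _; apply/max_idPl; lra.
Qed.

End Continuity.

(** * Half-spaces *)
Section HalfSpaces.
Variable R : realType.
Local Open Scope complex_scope.
Implicit Types (p q x y g h a b : V R) (T : topologicalType).

Lemma closure_inP T (X A : set T) : A `<=` X -> closure_in X A = closure A `&` X.
Proof. exact: closure_subspaceW. Qed.

Lemma interior_in_sub T (X A : set T) : interior_in X A `<=` A.
Proof. exact: (@interior_subset (subspace X)). Qed.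

Lemma interior_inP T (X A : set T) (x : T) : X x ->
  interior_in X A x <-> exists2 U, nbhs x U & U `&` X `<=` A.
Proof.
move=> Xx; rewrite /interior_in /interior /=; split.
  move=> /(nbhs_subspace_ex _ Xx)[U nU e]; exists U => // y [Uy Xy].
  by have [] : (A `&` X) y by rewrite e.
move=> [U nU UA]; apply/(nbhs_subspace_ex _ Xx); exists (U `|` A).
  by apply: filterS nU => y; left.
apply/seteqP; split=> y [h Xy]; split => //; first by right.
by case: h => // h; exact: UA.
Qed.

Definition seg a b (t : R) : V R :=
  ((((1 - t) * a.1.1.1 + t * b.1.1.1, (1 - t) * a.1.1.2 + t * b.1.1.2),
    (1 - t) * a.1.2 + t * b.1.2), (1 - t) * a.2 + t * b.2).

Lemma seg0 a b : seg a b 0 = a.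
Proof.
by rewrite /seg subr0 !mul1r !mul0r !addr0; case: a => [[[? ?] ?] ?].
Qed.

Lemma seg1 a b : seg a b 1 = b.
Proof.
by rewrite /seg subrr !mul1r !mul0r !add0r; case: b => [[[? ?] ?] ?].
Qed.

Lemma seg_continuous a b : continuous (seg a b).
Proof.
have lin (c d : R) : continuous (fun t : R => (1 - t) * c + t * d).
  move=> t; apply: cvgD; apply: cvgM; try exact: cvg_cst; last exact: cvg_id.
  by apply: cvgB; [exact: cvg_cst|exact: cvg_id].
by move=> t; apply: cvg_V; exact: lin.
Qed.

Lemma seg_connected a b : connected (seg a b @` `[0, 1]).
Proof.
apply: connected_continuous_connected; first exact: segment_connected.
by apply: continuous_subspaceT; exact: seg_continuous.
Qed.

(** The regions to which this applies are not star-shaped, but two segments per point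
    suffice: the first one moves to an intermediate point from which b is visible. *)
Lemma star_connected (S : set (V R)) b :
  (forall a, S a -> exists c, forall t, 0 <= t <= 1 -> S (seg a c t) /\ S (seg c b t)) ->
  connected S.
Proof.
move=> st.
have -> : S = \bigcup_(C in [set C : set (V R) | [/\ C b, C `<=` S & connected C]]) C.
  apply/seteqP; split=> [a Sa|a [C [_ CS _] Ca]]; last exact: CS.
  have [c cs] := st a Sa.
  have i0 : (`[0, 1]%classic : set R) 0 by rewrite /= in_itv /= lexx ler01.
  have i1 : (`[0, 1]%classic : set R) 1 by rewrite /= in_itv /= lexx ler01.
  exists (seg a c @` `[0, 1] `|` seg c b @` `[0, 1]); last by left; exists 0 => //; rewrite seg0.
  split; first by right; exists 1 => //; rewrite seg1.
    by move=> y [] [t]; rewrite /= in_itv /= => /cs[? ?] <-.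
  apply: connectedU; try exact: seg_connected.
  by exists c; split; [exists 1; rewrite ?seg1|exists 0; rewrite ?seg0].
apply: bigcup_connected; last by move=> C [].
by exists b => C [].
Qed.

Lemma seg_Lt a b t : 0 <= t <= 1 -> Lt a -> Lt b -> Lt (seg a b t).
Proof.
move=> /andP[t0 t1] [a0 za] [b0 zb].
have e : vz (seg a b t) = (1 - t)%:C * vz a + t%:C * vz b.
  by apply/eqP; rewrite eq_complex /seg /vz /=; apply/andP; split; apply/eqP; ring.
have er : vr (seg a b t) = (1 - t) * vr a + t * vr b by [].
have t1' : 0 <= 1 - t by rewrite subr_ge0.
have n : normc (vz (seg a b t)) < vr (seg a b t).
  rewrite e er; apply: le_lt_trans (le_normcD _ _) _.
  rewrite !normcM !normc_real //.
  have [->|tn0] := eqVneq t 0; first by rewrite subr0 !mul0r !mul1r !addr0.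
  have tp : 0 < t by rewrite lt_neqAle eq_sym tn0.
  by apply: ler_ltD; [apply: ler_wpM2l => //; exact: ltW|rewrite ltr_pM2l].
by split => //; apply: le_lt_trans n; exact: normc_ge0.
Qed.

Lemma psi_self g : Gt g -> psi g g = 1.
Proof.
move=> Gg; rewrite /psi subrr normr0 pi_gt0 (Gt_form Gg) opprK.
by apply/max_idPr; exact: ler01.
Qed.

Lemma psi_geN g a : `|valpha a - valpha g| < pi ->
  - form (pi_cov g) (pi_cov a) <= psi g a.
Proof. by move=> h; rewrite /psi h le_max lexx orbT. Qed.

Lemma cos_le_abs (s t : R) : `|s| <= `|t| -> `|t| <= pi -> cos t <= cos s.
Proof.
move=> st tp; rewrite -(cos_norm s) -(cos_norm t).
by rewrite leNgt ltr_cos ?in_itv /= ?normr_ge0 ?tp //= ?(le_trans st) // -leNgt.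
Qed.

Lemma psi_mono_alpha g a b : 0 < vr g -> 0 < vr a -> vz b = vz a -> vr b = vr a ->
  `|valpha b - valpha g| <= `|valpha a - valpha g| -> psi g a <= psi g b.
Proof.
move=> g0 a0 ez er l; rewrite {1}/psi; case: ifP => h; last exact: psi_ge0.
rewrite /psi (le_lt_trans l h) ge_max le_max lexx /= le_max; apply/orP; right.
rewrite lerN2 !form_pi ez er lerB // ler_pM2l ?mulr_gt0 //.
by apply: cos_le_abs => //; exact: ltW.
Qed.

Lemma psi_le g a : Gt g -> Lt a -> psi g a <= 2 * vr g * vr a.
Proof.
move=> Gg [a0 za]; have g0 := Gt_r0 Gg; have zg := Gt_zr Gg.
have rr := mulr_gt0 g0 a0.
rewrite /psi; case: ifP => _; last by nra.
rewrite ge_max; apply/andP; split; first by nra.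
rewrite form_pi opprB.
have := Re_mul_le (vz g) (vz a); rewrite ler_norml => /andP[h _].
have : normc (vz g) * normc (vz a) < vr g * vr a by apply: ltr_pM => //; exact: normc_ge0.
have : vr g * vr a * cos (valpha a - valpha g) <= vr g * vr a.
  by rewrite ger_pMr //; have := cos_max (valpha a - valpha g); rewrite ler_norml => /andP[].
by lra.
Qed.

(** Turning a point towards the angle of g increases psi g. At that angle minus the
    form is affine on segments, so on the segment from the turned point to a multiple
    of g it stays above the smaller of its values at the ends. *)
Lemma psi_path g a (s k : R) : Gt g -> Lt a -> 0 < s -> s <= psi g a -> s <= k ->
  let c := mkV (vz a) (valpha g) (vr a) in
  forall t, 0 <= t <= 1 ->
  [/\ Lt (seg a c t), Lt (seg c (scaleV k g) t),
      s <= psi g (seg a c t) & s <= psi g (seg c (scaleV k g) t)].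
Proof.
move=> Gg La s0 sa sk c t t01; have /andP[t0 t1] := t01.
have k0 : 0 < k := lt_le_trans s0 sk.
have g0 := Gt_r0 Gg.
have Lc : Lt c by case: La => ? ?; split; rewrite /c !mkVE.
have Lk : Lt (scaleV k g) by apply: Lt_scale => //; case: Gg.
have mono u : 0 <= u <= 1 -> s <= psi g (seg a c u).
  move=> /andP[u0 u1].
  apply: le_trans sa _; apply: psi_mono_alpha => //; first by case: La.
  - by rewrite /seg /c /vz /mkV /=; congr (_ +i* _); ring.
  - by rewrite /seg /c /vr /mkV /=; ring.
  - have -> : valpha (seg a c u) - valpha g = (1 - u) * (valpha a - valpha g).
      by rewrite /seg /c /valpha /mkV /=; ring.
    by rewrite normrM ler_piMl // ger0_norm; lra.
split; [exact: seg_Lt|exact: seg_Lt|exact: mono|].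
have ac : valpha (seg c (scaleV k g) t) = valpha g.
  by rewrite /seg scaleVE /c /valpha /mkV /=; ring.
apply: le_trans (psi_geN _); last by rewrite ac subrr normr0 pi_gt0.
have sc : s <= - form (pi_cov g) (pi_cov c).
  have := mono 1; rewrite seg1 lexx ler01 => /(_ isT) h.
  by rewrite -psi_form //; exact: lt_le_trans h.
have -> : form (pi_cov g) (pi_cov (seg c (scaleV k g) t)) =
    (1 - t) * form (pi_cov g) (pi_cov c) + t * (k * form (pi_cov g) (pi_cov g)).
  rewrite !form_pi ac /c valpha_mkV subrr cos0 /seg scaleVE /mkV /vz /vr /=.
  by ring.
rewrite (Gt_form Gg); nra.
Qed.

Lemma psi_up_connected g (S : set R) : Gt g ->
  (forall s k, S s -> s <= k -> S k) -> (forall s, S s -> 0 < s) ->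
  connected (@Lt R `&` [set a | S (psi g a)]).
Proof.
move=> Gg up pos; have [[s0 Ss0]|none] := pselect (exists s, S s); last first.
  rewrite (_ : _ `&` _ = set0); first exact: connected0.
  by apply/seteqP; split=> // a [_ /= Sa]; apply: none; exists (psi g a).
apply: (@star_connected _ (scaleV s0 g)) => a [La /= Sa].
exists (mkV (vz a) (valpha g) (vr a)) => t t01.
pose m := Num.min s0 (psi g a).
have Sm : S m by rewrite /m minEle; case: ifP.
have ma : m <= psi g a by rewrite ge_min lexx orbT.
have ms : m <= s0 by rewrite ge_min lexx.
have [L1 L2 p1 p2] := psi_path Gg La (pos _ Sm) ma ms t01.
by split; split => //=; [exact: up p1|exact: up p2].
Qed.

(** Shrinking a point along its ray decreases psi g and leads to small r, where psi g
    is below one everywhere. *)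
Lemma psi_down_connected g : Gt g ->
  connected (@Lt R `&` [set a | psi g a < 1]).
Proof.
move=> Gg; have g0 := Gt_r0 Gg; have g1 := Gt_r1 Gg.
(* Where r is at most e, the bound psi_le gives psi g <= 1 / 2. *)
pose e := (4 * vr g)^-1.
have e0 : 0 < e by rewrite invr_gt0 mulr_gt0.
have ge : vr g * e = 4^-1 by rewrite /e invfM mulrCA divff ?gt_eqF // mulr1.
have small b : Lt b -> vr b <= e -> psi g b < 1.
  move=> Lb be; apply: le_lt_trans (psi_le Gg Lb) _.
  have : vr g * vr b <= vr g * e by rewrite ler_pM2l.
  by rewrite ge; lra.
have Lb : Lt (mkV 0 0 e) by split; rewrite !mkVE ?normc0.
apply: (@star_connected _ (mkV 0 0 e)) => a [La /= pa].
have [a0 _] := La.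
pose s := e / (e + vr a).
have s0 : 0 < s by rewrite divr_gt0 // addr_gt0.
have s1 : s <= 1 by rewrite ler_pdivrMr ?addr_gt0 //; lra.
have sa : s * vr a <= e.
  by rewrite /s mulrAC ler_pdivrMr ?addr_gt0 //; nra.
exists (scaleV s a) => t /[dup] t01 /andP[t0 t1].
have Ls : Lt (scaleV s a) by exact: Lt_scale.
split; last first.
  split; first exact: seg_Lt.
  apply: small; first exact: seg_Lt.
  have -> : vr (seg (scaleV s a) (mkV 0 0 e) t) = (1 - t) * (s * vr a) + t * e by [].
  by nra.
split; first exact: seg_Lt.
pose w := 1 - t + t * s.
have w0 : 0 <= w by rewrite /w; nra.
have w1 : w <= 1 by rewrite /w; nra.
have -> : seg a (scaleV s a) t = scaleV w a.
  rewrite /seg !scaleVE /w; congr pair; last by rewrite /=; ring.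
  by congr pair; [congr pair|]; rewrite /=; ring.
rewrite /= psi_scale //; have := psi_ge0 g a; nra.
Qed.

Lemma psi_gap g (C : set (V R)) v y : Gt g -> connected C -> C `<=` @Lt R ->
  (forall x, C x -> psi g x <> v) -> C y ->
  (v < psi g y -> forall x, C x -> v < psi g x) /\
  (psi g y < v -> forall x, C x -> psi g x < v).
Proof.
move=> Gg cC CL nv Cy.
have : connected (psi g @` C).
  apply: connected_continuous_connected => //; apply: continuous_in_subspaceT.
  by move=> x /set_mem Cx; apply: cvg_psi; [case: Gg|exact: CL].
move=> /connected_intervalP itv.
have no x z : C x -> C z -> ~ (psi g x <= v <= psi g z).
  move=> Cx Cz h; have [w Cw e] := itv _ _ (imageP _ Cx) (imageP _ Cz) _ h.
  exact: nv e.
split=> h x Cx; rewrite ltNge; apply/negP => k.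
  by apply: (no x y) => //; rewrite k ltW.
by apply: (no y x) => //; rewrite k ltW.
Qed.

(** On a set where minus the form is at least one, psi g takes no value strictly
    between 0 and 1. So it cannot drop to 0 on a connected set through g, which
    therefore stays on the sheet of g. *)
Lemma psi_level_sub g (S : set R) y : Gt g -> (forall s, S s -> 1 <= s) ->
  connected_component (@Lt R `&` [set a | S (- form (pi_cov g) (pi_cov a))]) g y ->
  S 1 -> Lt y /\ S (psi g y).
Proof.
move=> Gg S1 [C [Cg CS cC] Cy] S11.
have val x : C x -> psi g x = 0 \/ S (psi g x).
  move=> Cx; have [_ /= Sx] := CS _ Cx.
  have := psi_ge0 g x; rewrite le_eqVlt => /orP[/eqP<-|p]; first by left.
  by right; rewrite psi_form.
have nh x : C x -> psi g x <> 1 / 2.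
  by move=> Cx e; case: (val x Cx) => [|/S1]; rewrite e; lra.
have [hi _] := psi_gap Gg cC (fun x Cx => (CS x Cx).1) nh Cg.
have [Ly _] := CS _ Cy; split => //.
case: (val y Cy) => // y0.
have : 1 / 2 < psi g y.
  by apply: hi => //; rewrite psi_self //; lra.
by rewrite y0; lra.
Qed.

Lemma form_psi_ge g y : Gt g -> 0 < psi g y -> form (pi_cov g) (pi_cov y) = - psi g y.
Proof. by move=> Gg p; rewrite psi_form // opprK. Qed.

Lemma IsetE g : Gt g -> Iset g = @Lt R `&` [set a | 1 <= psi g a].
Proof.
move=> Gg; apply/seteqP; split=> y.
  rewrite /Iset.
  rewrite (_ : [set a | form _ (pi_cov a) <= -1] =
    [set a | [set s | 1 <= s] (- form (pi_cov g) (pi_cov a))]); last first.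
    by apply/seteqP; split => a /=; rewrite lerNr.
  by move=> /(psi_level_sub Gg) [] //=; lra.
move: y; apply: connected_component_max.
- by split; [case: Gg|rewrite /= psi_self].
- move=> y [Ly /= py]; split => //=; rewrite form_psi_ge ?lerN2 //; lra.
- apply: (@psi_up_connected g [set s | 1 <= s]) => //= [s k|s]; last by lra.
  exact: le_trans.
Qed.

(** The level set is connected as the image of the region above it under the
    radial retraction. *)
Lemma EsetE g : Gt g -> Eset g = @Lt R `&` [set a | psi g a = 1].
Proof.
move=> Gg; apply/seteqP; split=> y.
  rewrite /Eset.
  rewrite (_ : [set a | form _ (pi_cov a) = -1] =
    [set a | [set s | s = 1] (- form (pi_cov g) (pi_cov a))]); last first.
    by apply/seteqP; split => a /= e; lra.
  by move=> /(psi_level_sub Gg) [] //= s ->.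
move: y; apply: connected_component_max.
- by split; [case: Gg|rewrite /= psi_self].
- by move=> y [Ly /= py]; split => //=; rewrite form_psi_ge ?py.
- pose I := @Lt R `&` [set a | 1 <= psi g a].
  have -> : @Lt R `&` [set a | psi g a = 1] = (fun a => scaleV (psi g a)^-1 a) @` I.
    apply/seteqP; split=> a.
      by move=> [La /= pa]; exists a; [split => //=; rewrite pa|rewrite pa invr1 scaleV1].
    move=> [b [Lb /= pb] <-]; have p0 : 0 < psi g b by lra.
    split; first by apply: Lt_scale => //; rewrite invr_gt0.
    by rewrite /= psi_scale ?invr_ge0 ?ltW // mulVf // gt_eqF.
  apply: connected_continuous_connected.
    apply: (@psi_up_connected g [set s | 1 <= s]) => //= [s k|s]; last by lra.
    exact: le_trans.
  apply: continuous_in_subspaceT => a /set_mem[La /= pa].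
  apply: cvg_scaleV; last exact: cvg_id.
  apply: cvgV; first by rewrite gt_eqF //; lra.
  by apply: cvg_psi => //; case: Gg.
Qed.

(** For a function of positive degree of homogeneity the boundary of a sublevel set
    is the level set: rays cross the level transversally. *)
Section Homogeneous.
Variable f : V R -> R.
Hypothesis fc : forall a, Lt a -> {for a, continuous f}.
Hypothesis fh : forall s a, 0 < s -> Lt a -> f (scaleV s a) = s * f a.

(* Every neighbourhood of a contains multiples of a by factors close to one. *)
Let ray a (U : set (V R)) : nbhs a U -> exists2 e, 0 < e < 1 &
  U (scaleV (1 + e) a) /\ U (scaleV (1 - e) a).
Proof.
move=> aU.
have c : (fun s : R => scaleV s a) @ (1 : R) --> a.
  rewrite -{2}(scaleV1 a); apply: cvg_scaleV; [exact: cvg_id|exact: cvg_cst].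
have /nbhs_ballP[e /= e0 eU] := c _ aU.
exists (Num.min (e / 2) 2^-1); first by rewrite lt_min gt_min; lra.
have m1 : Num.min (e / 2) 2^-1 < e by rewrite gt_min; apply/orP; left; lra.
have m0 : 0 < Num.min (e / 2) 2^-1 by rewrite lt_min; lra.
split; apply: eU; rewrite /ball /=.
  by rewrite opprD addrA subrr add0r normrN gtr0_norm.
by rewrite opprB addrC subrK gtr0_norm.
Qed.

Lemma closure_sub_lt : closure_in (@Lt R) (@Lt R `&` [set a | f a < 1]) =
  @Lt R `&` [set a | f a <= 1].
Proof.
rewrite closure_inP; last by move=> a [].
apply/seteqP; split=> a.
  move=> [cl La]; split => //=; rewrite leNgt; apply/negP => h.
  have [b [[_ /= b1] /= b2]] := cl _ (near_gt (fc La) h).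
  by move: (lt_trans b1 b2); rewrite ltxx.
move=> [La /= fa]; split => // U /ray[e /andP[e0 e1] [_ Ue]].
exists (scaleV (1 - e) a); split => //; split; first by apply: Lt_scale => //; lra.
by rewrite /= fh; [nra|lra|].
Qed.

Lemma closure_sub_gt : closure_in (@Lt R) (@Lt R `&` [set a | 1 < f a]) =
  @Lt R `&` [set a | 1 <= f a].
Proof.
rewrite closure_inP; last by move=> a [].
apply/seteqP; split=> a.
  move=> [cl La]; split => //=; rewrite leNgt; apply/negP => h.
  have [b [[_ /= b1] /= b2]] := cl _ (near_lt (fc La) h).
  by move: (lt_trans b1 b2); rewrite ltxx.
move=> [La /= fa]; split => // U /ray[e /andP[e0 e1] [Ue _]].
exists (scaleV (1 + e) a); split => //; split; first by apply: Lt_scale => //; lra.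
by rewrite /= fh; [nra|lra|].
Qed.

Lemma boundary_sub_le : boundary_in (@Lt R) (@Lt R `&` [set a | f a <= 1]) =
  @Lt R `&` [set a | f a = 1].
Proof.
rewrite /boundary_in closure_inP; last by move=> a [].
apply/seteqP; split=> a.
  move=> [[cl La] ni]; split => //=; apply/eqP; rewrite eq_le; apply/andP; split.
    rewrite leNgt; apply/negP => h.
    have [b [[_ /= b1] /= b2]] := cl _ (near_gt (fc La) h).
    by move: (le_lt_trans b1 b2); rewrite ltxx.
  rewrite leNgt; apply/negP => h; apply: ni; apply/(interior_inP _ La).
  exists [set b | f b < 1]; first by apply: near_lt => //; exact: fc.
  by move=> b [/= fb Lb]; split => //=; exact: ltW.
move=> [La /= fa]; split.
  by split => //; apply: subset_closure; split => //=; rewrite fa.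
move=> /(interior_inP _ La)[U /ray[e /andP[e0 e1] [Ue _]] UF].
have [|_ /=] := UF (scaleV (1 + e) a); first by split => //; apply: Lt_scale => //; lra.
by rewrite fh //; [rewrite fa; lra|lra].
Qed.

End Homogeneous.

(** The complement of the level set has two components, psi g < 1 and psi g > 1, and
    the closure of the second one is the set I of g. *)
Lemma HsetE g : Gt g -> Hset g = @Lt R `&` [set a | psi g a <= 1].
Proof.
move=> Gg.
have fc a : Lt a -> {for a, continuous (psi g)} by move=> La; apply: cvg_psi => //; case: Gg.
have fh (s : R) a : 0 < s -> Lt a -> psi g (scaleV s a) = s * psi g a.
  by move=> s0 _; apply: psi_scale; exact: ltW.
have g0 : Lt g by case: Gg.
have complE : @Lt R `\` Eset g = @Lt R `&` [set a | psi g a <> 1].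
  rewrite EsetE //; apply/seteqP; split=> a [La h]; split => //; first by move=> e; apply: h.
  by move=> [].
have sub (P : set R) : (forall s, P s -> s <> 1) ->
    @Lt R `&` [set a | P (psi g a)] `<=` @Lt R `\` Eset g.
  by rewrite complE => PN a [La /= Pa]; split => //=; exact: PN.
have compL y : (@Lt R `\` Eset g) y -> psi g y < 1 ->
    connected_component (@Lt R `\` Eset g) y = @Lt R `&` [set a | psi g a < 1].
  move=> Ey py; have Ly : Lt y by case: Ey.
  apply/seteqP; split=> [a [C [Cy CE cC] Ca]|].
    have Ec x : C x -> Lt x /\ psi g x <> 1.
      by move=> Cx; have := CE _ Cx; rewrite complE => -[].
    have [_ lo] := psi_gap Gg cC (fun x Cx => (Ec x Cx).1) (fun x Cx => (Ec x Cx).2) Cy.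
    by split; [case: (Ec a Ca)|exact: lo].
  apply: connected_component_max => //; last exact: psi_down_connected.
  by apply: (sub [set s | s < 1]) => s /=; lra.
have compU y : (@Lt R `\` Eset g) y -> 1 < psi g y ->
    connected_component (@Lt R `\` Eset g) y = @Lt R `&` [set a | 1 < psi g a].
  move=> Ey py; have Ly : Lt y by case: Ey.
  apply/seteqP; split=> [a [C [Cy CE cC] Ca]|].
    have Ec x : C x -> Lt x /\ psi g x <> 1.
      by move=> Cx; have := CE _ Cx; rewrite complE => -[].
    have [hi _] := psi_gap Gg cC (fun x Cx => (Ec x Cx).1) (fun x Cx => (Ec x Cx).2) Cy.
    by split; [case: (Ec a Ca)|exact: hi].
  apply: connected_component_max => //; last first.
    by apply: (@psi_up_connected g [set s | 1 < s]) => //= [s k|s]; [exact: lt_le_trans|lra].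
  by apply: (sub [set s | 1 < s]) => s /=; lra.
have half : Lt (scaleV (2^-1) g) /\ psi g (scaleV (2^-1) g) = 2^-1.
  by rewrite fh // psi_self // mulr1; split => //; apply: Lt_scale.
apply/seteqP; split=> a.
  move=> [y [Ey nI cl]].
  have : psi g y <> 1 by move: Ey; rewrite complE => -[].
  case: (ltrgtP (psi g y) 1) => // py _; last first.
    by exfalso; apply: nI; rewrite compU // (closure_sub_gt fc fh) IsetE.
  by move: cl; rewrite compL // (closure_sub_lt fc fh).
move=> pa; exists (scaleV (2^-1) g) => /=.
have Eh : (@Lt R `\` Eset g) (scaleV (2^-1) g).
  by rewrite complE; case: half => h1 h2; split => //=; rewrite h2; lra.
have ph : psi g (scaleV (2^-1) g) < 1 by rewrite half.2; lra.
rewrite compL // (closure_sub_lt fc fh); split => //.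
rewrite IsetE // => e.
have : (@Lt R `&` [set a | psi g a <= 1]) (scaleV (2^-1) g) by split; [exact: half.1|exact: ltW].
by rewrite e => -[_ /=]; rewrite leNgt ph.
Qed.

End HalfSpaces.

(** * Translations of the covering group *)
Section Translations.
Variable R : realType.
Local Open Scope complex_scope.
Implicit Types (p q x y g h a b k : V R).

(** The points of V have real coordinates, so complex functions on V are handled
    through their real and imaginary parts. *)
Definition ccvg T (F : set_system T) (f : T -> R[i]) (z : R[i]) : Prop :=
  (fun t => complex.Re (f t)) @ F --> complex.Re z /\
  (fun t => complex.Im (f t)) @ F --> complex.Im z.

Section Ccvg.
Variables (T : Type) (F : set_system T).
Hypothesis FF : Filter F.

Lemma ccvg_cst z : ccvg F (fun=> z) z.
Proof. by split; exact: cvg_cst. Qed.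

Lemma ccvgD (f g : T -> R[i]) z w : ccvg F f z -> ccvg F g w ->
  ccvg F (fun t => f t + g t) (z + w).
Proof.
move=> [f1 f2] [g1 g2]; have e (u v : R[i]) : u + v =
    (complex.Re u + complex.Re v) +i* (complex.Im u + complex.Im v) by case: u; case: v.
by split; under eq_fun do rewrite e; rewrite e /=; apply: cvgD.
Qed.

Lemma ccvgM (f g : T -> R[i]) z w : ccvg F f z -> ccvg F g w ->
  ccvg F (fun t => f t * g t) (z * w).
Proof.
move=> [f1 f2] [g1 g2]; have e (u v : R[i]) : u * v =
    (complex.Re u * complex.Re v - complex.Im u * complex.Im v) +i*
    (complex.Re u * complex.Im v + complex.Im u * complex.Re v) by case: u; case: v.
by split; under eq_fun do rewrite e; rewrite e /=;
  [apply: cvgB|apply: cvgD]; apply: cvgM.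
Qed.

Lemma ccvgJ (f : T -> R[i]) z : ccvg F f z ->
  ccvg F (fun t => ((f t)^*)%R) (z^*)%R.
Proof.
move=> [f1 f2]; have e (u : R[i]) : (u^*)%R = (complex.Re u) +i* (- complex.Im u) by case: u.
by split; under eq_fun do rewrite e; rewrite e //=; apply: cvgN.
Qed.

Lemma ccvgV (f : T -> R[i]) z : z != 0 -> ccvg F f z ->
  ccvg F (fun t => (f t)^-1) z^-1.
Proof.
move=> z0 [f1 f2]; have e (u : R[i]) : u^-1 =
    (complex.Re u / (complex.Re u ^+ 2 + complex.Im u ^+ 2)) +i*
    (- (complex.Im u / (complex.Re u ^+ 2 + complex.Im u ^+ 2))).
  by case: u => a b.
have n0 : complex.Re z ^+ 2 + complex.Im z ^+ 2 != 0.
  by apply: contraNneq z0; case: z {f1 f2} => a b /= h; rewrite eq_complex /=; apply/andP; split; apply/eqP; nra.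
have nn : (fun t => (complex.Re (f t) ^+ 2 + complex.Im (f t) ^+ 2)^-1) @ F -->
    (complex.Re z ^+ 2 + complex.Im z ^+ 2)^-1.
  apply: cvgV => //; apply: cvgD; rewrite expr2; under eq_fun do rewrite expr2;
  by apply: cvgM.
by split; under eq_fun do rewrite e; rewrite e /=; [|apply: cvgN]; apply: cvgM.
Qed.

End Ccvg.

Lemma ccvg_pi T (F : set_system T) (FF : Filter F) (f : T -> V R) p : f @ F --> p ->
  ccvg F (fun t => (pi_cov (f t)).1) (pi_cov p).1 /\
  ccvg F (fun t => (pi_cov (f t)).2) (pi_cov p).2.
Proof.
move=> h; have [h1 h2 h3 h4] := cvg_coords FF h; split; first by split.
apply: ccvgM; first by split => //=; exact: cvg_cst.
by split=> /=; apply: cvg_comp h3 _; [exact: continuous_cos|exact: continuous_sin].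
Qed.

Lemma mulSU_pole p q : Gt p -> Gt q ->
  0 < complex.Re (1 + (pi_cov p).1^* * (pi_cov q).1 / ((pi_cov p).2 * (pi_cov q).2)).
Proof.
move=> Gp Gq; apply: Re_gt0.
have p0 := Gt_r0 Gp; have q0 := Gt_r0 Gq.
rewrite normcM normcV (normcM (pi_cov p).1^*) (normcM (pi_cov p).2) !normc_pi2 // normc_conj.
rewrite ltr_pdivrMr ?mulr_gt0 // mul1r.
by apply: ltr_pM; rewrite ?normc_ge0 //; apply: Gt_zr.
Qed.

Lemma pi2_neq0 p : Gt p -> (pi_cov p).2 != 0.
Proof.
move=> Gp; apply/eqP => e; have := Gt_r0 Gp.
by rewrite -normc_pi2 // e normc0 ltxx.
Qed.

Lemma cvg_mulG T (F : set_system T) (FF : Filter F) (f g : T -> V R) p q :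
  Gt p -> Gt q -> f @ F --> p -> g @ F --> q ->
  (fun t => mulG (f t) (g t)) @ F --> mulG p q.
Proof.
move=> Gp Gq fp gq.
have [f1 f2] := ccvg_pi FF fp; have [g1 g2] := ccvg_pi FF gq.
have [_ _ fa _] := cvg_coords FF fp; have [_ _ ga _] := cvg_coords FF gq.
have [c1 c2] : ccvg F (fun t => (mulSU (pi_cov (f t)) (pi_cov (g t))).1) (mulSU (pi_cov p) (pi_cov q)).1.
  by apply: ccvgD => //; apply: ccvgM => //; exact: ccvgJ.
have [d1 d2] : ccvg F (fun t => (mulSU (pi_cov (f t)) (pi_cov (g t))).2) (mulSU (pi_cov p) (pi_cov q)).2.
  by apply: ccvgD => //; apply: ccvgM => //; exact: ccvgJ.
have [e1 e2] : ccvg F (fun t => 1 + ((pi_cov (f t)).1^*)%R * (pi_cov (g t)).1 / ((pi_cov (f t)).2 * (pi_cov (g t)).2))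
    (1 + ((pi_cov p).1^*)%R * (pi_cov q).1 / ((pi_cov p).2 * (pi_cov q).2)).
  apply: ccvgD => //; first exact: ccvg_cst.
  apply: ccvgM => //; first by apply: ccvgM => //; exact: ccvgJ.
  by apply: ccvgV => //; [rewrite mulf_neq0 ?pi2_neq0|apply: ccvgM].
apply: cvg_V.
- by under eq_fun do rewrite vz_mulG; rewrite vz_mulG.
- by under eq_fun do rewrite vz_mulG; rewrite vz_mulG.
- under eq_fun do rewrite valpha_mulG; rewrite valpha_mulG.
  apply: cvgD; first exact: cvgD.
  rewrite /cocycle /arg_right.
  set u := (X in atan X).
  apply: (@cvg_comp _ _ _ _ atan _ (nbhs u)); last exact: continuous_atan.
  apply: cvgM => //; apply: cvgV => //; rewrite gt_eqF //; exact: mulSU_pole.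
- by apply: cvg_normc.
Qed.

Lemma cvg_invG T (F : set_system T) (FF : Filter F) (f : T -> V R) p : f @ F --> p ->
  (fun t => invG (f t)) @ F --> invG p.
Proof.
move=> h; have [h1 h2 h3 h4] := cvg_coords FF h.
have e1 q : complex.Re (vz (invG q)) = - complex.Re (vz q) by [].
have e2 q : complex.Im (vz (invG q)) = - complex.Im (vz q) by [].
have e3 q : valpha (invG q) = - valpha q by [].
apply: cvg_V; rewrite ?e1 ?e2 ?e3 //.
- by under eq_fun do rewrite e1; apply: cvgN.
- by under eq_fun do rewrite e2; apply: cvgN.
- by under eq_fun do rewrite e3; apply: cvgN.
Qed.

Lemma Gt_act g h x : Gt g -> Gt h -> Gt x -> Gt (actG g h x).
Proof. by move=> Gg Gh Gx; apply: Gt_mul; [exact: Gt_mul|exact: Gt_inv]. Qed.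

Lemma cvg_actG g h x : Gt g -> Gt h -> Gt x -> {for x, continuous (actG g h)}.
Proof.
move=> Gg Gh Gx; apply: cvg_mulG; [exact: Gt_mul|exact: Gt_inv| |exact: cvg_cst].
by apply: cvg_mulG => //; exact: cvg_cst.
Qed.

Lemma actGK g h x : Gt g -> Gt h -> Gt x -> actG (invG g) (invG h) (actG g h x) = x.
Proof.
move=> Gg Gh Gx; have ? := Gt_inv Gg; have ? := Gt_inv Gh; have ? := Gt_mul Gg Gx.
rewrite /actG invGK mulGA // -?mulGA //; do ?exact: Gt_mul; do ?exact: Gt_inv.
by rewrite mulVG // mulG1 // mulKG.
Qed.

Lemma actGKV g h x : Gt g -> Gt h -> Gt x -> actG g h (actG (invG g) (invG h) x) = x.
Proof.
move=> Gg Gh Gx; have := @actGK (invG g) (invG h) x; rewrite !invGK.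
by apply => //; exact: Gt_inv.
Qed.

(** For y a quotient of b by h this reduces psi h to the function of the neutral
    element. The angle of y is the difference of those of b and h up to a cocycle of
    less than a quarter turn; where the form is negative, the angle of y is less than a
    quarter turn away from a multiple of the full turn, so both functions choose the
    same sheet. *)
Lemma psi_sheet h b y : Gt y ->
  form (pi_cov (oneG R)) (pi_cov y) = form (pi_cov h) (pi_cov b) ->
  `|valpha y - (valpha b - valpha h)| < pi / 2 -> psi h b = psi (oneG R) y.
Proof.
move=> Gy e lt; rewrite /psi -e.
case: (ltP (form (pi_cov (oneG R)) (pi_cov y)) 0) => f0; last first.
  have -> : Num.max 0 (- form (pi_cov (oneG R)) (pi_cov y)) = 0 by apply/max_idPl; lra.
  by case: ifP; case: ifP.
have p0 := pi_gt0 R.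
have c0 : 0 < cos (valpha y).
  move: f0; rewrite form_pi /oneG !mkVE /= !mul0r !addr0 add0r mul1r subr0 oppr_lt0.
  by rewrite pmulr_rgt0 // Gt_r0.
suff -> : (`|valpha b - valpha h| < pi) = (`|valpha y - valpha (oneG R)| < pi) by [].
rewrite /oneG valpha_mkV subr0.
(* A positive cosine excludes the angles between a quarter and three quarters of a turn. *)
have c1 : `|valpha y| < 3 * pi / 2 -> `|valpha y| < pi / 2.
  move=> l; rewrite ltNge; apply/negP => g.
  have : 0 <= cos (`|valpha y| - pi) by apply: cos_ge0_pihalf; lra.
  rewrite cosB cospi sinpi mulr0 addr0 mulrN1 cos_norm; lra.
apply/idP/idP => l.
  have : `|valpha y| < pi / 2; last by lra.
  apply: c1.
  have := ler_normD (valpha y - (valpha b - valpha h)) (valpha b - valpha h).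
  rewrite subrK; lra.
have {}l : `|valpha y| < pi / 2 by apply: c1; lra.
have := ler_normB (valpha y) (valpha y - (valpha b - valpha h)).
by rewrite subKr; lra.
Qed.

Lemma psi_left h b : Gt h -> Gt b -> psi h b = psi (oneG R) (mulG (invG h) b).
Proof.
move=> Gh Gb; have Gi := Gt_inv Gh; apply: psi_sheet; first exact: Gt_mul.
  rewrite -(mulVG Gh) !pi_mulG // mulSU_form Gt_form // opprK mul1r //.
rewrite valpha_mulG (_ : _ - _ = cocycle (invG h) b); last by rewrite /invG valpha_mkV; ring.
exact: cocycle_lt.
Qed.

Lemma psi_right h b : Gt h -> Gt b -> psi h b = psi (oneG R) (mulG b (invG h)).
Proof.
move=> Gh Gb; have Gi := Gt_inv Gh; apply: psi_sheet; first exact: Gt_mul.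
  rewrite -(mulGV Gh) !pi_mulG // mulSU_formr Gt_form // opprK mul1r //.
rewrite valpha_mulG (_ : _ - _ = cocycle b (invG h)); last by rewrite /invG valpha_mkV; ring.
exact: cocycle_lt.
Qed.

Lemma psi_mul2l k h b : Gt k -> Gt h -> Gt b -> psi (mulG k h) (mulG k b) = psi h b.
Proof.
move=> Gk Gh Gb; have ? := Gt_mul Gk Gh; have ? := Gt_mul Gk Gb.
rewrite psi_left // [RHS]psi_left // invMG // -mulGA; try exact: Gt_inv; rewrite ?mulKG //.
Qed.

Lemma psi_mul2r k h b : Gt k -> Gt h -> Gt b -> psi (mulG h k) (mulG b k) = psi h b.
Proof.
move=> Gk Gh Gb; have ? := Gt_mul Gh Gk; have ? := Gt_mul Gb Gk; have ? := Gt_inv Gk; have ? := Gt_inv Gh.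
by rewrite psi_right // [RHS]psi_right // invMG // mulGA // mulGK.
Qed.

Lemma psi_act g1 g2 h b : Gt g1 -> Gt g2 -> Gt h -> Gt b ->
  psi (actG g1 g2 h) (actG g1 g2 b) = psi h b.
Proof.
move=> G1 G2 Gh Gb; rewrite /actG psi_mul2r; try exact: Gt_mul; last exact: Gt_inv.
exact: psi_mul2l.
Qed.

(** * The radial trivialization *)

Lemma lambda_gt0 a : Lt a -> 0 < lambda a.
Proof.
move=> [a0 za]; rewrite /lambda sqrtr_gt0 subr_gt0.
by rewrite ltr_pXn2r ?nnegrE ?normc_ge0 // ltW.
Qed.

Lemma lambda_sqr a : Lt a -> lambda a ^+ 2 = vr a ^+ 2 - normc (vz a) ^+ 2.
Proof.
move=> /lambda_gt0; rewrite /lambda sqrtr_gt0 => h; rewrite sqr_sqrtr //; exact: ltW.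
Qed.

Lemma lambda_scale (s : R) a : 0 < s -> lambda (scaleV s a) = s * lambda a.
Proof.
move=> s0; rewrite /lambda vr_scale vz_scale normcM normc_real ?ltW //.
by rewrite !exprMn -mulrBr sqrtrM ?sqr_ge0 // sqrtr_sqr gtr0_norm.
Qed.

Lemma lambda_Gt x : Gt x -> lambda x = 1.
Proof. by move=> /GtP[_ e]; rewrite /lambda e addrK sqrtr1. Qed.

Lemma Gt_theta a : Lt a -> Gt (theta a).
Proof.
move=> La; have l0 := lambda_gt0 La; have [a0 _] := La.
have i0 : 0 <= (lambda a)^-1 by rewrite invr_ge0 ltW.
apply/GtP; rewrite /theta vr_scale vz_scale normcM normc_real //.
split; first by rewrite mulr_gt0 // invr_gt0.
rewrite !exprMn; apply/eqP; rewrite -subr_eq -mulrBr -lambda_sqr //.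
by rewrite -exprMn mulVf ?expr1n // gt_eqF.
Qed.

Lemma scale_theta a : Lt a -> scaleV (lambda a) (theta a) = a.
Proof.
by move=> La; rewrite /theta scaleVA mulfV ?scaleV1 // gt_eqF // lambda_gt0.
Qed.

Lemma theta_scale (s : R) x : 0 < s -> Gt x -> theta (scaleV s x) = x.
Proof.
move=> s0 Gx; rewrite /theta lambda_scale // lambda_Gt // mulr1 scaleVA mulVf ?scaleV1 //.
by rewrite gt_eqF.
Qed.

Lemma cvg_lambda a : {for a, continuous (@lambda R)}.
Proof.
rewrite /continuous_at /lambda.
apply: (@cvg_comp _ _ _ _ Num.sqrt _ (nbhs (vr a ^+ 2 - normc (vz a) ^+ 2))); last exact: sqrt_continuous.
have [h1 h2 h3 h4] := cvg_coords (nbhs_filter a) (@cvg_id _ (nbhs a)).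
have h5 := @cvg_normc _ _ _ (nbhs_filter a) (@vz R) (vz a) h1 h2.
by apply: cvgB; rewrite expr2; under eq_fun do rewrite expr2; apply: cvgM.
Qed.

Lemma cvg_theta a : Lt a -> {for a, continuous (@theta R)}.
Proof.
move=> La; apply: cvg_scaleV; last exact: cvg_id.
by apply: cvgV; [rewrite gt_eqF // lambda_gt0|exact: cvg_lambda].
Qed.

Lemma psi_theta g a : Lt a -> psi g a = lambda a * psi g (theta a).
Proof.
by move=> La; rewrite -psi_scale ?scale_theta // ltW // lambda_gt0.
Qed.

End Translations.

(** * Stabilizers in the disc *)
Section Stabilizers.
Variable R : realType.
Local Open Scope complex_scope.
Implicit Types (p q x y g h b k : V R) (z w u : R[i]) (t : R).

Lemma disc_normc z : disc z -> normc z < 1.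
Proof. by rewrite /disc /=; case: z => a b; rewrite -ltcR. Qed.

Lemma mobiusE (a : C2 R) z :
  mobius a z = ((a.2^*)%R * z + a.1) / ((a.1^*)%R * z + a.2).
Proof. by rewrite /mobius !mxE. Qed.

Lemma mobius_den p z : Gt p -> disc z -> ((pi_cov p).1^*)%R * z + (pi_cov p).2 != 0.
Proof.
move=> Gp /disc_normc z1; apply/eqP => /eqP; rewrite addr_eq0 => /eqP e.
have := congr1 (@normc R) e; rewrite normcN normcM normc_conj normc_pi2 // => {}e.
have := Gt_zr Gp; have := normc_ge0 (vz p); have := normc_ge0 z; have := Gt_r0 Gp.
by rewrite -e /=; nra.
Qed.

Lemma actD_mul p q z : Gt p -> Gt q -> disc z ->
  actD (mulG p q) z = actD p (actD q z).
Proof.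
move=> Gp Gq dz; have := mobius_den (Gt_mul Gp Gq) dz; have := mobius_den Gq dz.
rewrite /actD !mobiusE pi_mulG //; case: (pi_cov p) => a1 a2; case: (pi_cov q) => b1 b2.
rewrite /mulSU /= !(rmorphD, rmorphM) /= !conjCK => d1 d2.
by field; rewrite d1 /=; apply: contraNneq d2 => e; apply/eqP; rewrite -[RHS]e; ring.
Qed.

Lemma actD_one z : actD (oneG R) z = z.
Proof. by rewrite /actD mobiusE pi_one /= rmorph1 rmorph0 mul0r add0r addr0 mul1r divr1. Qed.

Lemma disc0 : disc (0 : R[i]).
Proof. by rewrite /disc /= normr0. Qed.

Lemma actD0 p : Gt p -> actD p 0 = (pi_cov p).1 / (pi_cov p).2.
Proof. by move=> Gp; rewrite /actD mobiusE !mulr0 !add0r. Qed.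

Lemma actD0_eq0 p : Gt p -> actD p 0 = 0 <-> vz p = 0.
Proof.
move=> Gp; rewrite actD0 //; split=> [/eqP|e]; last by rewrite /= e mul0r.
by rewrite mulf_eq0 invr_eq0 (negbTE (pi2_neq0 Gp)) orbF => /eqP.
Qed.

(** The hyperbolic translation along the geodesic from the centre of the disc to u. *)
Definition mover u : V R :=
  let r := (Num.sqrt (1 - normc u ^+ 2))^-1 in mkV (r%:C * u) 0 r.

Lemma Gt_mover u : disc u -> Gt (mover u).
Proof.
move=> /disc_normc u1; have u0 := normc_ge0 u.
have s0 : 0 < 1 - normc u ^+ 2 by nra.
have r0 : 0 < (Num.sqrt (1 - normc u ^+ 2))^-1 by rewrite invr_gt0 sqrtr_gt0.
apply/GtP; rewrite /mover !mkVE; split => //.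
rewrite normcM normc_real ?ltW // exprMn exprVn sqr_sqrtr ?ltW //.
by field; rewrite gt_eqF.
Qed.

Lemma actD_mover u : disc u -> actD (mover u) 0 = u.
Proof.
move=> du; have Gm := Gt_mover du; have n0 := pi2_neq0 Gm; rewrite actD0 //.
apply: (mulIf n0); rewrite divfK //; rewrite /mover /pi_cov !mkVE /expi cos0 sin0.
by rewrite -[1 +i* 0]/(1 : R[i]) mulr1 mulrC.
Qed.

(** The rotations about u, with the parameter of the conjugate turn: the disc is rotated
    by -2t, and t = pi gives a central element. *)
Definition turn_at u t : V R := mulG (mulG (mover u) (turn t)) (invG (mover u)).

Lemma Gt_turn_at u t : disc u -> Gt (turn_at u t).
Proof.
move=> du; have Gm := Gt_mover du.
by apply: Gt_mul; [apply: Gt_mul => //; exact: Gt_turn|exact: Gt_inv].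
Qed.

Lemma turn_atD u s t : disc u -> mulG (turn_at u s) (turn_at u t) = turn_at u (s + t).
Proof.
move=> du; have Gm := Gt_mover du; have Gi := Gt_inv Gm.
have Gs := Gt_turn s; have Gt' := Gt_turn t; have ? := Gt_mul Gm Gs.
rewrite /turn_at -mulGA // ?(Gt_mul, Gt_mul Gm) //; last by apply: Gt_mul => //; exact: Gt_mul.
rewrite [mulG (invG _) _]mulGA // ?mulKG //; last exact: Gt_mul.
by rewrite -(turnD s t) [mulG (mover u) (mulG _ _)]mulGA // -[RHS]mulGA.
Qed.

Lemma turn_at0 u : disc u -> turn_at u 0 = oneG R.
Proof. by move=> du; rewrite /turn_at turn0 mulG1 ?mulGV //; exact: Gt_mover. Qed.

Lemma turn_atN u t : disc u -> invG (turn_at u t) = turn_at u (- t).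
Proof.
move=> du; apply: invG_uniq; try exact: Gt_turn_at.
by rewrite turn_atD // subrr turn_at0.
Qed.

Lemma turn_at_pi u (n : int) : disc u -> turn_at u (n%:~R * pi) = turn (n%:~R * pi).
Proof.
move=> du; have Gm := Gt_mover du.
by rewrite /turn_at -turn_pi_comm // mulGK //; exact: Gt_turn.
Qed.

Lemma conj_mover u p : disc u -> Gt p ->
  p = mulG (mulG (mover u) (mulG (invG (mover u)) (mulG p (mover u)))) (invG (mover u)).
Proof.
move=> du Gp; have Gm := Gt_mover du.
by rewrite mulKVG ?mulGK //; exact: Gt_mul.
Qed.

(** Conjugation by the mover reduces this to the centre of the disc, whose stabilizer
    consists of the elements with z = 0. *)
Lemma stabP u g : disc u -> Gt g -> actD g u = u <-> exists t, g = turn_at u t.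
Proof.
move=> du Gg; have Gm := Gt_mover du; have Gi := Gt_inv Gm; have am := actD_mover du.
have ai : actD (invG (mover u)) u = 0.
  by rewrite -{2}am -actD_mul // ?mulVG ?actD_one //; exact: disc0.
split=> [gu|[t ->]].
  have Gc : Gt (mulG (invG (mover u)) (mulG g (mover u))) by apply: Gt_mul => //; exact: Gt_mul.
  have : actD (mulG (invG (mover u)) (mulG g (mover u))) 0 = 0.
    have d0 := disc0.
    by rewrite actD_mul ?actD_mul ?am ?gu //; exact: Gt_mul.
  move/actD0_eq0 => /(_ Gc)/(vz0_turn Gc) e.
  by exists (valpha (mulG (invG (mover u)) (mulG g (mover u)))); rewrite /turn_at -e -conj_mover.
have Gr := Gt_turn t; have d0 := disc0.
rewrite /turn_at actD_mul ?ai //; last exact: Gt_mul.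
rewrite actD_mul // (_ : actD (turn t) 0 = 0) ?am //.
by apply/actD0_eq0 => //; rewrite vz_mkV.
Qed.

Lemma actD_eq u g h : disc u -> Gt g -> Gt h ->
  actD g u = actD h u <-> exists t, g = mulG h (turn_at u t).
Proof.
move=> du Gg Gh; have Gi := Gt_inv Gh; have Gc := Gt_mul Gi Gg; split.
  move=> e; have : actD (mulG (invG h) g) u = u.
    by rewrite actD_mul // e -actD_mul // mulVG // actD_one.
  by move=> /(stabP du Gc)[t et]; exists t; rewrite -et mulKVG.
move=> [t ->]; have Gr := @Gt_turn_at u t du.
by rewrite actD_mul //; congr actD; apply/stabP => //; exists t.
Qed.

(** The images of the conjugate turns are diagonal, and e^(is) = e^(it) up to sign exactly
    when s - t is a multiple of pi. *)
Lemma psu_turn_at u s t : disc u ->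
  psu (pi_cov (turn_at u s)) = psu (pi_cov (turn_at u t)) <->
  exists n : int, s = t + n%:~R * pi.
Proof.
move=> du; have Gm := Gt_mover du; have Gi := Gt_inv Gm.
have mN (a b : C2 R) : mulSU a (- b) = - mulSU a b.
  by rewrite /mulSU /= !mulrN -!opprD.
have Nm (a b : C2 R) : mulSU (- a) b = - mulSU a b.
  by rewrite /mulSU /= !raddfN /= !mulNr -!opprD.
split.
  move=> e; have : psu (pi_cov (turn_at u t)) (pi_cov (turn_at u s)).
    by rewrite -e; left.
  have back r : pi_cov (turn r) = mulSU (pi_cov (invG (mover u))) (mulSU (pi_cov (turn_at u r)) (pi_cov (mover u))).
    have Ga := @Gt_turn_at u r du.
    rewrite -!pi_mulG //; last exact: Gt_mul.
    have Gr := Gt_turn r; have Gmr := Gt_mul Gm Gr.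
    by rewrite /turn_at mulGKV // mulKG.
  move=> h; have : pi_cov (turn s) = pi_cov (turn t) \/ pi_cov (turn s) = - pi_cov (turn t).
    by rewrite !back; case: h => ->; [left|right; rewrite Nm mN].
  rewrite !pi_turn => {}h; have [n en] : exists n : int, s - t = n%:~R * pi.
    apply: sin0_intmul_pi; rewrite sinB.
    by case: h => /(congr1 snd) /= []  => -> ->; ring.
  by exists n; rewrite -en; ring.
move=> [n ->].
have Gt' := @Gt_turn_at u t du.
have -> : turn_at u (t + n%:~R * pi) = mulG (turn (n%:~R * pi)) (turn_at u t).
  by rewrite -(turn_at_pi n du) turn_atD // addrC.
rewrite pi_mulG //; last exact: Gt_turn.
have -> : pi_cov (turn (n%:~R * pi)) = (0, (cos (n%:~R * pi : R))%:C).
  by rewrite pi_turn /expi (cos_intmul_pi _ n).2.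
have : cos (n%:~R * pi : R) ^+ 2 == 1 by rewrite (cos_intmul_pi _ n).1.
rewrite sqrf_eq1 => /orP[] /eqP ->.
  have -> (a : C2 R) : mulSU (0, 1%:C) a = a; last by [].
  rewrite /mulSU /= rmorph0 !mul0r addr0 add0r.
  by rewrite -[1%:C]/(1 : R[i]) rmorph1 !mul1r; case: a.
have -> (a : C2 R) : mulSU (0, (-1)%:C) a = - a.
  rewrite /mulSU /= rmorph0 !mul0r addr0 add0r raddfN /=.
  by rewrite -[1%:C]/(1 : R[i]) rmorphN rmorph1 !mulN1r; case: a.
by rewrite /psu opprK; move: (pi_cov _) => c; rewrite setUC.
Qed.

End Stabilizers.

(** * Levels and isotropy groups *)
Section Arithmetic.
Variable R : realType.
Local Open Scope complex_scope.
Implicit Types (p q x y g h b k : V R) (u : R[i]) (t : R) (Gam : set (V R)).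

Lemma finite_argmin (T : choiceType) (A : set T) (f : T -> R) :
  finite_set A -> A !=set0 -> exists2 x, A x & forall y : T, A y -> f x <= f y.
Proof.
move=> /finite_seqP[s ->]; elim: s => [[x //]|a s IH _].
case: s IH => [_|b s IH]; first by exists a; rewrite /= ?mem_seq1 // => y; rewrite mem_seq1 => /eqP ->.
have [|x /= xs xm] := IH; first by exists b => /=; rewrite mem_head.
case: (leP (f a) (f x)) => ax.
  exists a; first by rewrite /= mem_head.
  by move=> y /=; rewrite in_cons => /orP[/eqP -> //|/xm]; exact: le_trans.
exists x; first by rewrite /= in_cons xs orbT.
by move=> y /=; rewrite in_cons => /orP[/eqP ->|/xm //]; exact: ltW.
Qed.

(** Each class modulo q has exactly one representative among 0, ..., q - 1. *)
Lemma card_range_mod (T : Type) (phi : int -> T) (q : nat) : (0 < q)%N ->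
  (forall i j, phi i = phi j <-> (q%:Z %| i - j)%Z) -> (range phi #= `I_q)%card.
Proof.
move=> q0 phiE.
have -> : range phi = (fun j : nat => phi j%:Z) @` `I_q.
  apply/seteqP; split=> x [i _ <-]; last by exists i%:Z.
  have m0 : 0 <= (i %% q)%Z by rewrite modz_ge0 // -lt0n.
  exists `|(i %% q)%Z|%N.
    by rewrite /= -ltz_nat gez0_abs // ltz_pmod.
  rewrite gez0_abs //; apply/phiE; rewrite {2}(divz_eq i q) opprD addrC subrK.
  by rewrite dvdzE abszN -dvdzE dvdz_mull.
apply: inj_card_eq => i j; rewrite !inE /= => iq jq /phiE.
rewrite -eqz_mod_dvd => /eqP; by rewrite !modz_small //; case.
Qed.

(** The centre is infinite cyclic, so its intersection with the subgroup consists of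
    the multiples of some c, and c is the index. The case c = 0 is excluded because the
    index is finite. *)
Lemma level_centre Gam (k : nat) : subgroup Gam -> has_level Gam k ->
  (0 < k)%N /\ forall n : int, Gam (turn (n%:~R * pi)) <-> (k%:Z %| n)%Z.
Proof.
move=> [GG G1 GM GI] lev.
pose N (n : int) := Gam (turn (n%:~R * pi)).
have N0 : N 0 by rewrite /N mul0r.
have NB m n : N m -> N n -> N (m - n).
  move=> Nm Nn; rewrite /N rmorphB mulrBl -turnD -turnN.
  by apply: GM => //; exact: GI.
have ND m n : N m -> N n -> N (m + n).
  by move=> Nm Nn; rewrite -[n]opprK -[- n]sub0r; exact: (NB _ _ Nm (NB _ _ N0 Nn)).
have NM (m : nat) n : N n -> N (n *+ m).
  by move=> Nn; elim: m => [|m IH]; rewrite ?mulr0n // mulrS; exact: ND.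
have NMz (m : int) n : N n -> N (n * m).
  move=> Nn; case: m => m; first by rewrite -natz mulr_natr; exact: NM.
  rewrite NegzE mulrN -sub0r; apply: (NB _ _ N0).
  by rewrite -natz mulr_natr; exact: NM.
pose phi (n : int) := mulG (turn (n%:~R * pi)) @` (Gam `&` @centre R).
have phiE i j : phi i = phi j <-> N (i - j).
  have rr (m n : int) : mulG (turn (m%:~R * pi)) (turn (n%:~R * pi)) = turn ((m + n)%:~R * pi) :> V R.
    by rewrite turnD rmorphD mulrDl.
  have half m n : N (m - n) -> phi m `<=` phi n.
    move=> Nmn x [y [Gy Cy] <-]; have /centreP[l el] := Cy.
    exists (turn ((m - n + l)%:~R * pi)).
      split; last by apply/centreP; exists (m - n + l).
      by rewrite -rr; apply: GM => //; rewrite -el.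
    by rewrite el !rr; congr (turn (_%:~R * _)); ring.
  split=> [e|Nij].
    have : phi i (turn (i%:~R * pi)).
      exists (oneG R); last by rewrite mulG1 //; exact: Gt_turn.
      by split => //; apply/centreP; exists 0; rewrite mul0r.
    rewrite e => -[y [Gy /centreP[l el]]]; rewrite el rr => /turn_inj/mulIf h.
    have {h} : (j + l)%:~R = i%:~R :> R by apply: h; rewrite gt_eqF // pi_gt0.
    by move/intr_inj => <-; rewrite addrC addKr /N -el.
  apply/seteqP; split; apply: half => //.
  by rewrite -opprB -sub0r; exact: (NB _ _ N0).
have levE : [set mulG z @` (Gam `&` @centre R) | z in @centre R] = range phi.
  apply/seteqP; split=> X [z Cz <-]; last by exists (turn (z%:~R * pi)) => //; apply/centreP; exists z.
  by have /centreP[n ->] := Cz; exists n.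
have lev' : (range phi #= `I_k)%card by rewrite -levE.
(* Otherwise the turns by n pi would lie in distinct cosets. *)
have [n0 n00 Nn0] : exists2 n : nat, (0 < n)%N & N n%:Z.
  apply: contrapT => none; apply: infinite_nat.
  have fin : finite_set (range phi) by exists k.
  have : finite_set ((fun n : nat => phi n%:Z) @` setT).
    by apply: sub_finite_set fin => _ [n _ <-]; exists n%:Z.
  suff /eq_finite_set -> : ((fun n : nat => phi n%:Z) @` setT #= [set: nat])%card by [].
  apply: inj_card_eq => i j _ _ /phiE Nij; apply/eqP; rewrite -[_ == _]negbK; apply/negP => ne.
  apply: none; exists `|(i%:Z - j%:Z)|%N; first by rewrite absz_gt0 subr_eq0 eqz_nat.
  case: (lerP 0 (i%:Z - j%:Z)) => h; first by rewrite gez0_abs.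
  by rewrite ltz0_abs // -[X in N X]sub0r; exact: (NB _ _ N0).
have exN : exists n : nat, (0 < n)%N && `[< N n%:Z >].
  by exists n0; rewrite n00; apply/asboolP.
case: (ex_minnP exN) => c /andP[c0 /asboolP Nc] cmin.
have NE n : N n <-> (c%:Z %| n)%Z.
  split=> [Nn|/dvdzP[m ->]]; last by rewrite mulrC; exact: NMz.
  have m0 : 0 <= (n %% c)%Z by rewrite modz_ge0 // -lt0n.
  apply/dvdz_mod0P/eqP; rewrite -[_ == _]negbK; apply/negP => ne.
  have Nr : N (n %% c)%Z.
    have -> : (n %% c)%Z = n - c%:Z * (n %/ c)%Z by rewrite {2}(divz_eq n c); ring.
    by apply: NB => //; exact: NMz.
  have := cmin `|(n %% c)%Z|%N; rewrite absz_gt0 ne gez0_abs // => h.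
  have : (c <= `|(n %% c)%Z|)%N by apply: h; exact/asboolP.
  by rewrite -lez_nat gez0_abs // leNgt ltz_pmod.
have cardc : (range phi #= `I_c)%card.
  by apply: card_range_mod => // i j; rewrite phiE NE.
have /card_eq_II -> : (`I_k #= `I_c)%card by apply: card_eq_trans cardc; rewrite card_eq_sym.
by split.
Qed.

End Arithmetic.

Section Isotropy.
Variable R : realType.
Local Open Scope complex_scope.
Implicit Types (p q x y g h b k : V R) (u : R[i]) (t : R) (Gam : set (V R)).

(** As the isotropy group is finite, there is a smallest positive angle mu, which
    generates all angles of rotations about u. The central elements among them are
    those by multiples of k pi, so the isotropy group has k pi / mu elements. *)
Lemma isotropy_angles Gam u (k p : nat) : subgroup Gam -> disc u -> (0 < k)%N ->
  (forall n : int, Gam (turn (n%:~R * pi)) <-> (k%:Z %| n)%Z) ->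
  (isotropy Gam u #= `I_p)%card ->
  (0 < p)%N /\ forall t, Gam (turn_at u t) <->
    exists n : int, t = n%:~R * (k%:R * pi / p%:R).
Proof.
move=> [GG G1 GM GI] du k0 lev iso.
pose L t := Gam (turn_at u t); pose c : R := k%:R * pi.
have c0 : 0 < c by rewrite mulr_gt0 ?pi_gt0 // ltr0n.
have L0 : L 0 by rewrite /L turn_at0.
have LN t : L t -> L (- t) by rewrite /L -turn_atN // => /GI.
have LD s t : L s -> L t -> L (s + t) by rewrite /L -turn_atD // => ? ?; exact: GM.
have LM (n : int) t : L t -> L (n%:~R * t).
  have nat (m : nat) : L t -> L (m%:R * t).
    move=> Lt'; elim: m => [|m IH]; first by rewrite mul0r.
    by rewrite -natr1 mulrDl mul1r; exact: LD.
  by move=> Lt'; case: n => m; rewrite ?NegzE ?mulrNz ?mulNr; [exact: nat|apply: LN; exact: nat].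
have Lpi (m : int) : L (m%:~R * pi) <-> (k%:Z %| m)%Z by rewrite /L turn_at_pi.
have Lc : L c.
  have := (Lpi k%:Z).2 (dvdzz _); by rewrite -[k%:Z%:~R]/(k%:R).
pose f t := psu (pi_cov (turn_at u t)).
have fE s t : f s = f t <-> exists m : int, s = t + m%:~R * pi := psu_turn_at s t du.
pose A := [set t | [/\ L t, 0 < t & t <= c]].
(* Angles in A that give the same element of the isotropy group differ by the angle
   of a central element, that is by a multiple of c, so they are equal. *)
have Afin : finite_set A.
  have : (f @` A #= A)%card.
    apply: inj_card_eq => s t; rewrite !inE => -[Ls s0 sc] [Lt' t0 tc] /fE[m em].
    have : L (m%:~R * pi).
      have -> : m%:~R * pi = s + - t by rewrite em; ring.
      by apply: LD => //; exact: LN.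
    move=> /Lpi/dvdzP[l el].
    have {}em : s - t = l%:~R * c.
      by rewrite em el rmorphM /= /c -[k%:Z%:~R]/(k%:R); ring.
    have {el} : l = 0.
      apply/eqP; rewrite -[_ == _]negbK; apply/negP => l0.
      have : (1 : R) <= `|l%:~R| by rewrite -intr_norm ler1z; move: l0; case: l {em el} => // -[].
      have : `|l%:~R * c| < c by rewrite -em ltr_norml; lra.
      rewrite normrM (gtr0_norm c0) -[X in _ < X]mul1r ltr_pM2r //; lra.
    by move: em => /[swap] ->; rewrite mul0r => ?; lra.
  move=> /eq_finite_set <-; apply: sub_finite_set (_ : finite_set (isotropy Gam u)); last by exists p.
  move=> _ [t [Lt' _ _] <-]; exists (turn_at u t) => //; split => //.
  by apply/stabP => //; [exact: Gt_turn_at|exists t].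
have [|mu [Lmu mu0 muc] mumin] := finite_argmin id Afin; first by exists c.
have LE t : L t -> exists n : int, t = n%:~R * mu.
  move=> Lt'; exists (Num.floor (t / mu)).
  have /andP[n1 n2] := floor_itv (t / mu).
  set n := Num.floor _ in n1 n2 *.
  move: n1 n2; rewrite ler_pdivlMr // ltr_pdivrMr // rmorphD /= => n1 n2.
  apply/eqP; rewrite -subr_eq0 -[_ == _]negbK; apply/negP => ne.
  have r0 : 0 < t - n%:~R * mu by rewrite lt_neqAle eq_sym ne /=; lra.
  have : mu <= t - n%:~R * mu.
    apply: (mumin (t - n%:~R * mu)); split => //; last by lra.
    by apply: LD => //; apply: LN; exact: LM.
  by lra.
have [q' eq'] := LE _ Lc.
have q0 : 0 < q'%:~R :> R by rewrite -(pmulr_lgt0 _ mu0) -eq'.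
have [q eq q1] : exists2 q : nat, c = q%:R * mu & (0 < q)%N.
  by case: q' q0 eq' => q q0 eq'; [exists q => //; move: q0; rewrite ltr0z|move: q0; rewrite ltr0z].
have cardq : (isotropy Gam u #= `I_q)%card.
  have -> : isotropy Gam u = range (fun n : int => f (n%:~R * mu)).
    apply/seteqP; split=> X.
      move=> [g [Gg /(stabP du (GG _ Gg))[t et]] <-].
      have [n en] : exists n : int, t = n%:~R * mu by apply: LE; rewrite /L -et.
      by exists n => //; rewrite /f et en.
    move=> [n _ <-]; exists (turn_at u (n%:~R * mu)) => //; split; first exact: LM.
    by apply/stabP => //; [exact: Gt_turn_at|exists (n%:~R * mu)].
  apply: card_range_mod => // i j; rewrite fE; split=> [[m em]|/dvdzP[l el]].
    have /Lpi/dvdzP[l el] : L (m%:~R * pi).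
      have -> : m%:~R * pi = (i - j)%:~R * mu by rewrite rmorphB /= mulrBl em; ring.
      exact: LM.
    have : (i - j)%:~R * mu = (l * q)%:~R * mu.
      rewrite rmorphB /= mulrBl em el !rmorphM /= -[q%:Z%:~R]/(q%:R) -(mulrA l%:~R q%:R) -eq.
      by rewrite -[k%:Z%:~R]/(k%:R) /c; ring.
    move/mulIf => h; apply/dvdzP; exists l; apply: (@intr_inj R); apply: h.
    by rewrite gt_eqF.
  exists (l * k); have -> : i = l * q + j by rewrite -el subrK.
  rewrite rmorphD !rmorphM /= mulrDl -(mulrA l%:~R q%:~R) -[q%:Z%:~R]/(q%:R) -eq.
  by rewrite -[k%:Z%:~R]/(k%:R) /c; ring.
have pq : p = q by apply/card_eq_II; apply: card_eq_trans cardq; rewrite card_eq_sym.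
rewrite pq; split => // t.
have qn0 : q%:R != 0 :> R by rewrite pnatr_eq0 -lt0n.
have -> : k%:R * pi / q%:R = mu by rewrite -/c eq mulrC mulKf.
by split=> [/LE //|[n ->]]; exact: LM.
Qed.

(** By the Bezout identity the angles k pi / p1 and k pi / p2 combine to
    k pi / lcm(p1, p2), which is smaller than pi since k < lcm(p1, p2). *)
Lemma small_angle (k p1 p2 : nat) : (0 < k)%N -> (0 < p1)%N -> (0 < p2)%N ->
  (k < lcmn p1 p2)%N -> exists a b : int,
  let t : R := a%:~R * (k%:R * pi / p1%:R) + b%:~R * (k%:R * pi / p2%:R) in
  0 < t < pi.
Proof.
move=> k0 p10 p20 kp.
have [b [a ab]] := Bezoutz p1%:Z p2%:Z; exists a, b => t.
have p1n : p1%:R != 0 :> R by rewrite pnatr_eq0 -lt0n.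
have p2n : p2%:R != 0 :> R by rewrite pnatr_eq0 -lt0n.
have l0 : (0 < lcmn p1 p2)%N by rewrite lcmn_gt0 p10.
have ln : (lcmn p1 p2)%:R != 0 :> R by rewrite pnatr_eq0 -lt0n.
have gl : (lcmn p1 p2)%:R * (gcdn p1 p2)%:R = p1%:R * p2%:R :> R.
  by rewrite -!natrM muln_lcm_gcd.
have abR : b%:~R * p1%:R + a%:~R * p2%:R = (gcdn p1 p2)%:R :> R.
  have := congr1 (fun z : int => z%:~R : R) ab.
  by rewrite rmorphD !rmorphM.
have -> : t = k%:R * pi / (lcmn p1 p2)%:R.
  have -> : t = k%:R * pi * (b%:~R * p1%:R + a%:~R * p2%:R) / (p1%:R * p2%:R).
    by rewrite /t; field; rewrite p1n p2n.
  have gn : (gcdn p1 p2)%:R != 0 :> R by rewrite pnatr_eq0 -lt0n gcdn_gt0 p10.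
  by rewrite abR -gl; field; rewrite ln gn.
rewrite divr_gt0 ?mulr_gt0 ?pi_gt0 ?ltr0n //=.
by rewrite ltr_pdivrMr ?ltr0n // mulrC ltr_pM2l ?pi_gt0 // ltr_nat.
Qed.

Lemma cyclic_comm Gam : cyclic_subgroup Gam ->
  forall x y, Gam x -> Gam y -> mulG x y = mulG y x.
Proof.
move=> [[GG _ _ _] [c Gc gen]].
have Gtc := GG _ Gc; have Gti := Gt_inv Gtc.
have Git d n : Gt d -> Gt (iter n (mulG d) (oneG R)).
  by move=> Gd; elim: n => [|n IH]; [exact: Gt_one|exact: Gt_mul].
have com_iter d x n : Gt d -> Gt x -> mulG x d = mulG d x ->
    mulG x (iter n (mulG d) (oneG R)) = mulG (iter n (mulG d) (oneG R)) x.
  move=> Gd Gx xd; elim: n => [|n IH]; first by rewrite /= mulG1 ?mul1G.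
  have ? := Git d n Gd.
  by rewrite iterS mulGA // xd -mulGA // IH mulGA.
have com_inv x : Gt x -> mulG x c = mulG c x -> mulG x (invG c) = mulG (invG c) x.
  move=> Gx xc; have e : mulG c (mulG x (invG c)) = x by rewrite mulGA // -xc mulGK.
  by rewrite -{2}e mulKG //; exact: Gt_mul.
have com_gen x y : Gt x -> mulG x c = mulG c x -> Gam y -> mulG x y = mulG y x.
  move=> Gx xc Gy; have [n [->|->]] := gen _ Gy; apply: com_iter => //.
  exact: com_inv.
move=> x y Gx Gy; have Gtx := GG _ Gx.
have xc : mulG x c = mulG c x by rewrite -(com_gen c x).
exact: com_gen.
Qed.

(** Commuting elements preserve each other's fixed points, and u is the only fixed
    point of a nontrivial rotation about u. *)
Lemma abelian_fixes Gam u : subgroup Gam -> disc u ->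
  (forall x y, Gam x -> Gam y -> mulG x y = mulG y x) ->
  fixed_by_nontrivial Gam u -> forall g, Gam g -> exists t, g = turn_at u t.
Proof.
move=> [GG _ _ _] du com [_ [f [Gf /(stabP du (GG _ Gf))[t et]] <-] nt] g Gg.
have Gm := Gt_mover du; have Gi := Gt_inv Gm; have Gtg := GG _ Gg; have Gtt := Gt_turn t.
have st : sin t != 0.
  apply/eqP => /sin0_intmul_pi[n en]; apply: nt; rewrite et -(turn_at0 du).
  by apply/psu_turn_at => //; exists n; rewrite add0r.
pose c := mulG (invG (mover u)) (mulG g (mover u)).
have Gc : Gt c by apply: Gt_mul => //; exact: Gt_mul.
have gE : g = mulG (mulG (mover u) c) (invG (mover u)) := conj_mover du Gtg.
clearbody c.
have cc : mulG (turn t) c = mulG c (turn t).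
  have := com _ _ Gf Gg; rewrite et gE /turn_at.
  have ? := Gt_mul Gm Gc; have ? := Gt_mul Gm Gtt; have ? := Gt_mul Gc Gi; have ? := Gt_mul Gtt Gi.
  have ? := Gt_mul Gtt Gc; have ? := Gt_mul Gc Gtt.
  have e a b : Gt a -> Gt b -> mulG (mulG (mulG (mover u) a) (invG (mover u)))
      (mulG (mulG (mover u) b) (invG (mover u))) =
      mulG (mulG (mover u) (mulG a b)) (invG (mover u)).
    move=> Ga Gb; have ? := Gt_mul Gm Ga; have ? := Gt_mul Gm Gb; have ? := Gt_mul Ga Gb.
    have ? := Gt_mul Gb Gi; have ? := Gt_mul Gm (Gt_mul Gb Gi).
    rewrite -[mulG (mulG (mover u) b) _]mulGA // -[LHS]mulGA // mulKG // [LHS]mulGA //.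
    by rewrite -[mulG (mulG (mover u) a) b]mulGA.
  rewrite (e _ _ Gtt Gc) (e _ _ Gc Gtt) => h.
  have {}h := congr1 (fun z => mulG (invG (mover u)) (mulG z (mover u))) h.
  move: h; rewrite /= !mulGKV ?(mulKG Gm) //; exact: Gt_mul.
have z0 : vz c = 0.
  have := congr1 (@vz R) cc; rewrite mulG_turnl // mulG_turnr // !vz_mkV /expi.
  case: (vz c) => a b /= [e1 e2].
  have h1 : sin t * b = 0 by lra.
  have h2 : sin t * a = 0 by lra.
  move/eqP: h1; rewrite mulf_eq0 (negbTE st) /= => /eqP ->.
  by move/eqP: h2; rewrite mulf_eq0 (negbTE st) /= => /eqP ->.
by exists (valpha c); rewrite gE {1}(vz0_turn Gc z0).
Qed.

End Isotropy.

(** * Discreteness *)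
Section Discreteness.
Variable R : realType.
Local Open Scope complex_scope.
Implicit Types (p q x y g h b k : V R) (u : R[i]) (t C : R) (Gam : set (V R)).

Definition bounded_part C : set (V R) :=
  [set h | [/\ Gt h, vr h <= C & `|valpha h| <= C]].

Lemma vr_mulG_le p q : Gt p -> Gt q -> vr (mulG p q) <= 2 * vr p * vr q.
Proof.
move=> Gp Gq; rewrite vr_mulG.
have := Gt_zr Gp; have := Gt_zr Gq; have := Gt_r0 Gp; have := Gt_r0 Gq.
have := normc_ge0 (vz p); have := normc_ge0 (vz q).
have : normc (mulSU (pi_cov p) (pi_cov q)).2 <= normc (vz p) * normc (vz q) + vr p * vr q.
  apply: le_trans (le_normcD _ _) _.
  rewrite (normcM (pi_cov p).1^*) (normcM (pi_cov p).2) normc_conj !normc_pi2 //.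
by nra.
Qed.

Lemma vr_invG p : vr (invG p) = vr p. Proof. by []. Qed.

(** The group is the graph of r = sqrt (1 + |z|^2) over the coordinates z and alpha. *)
Lemma bounded_part_compact C : exists2 K : set (V R), compact K & bounded_part C `<=` K.
Proof.
pose I : set R := `[- C, C]%classic.
pose f (v : R * R * R) : V R := ((v.1, v.2), Num.sqrt (1 + v.1.1 ^+ 2 + v.1.2 ^+ 2)).
exists (f @` ((I `*` I) `*` I)).
  apply: continuous_compact; last first.
    by apply: compact_setX; [apply: compact_setX|]; exact: segment_compact.
  apply: continuous_subspaceT => v.
  have c1 : (fun w : R * R * R => w.1) @ v --> v.1 by exact: cvg_fst.
  have c2 : (fun w : R * R * R => w.2) @ v --> v.2 by exact: cvg_snd.
  have c11 : (fun w : R * R * R => w.1.1) @ v --> v.1.1 by apply: cvg_comp c1 _; exact: cvg_fst.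
  have c12 : (fun w : R * R * R => w.1.2) @ v --> v.1.2 by apply: cvg_comp c1 _; exact: cvg_snd.
  apply: (cvg_V (p := f v)) => //.
  rewrite /vr /f /=.
  apply: (@cvg_comp _ _ _ _ Num.sqrt _ (nbhs (1 + v.1.1 ^+ 2 + v.1.2 ^+ 2))); last exact: sqrt_continuous.
  apply: cvgD; first apply: cvgD; first exact: cvg_cst.
    by rewrite expr2; under eq_fun do rewrite expr2; apply: cvgM.
  by rewrite expr2; under eq_fun do rewrite expr2; apply: cvgM.
move=> h [Gh rC aC].
have /GtP[r0 er] := Gh.
have zC : complex.Re (vz h) ^+ 2 + complex.Im (vz h) ^+ 2 <= C ^+ 2.
  rewrite -normc_sqr; have := er; have : vr h ^+ 2 <= C ^+ 2 by nra.
  lra.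
have C0 : 0 <= C by lra.
exists (((complex.Re (vz h), complex.Im (vz h)), valpha h)).
  split; first by split; rewrite /I /= in_itv /=; apply/andP; split; nra.
  by rewrite /I /= in_itv /= -ler_norml.
rewrite /f /=.
have -> : Num.sqrt (1 + complex.Re (vz h) ^+ 2 + complex.Im (vz h) ^+ 2) = vr h.
  by rewrite -addrA -normc_sqr -er sqrtr_sqr gtr0_norm.
by case: h {Gh rC aC er zC r0} => [[[? ?] ?] ?].
Qed.

(** A compact set is covered by finitely many open sets in which the quotient of any
    two elements is close to the neutral element, hence trivial in the subgroup. *)
Lemma discrete_finite Gam C : discrete_subgroup Gam -> finite_set (Gam `&` bounded_part C).
Proof.
move=> [[GG G1 GM GI] iso].
have [_ [U U1 UG]] := iso _ G1.
have W x : Gt x -> exists2 A : set (V R), open A /\ A x &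
    forall a b, A a -> A b -> Gam a -> Gam b -> a = b.
  move=> Gx; have Gi := Gt_inv Gx.
  have c : (fun v : V R * V R => mulG (invG v.1) v.2) @ (x, x) --> mulG (invG x) x.
    apply: cvg_mulG => //; [|exact: cvg_snd].
    by apply: cvg_invG; exact: cvg_fst.
  rewrite mulVG // in c; have [[A B] /= [Ax Bx] AB] := c _ U1.
  exists ((A `&` B)^°); first by split; [exact: open_interior|exact: filterI].
  move=> a b /interior_subset[Aa _] /interior_subset[_ Bb] Ga Gb.
  have : (U `&` Gam) (mulG (invG a) b).
    by split; [exact: (AB (a, b))|apply: GM => //; exact: GI].
  by rewrite UG /= => e; rewrite -[b](mulKVG (GG _ Ga)) ?e ?mulG1 //; exact: GG.
have [K cK hK] := bounded_part_compact C.
have [f fP] : {f : V R -> set (V R) & forall x, Gt x -> (open (f x) /\ f x x) /\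
    forall a b, f x a -> f x b -> Gam a -> Gam b -> a = b}.
  apply: (@choice _ _ (fun (x : V R) (A : set (V R)) => Gt x -> (open A /\ A x) /\
    forall a b, A a -> A b -> Gam a -> Gam b -> a = b)) => x.
  have [Gx|nGx] := pselect (Gt x); last by exists set0.
  by have [A h1 h2] := W x Gx; exists A.
have closedK : compact (K `&` @Gt R).
  apply: compact_closedI => //.
  have -> : @Gt R = (@vr R @^-1` [set r | 1 <= r]) `&`
      ((fun p => vr p ^+ 2 - normc (vz p) ^+ 2) @^-1` [set 1]).
    apply/seteqP; split=> p; first by move=> Gp; split; [exact: Gt_r1|move/GtP: Gp => [_ /= ->]; rewrite addrK].
    move=> [h1 h2]; have {}h1 : 1 <= vr p := h1.
    have {}h2 : vr p ^+ 2 - normc (vz p) ^+ 2 = 1 := h2.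
    by apply/GtP; split; lra.
  apply: closedI; apply: closed_comp; try exact: closed_ge; try exact: closed_eq.
    by move=> p _; exact: cvg_vr.
  move=> p _.
  have [h1 h2 h3 h4] := cvg_coords (nbhs_filter p) (@cvg_id _ (nbhs p)).
  have h5 := @cvg_normc _ _ _ (nbhs_filter p) (@vz R) (vz p) h1 h2.
  by apply: cvgB; rewrite expr2; under eq_fun do rewrite expr2; apply: cvgM.
move: closedK; rewrite compact_cover => /(_ (V R) (@Gt R) f) [].
- by move=> x Gx; have [[]] := fP x Gx.
- by move=> x [_ Gx]; exists x => //; have [[]] := fP x Gx.
move=> D0 DG; set D := (X in cover X f) => cov.
have finD : finite_set D by exact: finite_fset.
have sub : Gam `&` bounded_part C `<=` \bigcup_(x in D) (f x `&` Gam).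
  move=> h [Gh bh]; have [x Dx fx] : cover D f h.
    by apply: cov; split; [exact: hK|exact: GG].
  by exists x.
apply: (sub_finite_set sub); apply: bigcup_finite; first exact: finD.
move=> x Dx; have Gx : Gt x by have := DG x Dx; rewrite inE.
have [_ {}sub] := fP x Gx.
have [[a [fa Ga]]|none] := pselect (exists a, (f x `&` Gam) a).
  apply: sub_finite_set (finite_set1 a) => b [fb Gb] /=; exact: sub.
by apply: sub_finite_set (finite_set0 _) => b fb; apply: none; exists b.
Qed.

(** Up to central elements, which belong to the first group, the second group has only
    p elements. So the set of products is a union of p right translates of the first
    group. *)
Lemma prodset_finite Gam1 Gam2 u (k p : nat) C : discrete_subgroup Gam1 -> Gam2 `<=` @Gt R ->
  disc u -> (0 < k)%N -> (0 < p)%N ->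
  (forall n : int, (k%:Z %| n)%Z -> Gam1 (turn (n%:~R * pi))) ->
  (forall h, Gam2 h -> exists n : int, h = turn_at u (n%:~R * (k%:R * pi / p%:R))) ->
  finite_set (prodset Gam1 Gam2 `&` bounded_part C).
Proof.
move=> disc1 GG2 du k0 p0 lev rot2; have [[GG1 _ GM1 _] _] := disc1.
pose e (j : nat) := turn_at u (j%:R * (k%:R * pi / p%:R)).
have Ge j : Gt (e j) := Gt_turn_at _ du.
have cover_e h : prodset Gam1 Gam2 h -> exists2 j : nat, (j < p)%N & Gam1 (mulG h (invG (e j))).
  move=> [g1 G1 [g2 /[dup] G2 /rot2[n en] <-]].
  have m0 : 0 <= (n %% p)%Z by rewrite modz_ge0 // -lt0n.
  exists `|(n %% p)%Z|%N; first by rewrite -ltz_nat gez0_abs // ltz_pmod.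
  set j := `|_|%N.
  have -> : g2 = mulG (turn (((n %/ p)%Z * k)%:~R * pi)) (e j).
    rewrite -(turn_at_pi _ du) turn_atD // en; congr turn_at.
    have -> : j%:R = (n %% p)%Z%:~R :> R by rewrite pmulrn gez0_abs.
    rewrite {1}(divz_eq n p) rmorphD !rmorphM /= -[p%:Z%:~R]/(p%:R) -[k%:Z%:~R]/(k%:R).
    by field; rewrite pnatr_eq0 -lt0n.
  have Gt1 := GG1 _ G1; have Gtt := Gt_turn (((n %/ p)%Z * k)%:~R * pi : R).
  rewrite mulGA // mulGK //; last exact: Gt_mul.
  by apply: GM1 => //; apply: lev; rewrite dvdz_mull.
pose B (j : nat) := 2 * C * vr (e j) + `|C| + `|valpha (e j)| + pi.
have sub : prodset Gam1 Gam2 `&` bounded_part C `<=` \bigcup_(j in `I_p)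
    ((fun g => mulG g (e j)) @` (Gam1 `&` bounded_part (B j))).
  move=> h [/cover_e[j jp G1] [Gh rh ah]]; exists j => //.
  have Gi := Gt_inv (Ge j).
  exists (mulG h (invG (e j))); last by rewrite mulGKV.
  have e0 := Gt_r0 (Ge j); have p3 := pi_gt0 R; have h0 := Gt_r0 Gh.
  split => //; split; first exact: Gt_mul.
    apply: le_trans (vr_mulG_le Gh Gi) _; rewrite vr_invG /B.
    have := normr_ge0 C; have := normr_ge0 (valpha (e j)).
    have : vr h * vr (e j) <= C * vr (e j) by rewrite ler_pM2r.
    by rewrite -!mulrA; lra.
  rewrite valpha_mulG /B.
  have := cocycle_lt h (invG (e j)); move: (cocycle _ _) => c hc.
  have -> : valpha (invG (e j)) = - valpha (e j) by [].
  have := ler_normD (valpha h - valpha (e j)) c; have := ler_normB (valpha h) (valpha (e j)).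
  have : 0 <= C * vr (e j) by apply: mulr_ge0; [lra|exact: ltW].
  have := ler_norm C; rewrite -!mulrA; lra.
apply: (sub_finite_set sub); apply: bigcup_finite; first exact: finite_II.
by move=> j _; apply: finite_image; exact: discrete_finite.
Qed.

End Discreteness.

(** * Totally geodesic surfaces *)
Section TrigonometricPolynomials.
Variable R : realType.
Implicit Types (p v : V R) (f g : V R -> R).

(** The algebra generated by the linear coordinates and by the sine and the cosine
    of the angle. It contains the components of the covering map and is closed under
    directional derivatives, so its elements are smooth. *)
Inductive trigpoly : (V R -> R) -> Prop :=
| Trig_cst c : trigpoly (fun=> c)
| Trig_x : trigpoly (fun p => complex.Re (vz p))
| Trig_y : trigpoly (fun p => complex.Im (vz p))
| Trig_r : trigpoly (fun p => vr p)
| Trig_cos : trigpoly (fun p => cos (valpha p))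
| Trig_sin : trigpoly (fun p => sin (valpha p))
| Trig_add f g : trigpoly f -> trigpoly g -> trigpoly (f \+ g)
| Trig_mul f g : trigpoly f -> trigpoly g -> trigpoly (f \* g).

Let is_diff_fst (U W : normedModType R) (p : U * W) : is_diff p fst fst.
Proof.
have c : continuous (fst : U * W -> U) by move=> q; exact: cvg_fst.
by apply: DiffDef; [exact: linear_differentiable|rewrite diff_lin].
Qed.

Let is_diff_snd (U W : normedModType R) (p : U * W) : is_diff p snd snd.
Proof.
have c : continuous (snd : U * W -> W) by move=> q; exact: cvg_snd.
by apply: DiffDef; [exact: linear_differentiable|rewrite diff_lin].
Qed.

Lemma is_diff_x p : is_diff p (fun p => complex.Re (vz p)) (fun v => complex.Re (vz v)).
Proof.
have h1 := @is_diff_fst _ _ p; have h2 := @is_diff_fst _ _ p.1; have h3 := @is_diff_fst _ _ p.1.1.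
exact: (@is_diff_comp _ _ _ _ _ _ _ _ _ (@is_diff_comp _ _ _ _ _ _ _ _ _ h1 h2) h3).
Qed.

Lemma is_diff_y p : is_diff p (fun p => complex.Im (vz p)) (fun v => complex.Im (vz v)).
Proof.
have h1 := @is_diff_fst _ _ p; have h2 := @is_diff_fst _ _ p.1; have h3 := @is_diff_snd _ _ p.1.1.
exact: (@is_diff_comp _ _ _ _ _ _ _ _ _ (@is_diff_comp _ _ _ _ _ _ _ _ _ h1 h2) h3).
Qed.

Lemma is_diff_valpha p : is_diff p (@valpha R) (@valpha R).
Proof.
have h1 := @is_diff_fst _ _ p; have h2 := @is_diff_snd _ _ p.1.
exact: (@is_diff_comp _ _ _ _ _ _ _ _ _ h1 h2).
Qed.

Lemma is_diff_vr p : is_diff p (@vr R) (@vr R).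
Proof. exact: is_diff_snd. Qed.

Lemma is_diff_1d (f : R -> R) (a df : R) : is_derive a 1 f df -> is_diff a f (fun t => t * df).
Proof.
move=> [d e]; apply: DiffDef; first exact/derivable1_diffP.
by apply/funext => t; rewrite deriv1E // derive1E e /GRing.scale.
Qed.

Lemma is_diff_cos p : is_diff p (fun p => cos (valpha p)) (fun v => valpha v * - sin (valpha p)).
Proof.
exact: (@is_diff_comp _ _ _ _ _ _ _ _ _ (is_diff_valpha p) (is_diff_1d (is_derive_cos (valpha p)))).
Qed.

Lemma is_diff_sin p : is_diff p (fun p => sin (valpha p)) (fun v => valpha v * cos (valpha p)).
Proof.
exact: (@is_diff_comp _ _ _ _ _ _ _ _ _ (is_diff_valpha p) (is_diff_1d (is_derive_sin (valpha p)))).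
Qed.

Lemma trigpoly_diff f : trigpoly f -> forall v, exists2 g, trigpoly g &
  forall p, differentiable f p /\ 'd f p v = g p.
Proof.
have base F (dF : V R -> V R -> R) : (forall p, is_diff p F (dF p)) ->
    forall p v, differentiable F p /\ 'd F p v = dF p v.
  by move=> h p v; have [d e] := h p; split => //; rewrite e.
elim => [c||||||F G TF IF TG IG|F G TF IF TG IG] v.
- exists (fun=> 0); first exact: Trig_cst.
  by move=> p; split; [exact: differentiable_cst|rewrite diff_cst].
- by exists (fun=> complex.Re (vz v)); [exact: Trig_cst|move=> p; exact: base is_diff_x p v].
- by exists (fun=> complex.Im (vz v)); [exact: Trig_cst|move=> p; exact: base is_diff_y p v].
- by exists (fun=> vr v); [exact: Trig_cst|move=> p; exact: base is_diff_vr p v].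
- exists (fun p => valpha v * - sin (valpha p)); last by move=> p; exact: base is_diff_cos p v.
  have -> : (fun p => valpha v * - sin (valpha p)) = (fun=> - valpha v) \* (fun p => sin (valpha p)).
    by apply/funext => p /=; rewrite mulrN mulNr.
  by apply: Trig_mul; [exact: Trig_cst|exact: Trig_sin].
- exists (fun p => valpha v * cos (valpha p)); last by move=> p; exact: base is_diff_sin p v.
  by apply: Trig_mul; [exact: Trig_cst|exact: Trig_cos].
- have [F' TF' hF] := IF v; have [G' TG' hG] := IG v; exists (F' \+ G'); first exact: Trig_add.
  move=> p; have [dF eF] := hF p; have [dG eG] := hG p; split; first exact: differentiableD.
  by rewrite diffD //= eF eG.
- have [F' TF' hF] := IF v; have [G' TG' hG] := IG v.
  exists ((F \* G') \+ (G \* F')); first by apply: Trig_add; exact: Trig_mul.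
  move=> p; have [dF eF] := hF p; have [dG eG] := hG p; split; first exact: differentiableM.
  rewrite (diffM dF dG).
  change (F p * 'd G p v + G p * 'd F p v = F p * G' p + G p * F' p).
  by rewrite eF eG.
Qed.

Lemma trigpoly_differentiable f p : trigpoly f -> differentiable f p.
Proof. by move=> /trigpoly_diff /(_ 0)[g _ h]; have [] := h p. Qed.

Lemma trigpoly_derive f v : trigpoly f -> trigpoly ('D_v f).
Proof.
move=> /trigpoly_diff /(_ v)[g Tg h].
suff -> : 'D_v f = g by [].
by apply/funext => p; have [d e] := h p; rewrite deriveE.
Qed.

(** Two real functions as one map to row vectors, the form in which a submanifold of
    codimension two is defined. *)
Definition rowpair f g (p : V R) : 'rV[R]_2 :=
  f p *: delta_mx 0 0 + g p *: delta_mx 0 1.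

Lemma rowpair_differentiable f g p : trigpoly f -> trigpoly g ->
  differentiable (rowpair f g) p.
Proof.
move=> Tf Tg; apply: differentiableD; apply: differentiableZl; exact: trigpoly_differentiable.
Qed.

Lemma rowpair_diff f g p v : trigpoly f -> trigpoly g ->
  'd (rowpair f g) p v = 'd f p v *: delta_mx 0 0 + 'd g p v *: delta_mx 0 1.
Proof.
move=> Tf Tg; have df := @trigpoly_differentiable f p Tf; have dg := @trigpoly_differentiable g p Tg.
have h (k : V R -> R) (e : 'rV[R]_2) : differentiable k p ->
    is_diff p (fun z => k z *: e) (fun z => 'd k p z *: e).
  by move=> dk; apply: DiffDef; [exact: differentiableZl|exact: diffZl].
have [_ e] := @is_diffD _ _ _ _ _ _ _ _ (h f (delta_mx 0 0) df) (h g (delta_mx 0 1) dg).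
exact: (congr1 (fun F => F v) e).
Qed.

Lemma rowpair_smooth f g (U : set (V R)) : trigpoly f -> trigpoly g -> smooth_on U (rowpair f g).
Proof.
move=> Tf Tg k; elim: k f g Tf Tg => [|k IH] f g Tf Tg /=.
  by move=> p _; apply: differentiable_continuous; exact: rowpair_differentiable.
split=> [p _|v]; first exact: rowpair_differentiable.
have -> : 'D_v (rowpair f g) = rowpair ('D_v f) ('D_v g).
  apply/funext => p; rewrite deriveE; last exact: rowpair_differentiable.
  by rewrite rowpair_diff // /rowpair !deriveE //; exact: trigpoly_differentiable.
by apply: IH; exact: trigpoly_derive.
Qed.

Lemma rowpair_eq (a b c d : R) :
  a *: delta_mx 0 0 + b *: delta_mx 0 1 = c *: delta_mx 0 0 + d *: delta_mx 0 1 :> 'rV[R]_2 <->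
  a = c /\ b = d.
Proof.
split=> [|[-> ->] //] /matrixP e.
by have := e 0 0; have := e 0 1; rewrite !mxE /= !mulr1 !mulr0 !addr0 !add0r.
Qed.

Lemma rowpair_surj (c : 'rV[R]_2) : c = c 0 0 *: delta_mx 0 0 + c 0 1 *: delta_mx 0 1.
Proof.
apply/matrixP => i j; rewrite (ord1 i).
have [->|->] : j = 0 \/ j = 1 by case: j => [[|[|//]] j]; [left|right]; apply: val_inj.
  by rewrite !mxE /= mulr1 mulr0 addr0.
by rewrite !mxE /= mulr1 mulr0 add0r.
Qed.

End TrigonometricPolynomials.

Section Surface.
Variable R : realType.
Local Open Scope complex_scope.
Implicit Types (p q v : V R) (a b w : C2 R) (t e : R).

Definition surface w : set (V R) := [set p | Gt p /\ form w (pi_cov p) = 0].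

(** The differential of pi_cov at p, as a vector of C2. *)
Definition dpi p v : C2 R :=
  (vz v, (vr v * cos (valpha p) - vr p * sin (valpha p) * valpha v) +i*
         (vr v * sin (valpha p) + vr p * cos (valpha p) * valpha v)).

Lemma pi_cov2 p : (pi_cov p).2 = (vr p * cos (valpha p)) +i* (vr p * sin (valpha p)).
Proof. by rewrite /pi_cov /expi /=; apply/eqP; rewrite eq_complex /=; apply/andP; split; apply/eqP; ring. Qed.

Lemma dpi_surj p a : 0 < vr p -> exists v, dpi p v = a.
Proof.
case: a => [a1 [x y]] r0.
exists (mkV a1 ((y * cos (valpha p) - x * sin (valpha p)) / vr p)
            (x * cos (valpha p) + y * sin (valpha p))).
rewrite /dpi !mkVE; congr (_, (_ +i* _)).
  have -> : vr p * sin (valpha p) * ((y * cos (valpha p) - x * sin (valpha p)) / vr p) =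
    sin (valpha p) * (y * cos (valpha p) - x * sin (valpha p)) by field; rewrite gt_eqF.
  rewrite -[RHS]mulr1 -(cos2Dsin2 (valpha p)); ring.
have -> : vr p * cos (valpha p) * ((y * cos (valpha p) - x * sin (valpha p)) / vr p) =
  cos (valpha p) * (y * cos (valpha p) - x * sin (valpha p)) by field; rewrite gt_eqF.
rewrite -[RHS]mulr1 -(cos2Dsin2 (valpha p)); ring.
Qed.

Let x1 p := complex.Re (vz p).
Let x2 p := complex.Im (vz p).
Let x3 p := vr p * cos (valpha p).
Let x4 p := vr p * sin (valpha p).

Lemma form_pi_coords w p : form w (pi_cov p) =
  complex.Re w.1 * x1 p + complex.Im w.1 * x2 p - complex.Re w.2 * x3 p - complex.Im w.2 * x4 p.
Proof. by rewrite formE pi_cov2. Qed.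

Lemma trig_x1 : trigpoly x1. Proof. exact: Trig_x. Qed.
Lemma trig_x2 : trigpoly x2. Proof. exact: Trig_y. Qed.
Lemma trig_x3 : trigpoly x3.
Proof. exact: (Trig_mul (Trig_r R) (Trig_cos R)). Qed.
Lemma trig_x4 : trigpoly x4.
Proof. exact: (Trig_mul (Trig_r R) (Trig_sin R)). Qed.

Lemma is_diff_ext (f g : V R -> R) p (df dg : V R -> R) :
  f =1 g -> df =1 dg -> is_diff p f df -> is_diff p g dg.
Proof. by move=> /funext <- /funext <-. Qed.

Lemma is_diff_x3 p : is_diff p x3 (fun v => complex.Re (dpi p v).2).
Proof.
have h := @is_diffM _ _ _ _ _ _ _ (is_diff_vr p) (is_diff_cos p).
apply: is_diff_ext h => // v.
change (vr p * (valpha v * - sin (valpha p)) + cos (valpha p) * vr v =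
  vr v * cos (valpha p) - vr p * sin (valpha p) * valpha v).
by ring.
Qed.

Lemma is_diff_x4 p : is_diff p x4 (fun v => complex.Im (dpi p v).2).
Proof.
have h := @is_diffM _ _ _ _ _ _ _ (is_diff_vr p) (is_diff_sin p).
apply: is_diff_ext h => // v.
change (vr p * (valpha v * cos (valpha p)) + sin (valpha p) * vr v =
  vr v * sin (valpha p) + vr p * cos (valpha p) * valpha v).
by ring.
Qed.

Lemma trig_form w : trigpoly (fun p => form w (pi_cov p)).
Proof.
have -> : (fun p => form w (pi_cov p)) =
  ((fun=> complex.Re w.1) \* x1 \+ (fun=> complex.Im w.1) \* x2) \+
  ((fun=> - complex.Re w.2) \* x3 \+ (fun=> - complex.Im w.2) \* x4).
  by apply/funext => p; rewrite form_pi_coords /=; ring.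
by do 2?apply: Trig_add; apply: Trig_mul; try exact: Trig_cst;
  [exact: trig_x1|exact: trig_x2|exact: trig_x3|exact: trig_x4].
Qed.

Definition normdef p : R := form (pi_cov p) (pi_cov p) + 1.

Lemma trig_normdef : trigpoly normdef.
Proof.
have -> : normdef = ((x1 \* x1 \+ x2 \* x2) \+
  ((fun=> -1) \* (x3 \* x3) \+ (fun=> -1) \* (x4 \* x4))) \+ (fun=> 1).
  by apply/funext => p; rewrite /normdef form_pi_coords pi_cov2 /=; rewrite /x1 /x2 /x3 /x4; ring.
have h (f : V R -> R) : trigpoly f -> trigpoly (f \* f) by move=> tf; exact: Trig_mul.
have h' (f : V R -> R) : trigpoly f -> trigpoly ((fun=> -1) \* (f \* f)).
  by move=> tf; apply: Trig_mul; [exact: Trig_cst|exact: h].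
apply: Trig_add; last exact: Trig_cst.
apply: Trig_add; apply: Trig_add; do ?apply: h; do ?apply: h'; 
  [exact: trig_x1|exact: trig_x2|exact: trig_x3|exact: trig_x4].
Qed.

Lemma is_diff_lin4 p (c1 c2 c3 c4 : R) (f1 f2 f3 f4 d1 d2 d3 d4 : V R -> R) :
  is_diff p f1 d1 -> is_diff p f2 d2 -> is_diff p f3 d3 -> is_diff p f4 d4 ->
  is_diff p (fun q => c1 * f1 q + c2 * f2 q - c3 * f3 q - c4 * f4 q)
    (fun v => c1 * d1 v + c2 * d2 v - c3 * d3 v - c4 * d4 v).
Proof.
move=> h1 h2 h3 h4.
have k1 := @is_diffD _ _ _ _ _ _ _ _ (@is_diffZ _ _ _ _ _ c1 _ h1) (@is_diffZ _ _ _ _ _ c2 _ h2).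
have k2 := @is_diffB _ _ _ _ _ _ _ _ k1 (@is_diffZ _ _ _ _ _ c3 _ h3).
exact: (@is_diffB _ _ _ _ _ _ _ _ k2 (@is_diffZ _ _ _ _ _ c4 _ h4)).
Qed.

Lemma is_diff_form w p : is_diff p (fun q => form w (pi_cov q)) (fun v => form w (dpi p v)).
Proof.
have h := @is_diff_lin4 p (complex.Re w.1) (complex.Im w.1) (complex.Re w.2) (complex.Im w.2)
  _ _ _ _ _ _ _ _ (is_diff_x p) (is_diff_y p) (is_diff_x3 p) (is_diff_x4 p).
apply: is_diff_ext h => [q|v]; first by rewrite form_pi_coords.
by rewrite formE.
Qed.

Lemma is_diff_normdef p : is_diff p normdef (fun v => 2 * form (pi_cov p) (dpi p v)).
Proof.
have m1 := @is_diffM _ _ _ _ _ _ _ (is_diff_x p) (is_diff_x p).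
have m2 := @is_diffM _ _ _ _ _ _ _ (is_diff_y p) (is_diff_y p).
have m3 := @is_diffM _ _ _ _ _ _ _ (is_diff_x3 p) (is_diff_x3 p).
have m4 := @is_diffM _ _ _ _ _ _ _ (is_diff_x4 p) (is_diff_x4 p).
have h := @is_diff_lin4 p 1 1 1 1 _ _ _ _ _ _ _ _ m1 m2 m3 m4.
have := @is_diffD _ _ _ _ _ _ _ _ h (@is_diff_cst _ _ _ (1 : R) p).
apply: is_diff_ext => [q|v].
  change (1 * (x1 q * x1 q) + 1 * (x2 q * x2 q) - 1 * (x3 q * x3 q) - 1 * (x4 q * x4 q) + 1 = normdef q).
  by rewrite /normdef form_pi_coords pi_cov2 /=; rewrite -/(x1 q) -/(x2 q) -/(x3 q) -/(x4 q); ring.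
rewrite formE pi_cov2.
change (1 * (x1 p * x1 v + x1 p * x1 v) + 1 * (x2 p * x2 v + x2 p * x2 v)
  - 1 * (x3 p * complex.Re (dpi p v).2 + x3 p * complex.Re (dpi p v).2)
  - 1 * (x4 p * complex.Im (dpi p v).2 + x4 p * complex.Im (dpi p v).2) + 0 =
  2 * (x1 p * x1 v + x2 p * x2 v - x3 p * complex.Re (dpi p v).2 - x4 p * complex.Im (dpi p v).2)).
by ring.
Qed.

Lemma surfaceE w p : 0 < vr p -> surface w p <-> normdef p = 0 /\ form w (pi_cov p) = 0.
Proof.
move=> r0; rewrite /surface /normdef /=; split=> -[h1 h2]; split => //.
  by rewrite Gt_form // addNr.
by apply/GtP; split => //; move: h1; rewrite form_piN; lra.
Qed.

Lemma form_sym a b : form a b = form b a.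
Proof. by rewrite !formE; ring. Qed.

Lemma form_add a b c : form a (b + c) = form a b + form a c.
Proof.
by move: a b c => [[? ?] [? ?]] [[? ?] [? ?]] [[? ?] [? ?]]; rewrite !formE /=; ring.
Qed.

Definition smul t b : C2 R := (t%:C * b.1, t%:C * b.2).

Lemma form_smul a t b : form a (smul t b) = t * form a b.
Proof. by move: a b => [[? ?] [? ?]] [[? ?] [? ?]]; rewrite !formE /=; ring. Qed.

Lemma form_nondeg w : w <> 0 -> exists b, form w b = 1.
Proof.
move=> w0; pose N := normc w.1 ^+ 2 + normc w.2 ^+ 2.
have NE : N = complex.Re w.1 ^+ 2 + complex.Im w.1 ^+ 2 + (complex.Re w.2 ^+ 2 + complex.Im w.2 ^+ 2).
  by rewrite /N !normc_sqr.
have N0 : N != 0.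
  apply/eqP => N0; apply: w0; case: w N NE N0 => [[x y] [x' y']] N /= -> N0.
  have sq (r : R) := sqr_ge0 r.
  have z (r : R) : r ^+ 2 <= 0 -> r = 0.
    by move=> r0; apply/eqP; rewrite -sqrf_eq0 eq_le r0 sq.
  have := sq x; have := sq y; have := sq x'; have := sq y' => h1 h2 h3 h4.
  have ex : x = 0 by apply: z; lra.
  have ey : y = 0 by apply: z; lra.
  have ex' : x' = 0 by apply: z; lra.
  have ey' : y' = 0 by apply: z; lra.
  by rewrite ex ey ex' ey'.
exists (smul N^-1 (w.1, - w.2)); rewrite form_smul.
have -> : form w (w.1, - w.2) = N.
  by rewrite NE formE; move: (w) => [[? ?] [? ?]] /=; ring.
by rewrite mulVf.
Qed.

(** A nonzero vector w orthogonal to a point y of the group is not a multiple of y,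
    since form y y = -1; so the two defining equations are independent at y. *)
Lemma surface_submanifold w : w <> 0 -> submanifold 2 (surface w).
Proof.
move=> w0; split => // x Sx.
pose f2 p := form w (pi_cov p).
have tf2 : trigpoly f2 := trig_form w; have tn := trig_normdef.
have zero : 0 = 0 *: delta_mx 0 0 + 0 *: delta_mx 0 1 :> 'rV[R]_2 by rewrite !scale0r addr0.
exists [set p | 0 < vr p], (rowpair normdef f2); split.
- by apply: (@open_comp _ _ (@vr R) [set r | 0 < r]); [move=> p _; exact: cvg_snd|exact: open_gt].
- by apply: Gt_r0; case: Sx.
- exact: rowpair_smooth.
- apply/seteqP; split=> p.
    move=> [Sp p0]; split => //; rewrite [RHS]zero; apply/rowpair_eq.
    exact/(surfaceE w p0).
  by move=> [p0]; rewrite [RHS]zero => /rowpair_eq/(surfaceE w p0).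
move=> y [Gy wy] y0 c.
have yy := Gt_form Gy.
have [b wb] := form_nondeg w0.
(* The component of b orthogonal to y. *)
pose d := b + smul (form (pi_cov y) b) (pi_cov y).
have yd : form (pi_cov y) d = 0 by rewrite form_add form_smul yy mulrN1 subrr.
have wd : form w d = 1 by rewrite form_add form_smul wy mulr0 addr0.
have [v ev] := dpi_surj (smul (- (c 0 0 / 2)) (pi_cov y) + smul (c 0 1) d) y0.
exists v; rewrite rowpair_diff // [RHS]rowpair_surj.
have [_ e1] := is_diff_normdef y; have [_ e2] := is_diff_form w y.
rewrite e1 e2 ev !form_add !form_smul yd wd yy wy.
by congr (_ *: _ + _ *: _); field.
Qed.

(** The relational version of deriveC2, which includes the existence of the derivative. *)
Definition cderive (X : R -> C2 R) t a : Prop :=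
  [/\ is_derive t 1 (fun r => complex.Re (X r).1) (complex.Re a.1),
      is_derive t 1 (fun r => complex.Im (X r).1) (complex.Im a.1),
      is_derive t 1 (fun r => complex.Re (X r).2) (complex.Re a.2) &
      is_derive t 1 (fun r => complex.Im (X r).2) (complex.Im a.2)].

Lemma cderiveE X t a : cderive X t a -> deriveC2 X t = a.
Proof.
move=> [[_ h1] [_ h2] [_ h3] [_ h4]]; case: a h1 h2 h3 h4 => [[a1 a2] [a3 a4]] /= h1 h2 h3 h4.
by rewrite /deriveC2 /deriveC !derive1E h1 h2 h3 h4.
Qed.

Lemma cderive_form X Y t a b : cderive X t a -> cderive Y t b ->
  is_derive t 1 (fun r => form (X r) (Y r)) (form a (Y t) + form (X t) b).
Proof.
move=> [h1 h2 h3 h4] [k1 k2 k3 k4].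
have -> : (fun r => form (X r) (Y r)) =
  ((fun r => complex.Re (X r).1) * (fun r => complex.Re (Y r).1) +
   (fun r => complex.Im (X r).1) * (fun r => complex.Im (Y r).1) -
   (fun r => complex.Re (X r).2) * (fun r => complex.Re (Y r).2) -
   (fun r => complex.Im (X r).2) * (fun r => complex.Im (Y r).2)).
  by apply/funext => r; rewrite formE.
apply: is_derive_eq.
rewrite !formE /GRing.scale /=; ring.
Qed.

Lemma cderive_cst w t : cderive (fun=> w) t 0.
Proof. by split; exact: is_derive_cst. Qed.

End Surface.

Section Geodesics.
Variable R : realType.
Local Open Scope complex_scope.
Implicit Types (p q v : V R) (a b w : C2 R) (t e : R).

Lemma is_derive_continuous (f : R -> R) t d : is_derive t 1 f d -> {for t, continuous f}.
Proof. by move=> [/derivable1_diffP h _]; exact: differentiable_continuous. Qed.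

(** Uniqueness for the linear equation h'' = k h with bounded k: the energy of a
    solution that vanishes to first order grows at most exponentially from zero. *)
Lemma ode_zero (h h1 h2 k : R -> R) (e M : R) : 0 <= M ->
  (forall t, `|t| < e -> [/\ is_derive t 1 h (h1 t), is_derive t 1 h1 (h2 t),
     h2 t = k t * h t & `|k t| <= M]) ->
  h 0 = 0 -> h1 0 = 0 -> forall t, `|t| < e -> h t = 0.
Proof.
move=> M0 eqn h0 h10.
pose E t := h t * h t + h1 t * h1 t.
pose E' t := 2 * (h t * h1 t) * (1 + k t).
have dE t : `|t| < e -> is_derive t 1 E (E' t).
  move=> /eqn[d1 d2 e2 _].
  apply: is_derive_eq.
  by rewrite /E' e2 /GRing.scale /=; ring.
have bE t : `|t| < e -> `|E' t| <= (1 + M) * E t.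
  move=> /eqn[_ _ _ kM]; rewrite /E' normrM mulrC.
  have k1 : `|1 + k t| <= 1 + M by apply: le_trans (ler_normD _ _) _; rewrite normr1 lerD2l.
  apply: ler_pM => //; rewrite /E ler_norml; apply/andP.
  by have := sqr_ge0 (h t + h1 t); have := sqr_ge0 (h t - h1 t); rewrite !expr2; split; nra.
have E00 : E 0 = 0 by rewrite /E h0 h10 mulr0 addr0.
suff E0 t : `|t| < e -> E t <= 0.
  move=> t /E0; rewrite /E => le; apply/eqP; rewrite -sqrf_eq0 expr2.
  have := sqr_ge0 (h t); have := sqr_ge0 (h1 t); rewrite !expr2 => a b.
  by apply/eqP; lra.
(* The energy times an exponential is monotone on each side of zero. *)
have mono (c r : R) : `|r| < e -> is_derive r 1 (fun s => expR (c * s) * E s)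
    (expR (c * r) * (c * E r + E' r)).
  move=> te; have dEt := dE r te.
  have dexp : is_derive r 1 (fun s => expR (c * s)) (expR (c * r) * c).
    apply: (@is_derive1_comp _ expR (fun s => c * s)).
    by apply: is_derive_eq; rewrite /GRing.scale /= mulr1.
  have := @is_deriveM _ _ _ _ _ _ _ _ dexp dEt.
  move=> h'; apply: (@is_derive_eq _ _ _ _ _ _ _ _ h').
  by rewrite /GRing.scale /=; ring.
have cont c (x y : R) : - e < x -> y < e -> {within `[x, y], continuous (fun s => expR (c * s) * E s)}.
  move=> xe ye; apply: continuous_in_subspaceT => s.
  rewrite inE /= in_itv /= => /andP[xs sy]; apply: is_derive_continuous; apply: mono.
  by rewrite ltr_norml; lra.
move=> te; move: (te); rewrite ltr_norml => /andP[t1 t2].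
case: (ltrgtP t 0) => [tn|tp|->]; last by rewrite E00.
- have [||s] := @MVT R (fun s => expR ((1 + M) * s) * E s)
    (fun s => expR ((1 + M) * s) * ((1 + M) * E s + E' s)) t 0 tn.
  + by move=> s; rewrite in_itv /= => /andP[*]; apply: mono; rewrite ltr_norml; lra.
  + by apply: cont; lra.
  rewrite in_itv /= => /andP[s1 s2]; rewrite E00 mulr0 sub0r sub0r => eq.
  have se : `|s| < e by rewrite ltr_norml; lra.
  have := bE s se; rewrite ler_norml => /andP[b1 b2].
  have x0 := expR_gt0 ((1 + M) * s); have x1 := expR_gt0 ((1 + M) * t).
  have : 0 <= expR ((1 + M) * s) * ((1 + M) * E s + E' s) * - t by apply: mulr_ge0; [apply: mulr_ge0; lra|lra].
  rewrite -eq oppr_ge0 pmulr_rle0 //.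
- have [||s] := @MVT R (fun s => expR (- (1 + M) * s) * E s)
    (fun s => expR (- (1 + M) * s) * (- (1 + M) * E s + E' s)) 0 t tp.
  + by move=> s; rewrite in_itv /= => /andP[*]; apply: mono; rewrite ltr_norml; lra.
  + by apply: cont; lra.
  rewrite in_itv /= => /andP[s1 s2]; rewrite E00 mulr0 subr0 subr0 => eq.
  have se : `|s| < e by rewrite ltr_norml; lra.
  have := bE s se; rewrite ler_norml => /andP[b1 b2].
  have x0 := expR_gt0 (- (1 + M) * s); have x1 := expR_gt0 (- (1 + M) * t).
  have : expR (- (1 + M) * s) * (- (1 + M) * E s + E' s) * t <= 0.
    by rewrite pmulr_lle0 // pmulr_rle0 //; lra.
  rewrite -eq pmulr_rle0 //.
Qed.

(** The vector w + form X w * X is tangent to the level form X X = -1, so the normal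
    acceleration X'' gives h'' = k h for h = form w X with k = - form X'' X. By
    differentiating form X X = -1 twice, k = form X' X', which is continuous at zero
    and hence bounded near it. *)
Lemma geodesic_hyperplane (X X1 X2 : R -> C2 R) w e : 0 < e ->
  (forall t, `|t| < e -> [/\ cderive X t (X1 t), cderive X1 t (X2 t), form (X t) (X t) = -1 &
     forall a, form (X t) a = 0 -> form (X2 t) a = 0]) ->
  form w (X 0) = 0 -> form w (X1 0) = 0 -> \forall t \near (0 : R), form w (X t) = 0.
Proof.
move=> e0 hX w0 w1.
pose k t := - form (X2 t) (X t).
have nearby t : `|t| < e -> \forall s \near t, `|s| < e.
  move=> te; apply: (@near_lt R R (fun s => `|s|) t e) => //.
  exact: norm_continuous.
have k1 t : `|t| < e -> k t = form (X1 t) (X1 t).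
  move=> te; have [d1 d2 _ _] := hX t te.
  have zero s : `|s| < e -> form (X1 s) (X s) = 0.
    move=> se; have [c1 _ _ _] := hX s se.
    have [_ e1] := cderive_form c1 c1.
    have : 'D_1 (fun r => form (X r) (X r)) s = 'D_1 (fun=> -1 : R) s.
      by apply: near_eq_derive; apply: filterS (nearby s se) => r /hX[].
    by rewrite e1 derive_cst (form_sym (X s)); lra.
  have [_ e2] := cderive_form d2 d1.
  have : 'D_1 (fun r => form (X1 r) (X r)) t = 'D_1 (fun=> 0 : R) t.
    by apply: near_eq_derive; apply: filterS (nearby t te) => r /zero.
  by rewrite e2 derive_cst /k; lra.
have e00 : `|0 : R| < e by rewrite normr0.
have kc : {for 0, continuous (fun t => `|form (X1 t) (X1 t)|)}.
  have [_ d2 _ _] := hX 0 e00.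
  by apply: cvg_norm; exact: (is_derive_continuous (cderive_form d2 d2)).
pose M := `|form (X1 0) (X1 0)| + 1.
have kM : \forall t \near (0 : R), `|form (X1 t) (X1 t)| < M.
  by apply: near_lt => //; rewrite ltrDl.
have both : \forall t \near (0 : R), `|form (X1 t) (X1 t)| < M /\ `|t| < e.
  by apply: filterI kM (nearby 0 e00).
have /nbhs_ballP[d /= d0 hd] := both.
have ball_lt t : `|t| < d -> ball (0 : R) d t by rewrite /ball /= sub0r normrN.
have H : forall t, `|t| < d -> form w (X t) = 0.
  apply: (@ode_zero (fun t => form w (X t)) (fun t => form w (X1 t)) (fun t => form w (X2 t)) k d M) => //.
    by rewrite addr_ge0.
  move=> t /ball_lt/hd[/= tM te]; have [d1 d2 n geo] := hX t te.
  have lin Y Y' : cderive Y t Y' -> is_derive t 1 (fun s => form w (Y s)) (form w Y').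
    move=> dY; apply: (@is_derive_eq _ _ _ _ _ _ _ _ (cderive_form (cderive_cst w t) dY)).
    by rewrite !formE /=; ring.
  split; [exact: lin|exact: lin| |by rewrite k1 // ltW].
  have := geo (w + smul (form (X t) w) (X t)).
  rewrite !form_add !form_smul n mulrN1 subrr (form_sym w (X t)) (form_sym w (X2 t)) /k => /(_ erefl).
  by lra.
by apply/nbhs_ballP; exists d => // t /=; rewrite /ball /= sub0r normrN => /H.
Qed.

Lemma derivable_comp_diff (W : normedModType R) (c : R -> W) (f : W -> R) t :
  derivable c t 1 -> differentiable f (c t) ->
  is_derive t 1 (fun s => f (c s)) ('d f (c t) (derive1 c t)).
Proof.
move=> /derivable1_diffP dc df.
have d := differentiable_comp dc df.
apply: DeriveDef; first exact/derivable1_diffP.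
rewrite deriveE // (diff_comp dc df) /=; congr ('d f (c t) _).
by rewrite derive1E deriveE.
Qed.

Lemma cderive_pi (c : R -> V R) t : derivable c t 1 ->
  cderive (fun s => pi_cov (c s)) t (dpi (c t) (derive1 c t)).
Proof.
move=> dc.
have D (f : V R -> R) (df : V R -> R) : is_diff (c t) f df ->
    is_derive t 1 (fun s => f (c s)) (df (derive1 c t)).
  by move=> [d e]; have := derivable_comp_diff dc d; rewrite e.
have e3 : (fun s => complex.Re (pi_cov (c s)).2) = fun s => vr (c s) * cos (valpha (c s)).
  by apply/funext => s; rewrite pi_cov2.
have e4 : (fun s => complex.Im (pi_cov (c s)).2) = fun s => vr (c s) * sin (valpha (c s)).
  by apply/funext => s; rewrite pi_cov2.
split; [exact: (D _ _ (is_diff_x _))|exact: (D _ _ (is_diff_y _))| |].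
  by rewrite e3; exact: (D _ _ (is_diff_x3 _)).
by rewrite e4; exact: (D _ _ (is_diff_x4 _)).
Qed.

Lemma cderive_dpi (c : R -> V R) t : derivable c t 1 -> derivable (derive1 c) t 1 ->
  exists a, cderive (fun s => dpi (c s) (derive1 c s)) t a.
Proof.
move=> dc dc'.
have D (g : R -> V R) (f : V R -> R) (df : V R -> R) : derivable g t 1 -> is_diff (g t) f df ->
    derivable (fun s => f (g s)) t 1.
  by move=> dg [d _]; have [] := derivable_comp_diff dg d.
have y1 := D _ _ _ dc' (is_diff_x _); have y2 := D _ _ _ dc' (is_diff_y _).
have r' := D _ _ _ dc' (is_diff_vr _); have a' := D _ _ _ dc' (is_diff_valpha _).
have r := D _ _ _ dc (is_diff_vr _).
have C := D _ _ _ dc (is_diff_cos _); have S := D _ _ _ dc (is_diff_sin _).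
have y3 : derivable (fun s => complex.Re (dpi (c s) (derive1 c s)).2) t 1.
  exact: (derivableB (derivableM r' C) (derivableM (derivableM r S) a')).
have y4 : derivable (fun s => complex.Im (dpi (c s) (derive1 c s)).2) t 1.
  exact: (derivableD (derivableM r' S) (derivableM (derivableM r C) a')).
exists (deriveC2 (fun s => dpi (c s) (derive1 c s)) t).
have P (f : R -> R) : derivable f t 1 -> is_derive t 1 f (derive1 f t).
  by move=> df; rewrite derive1E; exact: derivableP.
by split; [exact: P y1|exact: P y2|exact: P y3|exact: P y4].
Qed.

(** For a geodesic tangent to the surface at its starting point, both the position and
    the velocity in C2 are orthogonal to w there. *)
Lemma surface_totally_geodesic w : w <> 0 -> totally_geodesic 2 (surface w).
Proof.
move=> w0; split; [by move=> p []|exact: surface_submanifold|].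
move=> c geo [Gc0 wc0] [g [g0 gS dg gE]].
have /nbhs_ballP[e /= e0 he] := geo.
have ball_lt t : `|t| < e -> ball (0 : R) e t by rewrite /ball /= sub0r normrN.
pose X s := pi_cov (c s); pose X1 s := dpi (c s) (derive1 c s).
have dX t : `|t| < e -> cderive X t (X1 t).
  by move=> /ball_lt/he[_ dc _ _]; exact: cderive_pi.
have nearby t : `|t| < e -> \forall s \near t, `|s| < e.
  move=> te; apply: (@near_lt R R (fun s => `|s|) t e) => //.
  exact: norm_continuous.
have dX1 t : `|t| < e -> cderive X1 t (deriveC2 (deriveC2 X) t).
  move=> te; have [_ dc dc' _] := he _ (ball_lt _ te).
  have [a da] := cderive_dpi dc dc'.
  suff -> : deriveC2 (deriveC2 X) t = a by [].
  apply: cderiveE; case: da => h1 h2 h3 h4.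
  have eqX : \forall s \near t, X1 s = deriveC2 X s.
    by apply: filterS (nearby t te) => s se; rewrite (cderiveE (dX s se)).
  have N (f : C2 R -> R) d : is_derive t 1 (fun s => f (X1 s)) d -> is_derive t 1 (fun s => f (deriveC2 X s)) d.
    by apply: near_eq_is_derive; apply: filterS eqX => s ->.
  split.
  - exact: (N (fun z => complex.Re z.1)).
  - exact: (N (fun z => complex.Im z.1)).
  - exact: (N (fun z => complex.Re z.2)).
  - exact: (N (fun z => complex.Im z.2)).
have w1 : form w (X1 0) = 0.
  have dg1 := cderive_form (cderive_cst w 0) (cderive_pi dg).
  have [_ ee] := dg1.
  have : 'D_1 (fun r => form w (pi_cov (g r))) (0 : R) = 'D_1 (fun=> 0 : R) (0 : R).
    by apply: near_eq_derive; apply: filterS gS => s [].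
  rewrite ee derive_cst g0 gE => h.
  have z a : form 0 a = 0 by rewrite formE !mul0r !subr0 addr0.
  by move: h; rewrite z add0r.
have H : \forall t \near (0 : R), form w (X t) = 0.
  apply: (@geodesic_hyperplane X X1 (fun t => deriveC2 (deriveC2 X) t) w e) => // t te.
  have [Gt' _ _ nor] := he _ (ball_lt _ te).
  by split; [exact: dX|exact: dX1|exact: Gt_form|exact: nor].
have both : \forall t \near (0 : R), [/\ Gt (c t), derivable c t 1, derivable (derive1 c) t 1 &
    forall a, form (pi_cov (c t)) a = 0 -> form (deriveC2 (deriveC2 X) t) a = 0] /\ form w (X t) = 0.
  by apply: filterI geo H.
by apply: filterS both => t [[Gt' _ _ _] h].
Qed.

End Geodesics.

(** * Transport along homeomorphisms and a finite category argument *)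
Section Topology.
Implicit Types (T U : topologicalType).

Lemma within_continuousP T U (X : set T) (f : T -> U) (x : T) (W : set U) :
  {within X, continuous f} -> X x -> nbhs (f x) W ->
  exists2 N, nbhs x N & forall y, N y -> X y -> W (f y).
Proof.
move=> /subspace_continuousP cf Xx nW.
by exists [set y | X y -> W (f y)] => //; exact: (cf x Xx W nW).
Qed.

Section Homeomorphism.
Variables (T U : topologicalType) (X : set T) (Y : set U) (f : T -> U) (f' : U -> T).
Hypotheses (XY : forall x, X x -> Y (f x)) (YX : forall y, Y y -> X (f' y)).
Hypotheses (fK : forall x, X x -> f' (f x) = x) (fK' : forall y, Y y -> f (f' y) = y).
Hypotheses (cf : {within X, continuous f}) (cf' : {within Y, continuous f'}).

Lemma closure_in_homeo_sub (A : set T) : A `<=` X ->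
  f @` closure_in X A `<=` closure_in Y (f @` A).
Proof.
move=> AX; have AY : f @` A `<=` Y by move=> _ [x /AX/XY ? <-].
rewrite !closure_inP // => _ [x [cl Xx] <-]; split; last exact: XY.
move=> W nW; have [N nN NW] := within_continuousP cf Xx nW.
by have [a [Aa Na]] := cl N nN; exists (f a); split; [exists a|apply: NW => //; exact: AX].
Qed.

Lemma interior_in_homeo_sub (A : set T) : A `<=` X ->
  f @` interior_in X A `<=` interior_in Y (f @` A).
Proof.
move=> AX _ [x ix <-]; have Xx : X x by apply: AX; exact: interior_in_sub ix.
move/(interior_inP _ Xx): ix => [N nN NA].
have Yx := XY Xx.
have nN' : nbhs (f' (f x)) N by rewrite fK.
have [W nW WN] := within_continuousP cf' Yx nN'.
apply/(interior_inP _ Yx); exists W => // y [Wy Yy]; exists (f' y); last exact: fK'.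
by apply: NA; split; [exact: WN|exact: YX].
Qed.

End Homeomorphism.

Section HomeomorphismEq.
Variables (T U : topologicalType) (X : set T) (Y : set U) (f : T -> U) (f' : U -> T).
Hypotheses (XY : forall x, X x -> Y (f x)) (YX : forall y, Y y -> X (f' y)).
Hypotheses (fK : forall x, X x -> f' (f x) = x) (fK' : forall y, Y y -> f (f' y) = y).
Hypotheses (cf : {within X, continuous f}) (cf' : {within Y, continuous f'}).

Let imK (A : set T) : A `<=` X -> f' @` (f @` A) = A.
Proof.
move=> AX; apply/seteqP; split=> [_ [_ [a Aa <-] <-]|a Aa]; first by rewrite fK //; exact: AX.
by exists (f a); [exists a|rewrite fK //; exact: AX].
Qed.

Let imY (A : set T) : A `<=` X -> f @` A `<=` Y.
Proof. by move=> AX _ [x /AX/XY ? <-]. Qed.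

Lemma closure_in_homeo (A : set T) : A `<=` X ->
  f @` closure_in X A = closure_in Y (f @` A).
Proof.
move=> AX; apply/seteqP; split; first exact: (closure_in_homeo_sub XY cf).
move=> y cy; have Yy : Y y by move: cy; rewrite closure_inP; [case|exact: imY].
exists (f' y); last exact: fK'.
rewrite -(imK AX); apply: (closure_in_homeo_sub YX cf' (imY AX)).
by exists y.
Qed.

Lemma interior_in_homeo (A : set T) : A `<=` X ->
  f @` interior_in X A = interior_in Y (f @` A).
Proof.
move=> AX; apply/seteqP; split; first exact: (interior_in_homeo_sub XY YX fK fK' cf').
move=> y iy; have Yy : Y y by apply: (imY AX); exact: interior_in_sub iy.
exists (f' y); last exact: fK'.
rewrite -(imK AX); apply: (interior_in_homeo_sub YX XY fK' fK cf (imY AX)).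
by exists y.
Qed.

End HomeomorphismEq.

(** The first closed set either contains the whole open set, or the part outside of
    it is open, nonempty and covered by the remaining sets. *)
Lemma finite_closed_cover T (I : eqType) (S : set I) (Z : I -> set T) (W : set T) :
  finite_set S -> open W -> W !=set0 -> (forall i, S i -> closed (Z i)) ->
  (forall x, W x -> exists2 i, S i & Z i x) ->
  exists2 i, S i & (W `&` (Z i)^°) !=set0.
Proof.
move=> /finite_seqP[l ->]; elim: l W => [|i l IH] W oW [x Wx] cZ cov.
  by case: (cov x Wx).
have [[y [Wy nZ]]|none] := pselect ((W `&` ~` Z i) !=set0).
  have oW' : open (W `&` ~` Z i).
    by apply: openI => //; apply: closed_openC; apply: cZ; rewrite /= mem_head.
  have neW' : (W `&` ~` Z i) !=set0 by exists y.
  have cZ' j : [set` l] j -> closed (Z j) by move=> jl; apply: cZ; rewrite /= in_cons jl orbT.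
  have cov' z : (W `&` ~` Z i) z -> exists2 j, [set` l] j & Z j z.
    move=> [Wz nz]; have [j /=] := cov z Wz.
    by rewrite in_cons => /orP[/eqP -> //|jl Zj]; exists j.
  have [j jl [z [[Wz _] iz]]] := IH _ oW' neW' cZ' cov'.
  by exists j; [rewrite /= in_cons jl orbT|exists z].
exists i; first by rewrite /= mem_head.
exists x; split => //; rewrite /interior /=.
apply: filterS (open_nbhs_nbhs (conj oW Wx)) => z Wz; apply: contrapT => nz.
by apply: none; exists z.
Qed.

End Topology.

(** * Distinct elements have distinct functions *)
Section FormZero.
Variable R : realType.
Local Open Scope complex_scope.
Implicit Types (p q x y g h b : V R) (t : R).

(** Varying the angle at b in both directions gives the vanishing of the second
    component of w, and varying z along the two axes then that of the first. *)
Lemma form_open_zero (w : C2 R) b (U : set (V R)) : Gt b -> nbhs b U ->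
  (forall p, U p -> Gt p -> form w (pi_cov p) = 0) -> w = 0.
Proof.
move=> Gb nU zero.
have [b0 er] := (GtP b).1 Gb.
case: w zero => [[w1 w2] [w3 w4]] zero.
have val p : U p -> Gt p -> w1 * complex.Re (vz p) + w2 * complex.Im (vz p) =
    vr p * (w3 * cos (valpha p) + w4 * sin (valpha p)).
  by move=> Up Gp; have := zero p Up Gp; rewrite form_pi_coords /=; lra.
have Ub := nbhs_singleton nU.
(* A curve through b stays in U for small parameters of both signs. *)
have small (c : R -> V R) : c @ (0 : R) --> c 0 -> c 0 = b ->
    exists2 t, 0 < t < 1 & U (c t) /\ U (c (- t)).
  move=> cc c0; have : nbhs (0 : R) (c @^-1` U) by apply: cc; rewrite c0.
  move=> /nbhs_ballP[e /= e0 eU].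
  have m1 : Num.min (e / 2) 2^-1 < e by rewrite gt_min; apply/orP; left; lra.
  have m0 : 0 < Num.min (e / 2) 2^-1 by rewrite lt_min; lra.
  exists (Num.min (e / 2) 2^-1); first by rewrite m0 gt_min; apply/orP; right; lra.
  by split; apply: eU; rewrite /ball /= sub0r normrN ?normrN gtr0_norm.
have cid : (fun t : R => t) @ (0 : R) --> (0 : R) by exact: cvg_id.
have [w30 w40] : w3 = 0 /\ w4 = 0.
  pose c t := mkV (vz b) (valpha b + t) (vr b) : V R.
  have Gc t : Gt (c t) by apply/GtP; rewrite /c !mkVE.
  have c0 : c 0 = b by rewrite /c addr0 mkVK.
  have [|//|t /andP[t0 t1] [U1 U2]] := small c.
    apply: cvg_V; rewrite /c; try by under eq_fun do rewrite ?mkVE; rewrite ?mkVE; exact: cvg_cst.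
    by apply: cvgD; [exact: cvg_cst|exact: cid].
  have := val _ Ub Gb; have := val _ U1 (Gc t); have := val _ U2 (Gc (- t)).
  rewrite /c !mkVE !cosD !sinD cosN sinN => -> /(mulfI (lt0r_neq0 b0)) e1 /esym/(mulfI (lt0r_neq0 b0)) e2.
  have st : 0 < sin t by apply: sin_gt0_pi; have := pi_ge2 R; rewrite t0 /=; lra.
  have ct : cos t != 1.
    apply/eqP => ct; have := cos2Dsin2 t; rewrite ct expr1n => h.
    by have := exprn_gt0 2 st; lra.
  set C := cos (valpha b) in e1 e2 *; set S := sin (valpha b) in e1 e2 *.
  have CS : C ^+ 2 + S ^+ 2 = 1 := cos2Dsin2 (valpha b).
  have f1 : sin t * (w4 * C - w3 * S) = 0 by lra.
  have f2 : (cos t - 1) * (w3 * C + w4 * S) = 0 by lra.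
  move/eqP: f1; rewrite mulf_eq0 (gt_eqF st) /= => /eqP f1.
  move/eqP: f2; rewrite mulf_eq0 subr_eq0 (negbTE ct) /= => /eqP f2.
  split.
    by rewrite -[w3]mulr1 -CS; transitivity (C * (w3 * C + w4 * S) - S * (w4 * C - w3 * S)); [ring|rewrite f1 f2; ring].
  by rewrite -[w4]mulr1 -CS; transitivity (S * (w3 * C + w4 * S) + C * (w4 * C - w3 * S)); [ring|rewrite f1 f2; ring].
have lift (z : R -> R[i]) : z 0 = vz b ->
    (fun t => complex.Re (z t)) @ (0 : R) --> complex.Re (z 0) ->
    (fun t => complex.Im (z t)) @ (0 : R) --> complex.Im (z 0) ->
    exists2 t, 0 < t < 1 & w1 * complex.Re (z t) + w2 * complex.Im (z t) = 0.
  move=> z0 cr ci.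
  pose c t := mkV (z t) (valpha b) (Num.sqrt (1 + normc (z t) ^+ 2)) : V R.
  have n0 t : 0 < 1 + normc (z t) ^+ 2 by apply: ltr_wpDr => //; exact: sqr_ge0.
  have Gc t : Gt (c t) by apply/GtP; rewrite /c !mkVE sqrtr_gt0 n0 sqr_sqrtr // ltW.
  have c0 : c 0 = b.
    by rewrite /c z0 -er sqrtr_sqr gtr0_norm // mkVK.
  have [|//|t t01 [U1 _]] := small c.
    apply: cvg_V; rewrite /c; under eq_fun do rewrite ?mkVE; rewrite ?mkVE //; first exact: cvg_cst.
    apply: (@cvg_comp _ _ _ _ Num.sqrt _ (nbhs (1 + normc (z 0) ^+ 2))); last exact: sqrt_continuous.
    apply: cvgD; first exact: cvg_cst.
    by rewrite expr2; under eq_fun do rewrite expr2; apply: cvgM; exact: cvg_normc.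
  by exists t => //; have := val _ U1 (Gc t); rewrite /c !mkVE w30 w40 !mul0r addr0 mulr0.
have zb : w1 * complex.Re (vz b) + w2 * complex.Im (vz b) = 0.
  by rewrite (val _ Ub Gb) w30 w40 !mul0r addr0 mulr0.
have w10 : w1 = 0.
  have [|||t /andP[t0 _]] := lift (fun t => (complex.Re (vz b) + t) +i* complex.Im (vz b)).
  - by rewrite addr0; case: (vz b).
  - by apply: cvgD; [exact: cvg_cst|exact: cid].
  - exact: cvg_cst.
  move=> /= e; have : t * w1 = 0 by lra.
  by move/eqP; rewrite mulf_eq0 (gt_eqF t0) => /eqP.
have w20 : w2 = 0.
  have [|||t /andP[t0 _]] := lift (fun t => complex.Re (vz b) +i* (complex.Im (vz b) + t)).
  - by rewrite addr0; case: (vz b).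
  - exact: cvg_cst.
  - by apply: cvgD; [exact: cvg_cst|exact: cid].
  move=> /= e; have : t * w2 = 0 by lra.
  by move/eqP; rewrite mulf_eq0 (gt_eqF t0) => /eqP.
by rewrite w10 w20 w30 w40.
Qed.

(** The angles of distinct elements with the same image differ by at least a full turn,
    so the sheets on which their functions are positive are disjoint. *)
Lemma same_pi g h b : Gt g -> Gt h -> pi_cov g = pi_cov h ->
  0 < psi g b -> 0 < psi h b -> g = h.
Proof.
move=> Gg Gh e /psi_gt0[lg _] /psi_gt0[lh _]; apply: lift_uniq => //.
have := ler_normB (valpha b - valpha h) (valpha b - valpha g).
have -> : valpha b - valpha h - (valpha b - valpha g) = valpha g - valpha h by ring.
by move=> h'; lra.
Qed.

(** Near b the functions are minus the forms with the images of g and h, so the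
    difference of the images is orthogonal to an open piece of the group. *)
Lemma psi_inj_near g h b (U : set (V R)) : Gt g -> Gt h -> Gt b -> nbhs b U ->
  (forall p, U p -> Gt p -> 0 < psi g p /\ psi g p = psi h p) -> g = h.
Proof.
move=> Gg Gh Gb nU eq; have [p0 e] := eq _ (nbhs_singleton nU) Gb.
apply: (@same_pi g h b) => //; last by rewrite -e.
apply/eqP; rewrite -subr_eq0; apply/eqP; apply: (form_open_zero Gb nU) => p Up Gp.
have [pp ep] := eq p Up Gp.
have := psi_form pp; rewrite ep psi_form -?ep // => /oppr_inj e'.
rewrite form_sym form_add.
have -> : form (pi_cov p) (- pi_cov h) = - form (pi_cov p) (pi_cov h) by rewrite !formE /=; ring.
by rewrite !(form_sym (pi_cov p)) e' subrr.
Qed.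

End FormZero.

(** * The function defining the polytope *)
Section MinMax.
Variables (R : realType) (Gam1 Gam2 : set (V R)) (u : R[i]) (d1 d2 : R).
Local Open Scope complex_scope.
Implicit Types (p q x y g h b k : V R) (t C : R).
Hypothesis sub1 : subgroup Gam1.
Hypothesis sub2 : subgroup Gam2.
Hypothesis du : disc u.
Hypothesis rot2 : forall h, Gam2 h -> exists t, h = turn_at u t.
Hypothesis ang1 : forall n : int, Gam1 (turn_at u (n%:~R * d1)).
Hypothesis ang2 : forall n : int, Gam2 (turn_at u (n%:~R * d2)).
Hypothesis ang0 : 0 < d1 + d2 < pi.
Hypothesis fin : forall C, finite_set (prodset Gam1 Gam2 `&` bounded_part C).

Let G1 g : Gam1 g -> Gt g. Proof. by case: sub1 => h _ _ _ /h. Qed.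
Let G2 g : Gam2 g -> Gt g. Proof. by case: sub2 => h _ _ _ /h. Qed.
Let s := mover u.
Let Gs : Gt s := Gt_mover du.

(** The products of the pairs in T(x) for x = actD g u, so that Q_x is the
    intersection of the half-spaces of the elements of the block of g. *)
Definition block g : set (V R) :=
  [set h | exists g1 g2, [/\ Gam1 g1, Gam2 g2, actD g1 u = actD g u & h = mulG g1 g2]].

Lemma block_turn g h : Gam1 g -> block g h -> exists t, h = mulG g (turn_at u t).
Proof.
move=> /G1 Gg [g1 [g2 [/G1 H1 /rot2[t2 ->] /(actD_eq du H1 Gg)[t1 ->] ->]]].
by exists (t1 + t2); rewrite -mulGA ?turn_atD //; exact: Gt_turn_at.
Qed.

Lemma turn_block g (n : int) : Gam1 g -> block g (mulG g (turn_at u (n%:~R * (d1 + d2)))).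
Proof.
move=> H; have Gg := G1 H.
exists (mulG g (turn_at u (n%:~R * d1))), (turn_at u (n%:~R * d2)); split => //.
- by case: sub1 => _ _ M _; apply: M.
- by apply/actD_eq => //; [apply: Gt_mul => //; exact: Gt_turn_at|exists (n%:~R * d1)].
- by rewrite -mulGA ?turn_atD ?mulrDr //; exact: Gt_turn_at.
Qed.

Lemma block_prodset g h : block g h -> prodset Gam1 Gam2 h.
Proof. by move=> [g1 [g2 [? ? _ ->]]]; exists g1 => //; exists g2. Qed.

Lemma prodset_Gt h : prodset Gam1 Gam2 h -> Gt h.
Proof. by move=> [g1 /G1 ? [g2 /G2 ? <-]]; exact: Gt_mul. Qed.

(** The element b in coordinates where u, in the source, and the orbit point of g, in the
    target, are moved to the centre of the disc. *)
Definition seen g b := actG (invG (mulG g s)) (invG s) b.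

Lemma Gt_seen g b : Gt g -> Gt b -> Gt (seen g b).
Proof. by move=> Gg Gb; apply: Gt_act => //; apply: Gt_inv => //; exact: Gt_mul. Qed.

(** The hyperbolic cosine of half the distance from the orbit point of g to the
    image of u under b. It is the same for all elements of a block. *)
Definition rad g b := vr (seen g b).

Lemma rad_gt0 g b : Gt g -> Gt b -> 0 < rad g b.
Proof. by move=> Gg Gb; apply: Gt_r0; exact: Gt_seen. Qed.

(** By the invariance of psi, a rotation about u becomes a turn about the centre, for
    which psi has a simple formula. *)
Lemma psi_seen g b t : Gt g -> Gt b ->
  psi (mulG g (turn_at u t)) b = psi (turn t) (seen g b).
Proof.
move=> Gg Gb; have Ggs := Gt_mul Gg Gs; have Gtt := Gt_turn t; have Gi := Gt_inv Gs.
rewrite -[b in LHS](actGKV Ggs Gs Gb) -(psi_act Ggs Gs Gtt (Gt_seen Gg Gb)).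
congr psi; rewrite /actG /turn_at -/s mulGA //; last exact: Gt_mul.
by rewrite mulGA.
Qed.

Lemma form_turn t b : form (pi_cov (turn t)) (pi_cov b) = - (vr b * cos (valpha b - t)).
Proof. by rewrite form_pi /turn !mkVE /= !mul0r !addr0 add0r mul1r. Qed.

Lemma psi_turn_le t b : Gt b -> psi (turn t) b <= vr b.
Proof.
move=> Gb; have b0 := Gt_r0 Gb; rewrite /psi; case: ifP => _; last exact: ltW.
by rewrite form_turn opprK ge_max (ltW b0) /= ger_pMr // cos_le1.
Qed.

Lemma psi_le_rad g h b : Gam1 g -> block g h -> Gt b -> psi h b <= rad g b.
Proof.
move=> H bh Gb; have [t ->] := block_turn H bh; rewrite psi_seen //; last exact: G1.
by apply: psi_turn_le; apply: Gt_seen => //; exact: G1.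
Qed.

(** Half the step of the rotations in a block bounds the angle between a point and the
    nearest of them. *)
Definition kappa : R := cos ((d1 + d2) / 2).

Lemma kappa_gt0 : 0 < kappa.
Proof. by apply: cos_gt0_pihalf; have /andP[? ?] := ang0; apply/andP; split; lra. Qed.

Lemma kappa_le1 : kappa <= 1.
Proof. by have := cos_max ((d1 + d2) / 2); rewrite ler_norml => /andP[]. Qed.

(** The rotations in a block are spaced by less than a half turn, so one of them
    points to b within a quarter turn. *)
Lemma block_large g b : Gam1 g -> Gt b -> exists2 h, block g h & kappa * rad g b <= psi h b.
Proof.
move=> H Gb; have Gg := G1 H; have /andP[a0 a1] := ang0.
pose y := seen g b; pose d := d1 + d2.
have Gy : Gt y := Gt_seen Gg Gb; have y0 := Gt_r0 Gy.
(* The multiple of d which is nearest to the angle of y. *)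
pose n := Num.floor (valpha y / d + 2^-1).
exists (mulG g (turn_at u (n%:~R * d))); first exact: turn_block.
rewrite psi_seen // -/y.
have lt : `|valpha y - n%:~R * d| <= d / 2.
  have := floor_itv (valpha y / d + 2^-1); rewrite -/n rmorphD /= => /andP[n1 n2].
  have e : valpha y = valpha y / d * d by rewrite divfK // gt_eqF.
  rewrite ler_norml {1 2}e; apply/andP; split; rewrite /d in n1 n2 *; nra.
have dp : d < pi by [].
apply: le_trans (psi_geN _); last by rewrite valpha_mkV; lra.
rewrite form_turn opprK mulrC ler_pM2l // /kappa.
apply: cos_le_abs; first by rewrite (gtr0_norm (_ : 0 < (d1 + d2) / 2)); [exact: lt|lra].
rewrite gtr0_norm; lra.
Qed.

(** The coordinate r is submultiplicative up to the factor 2 and invariant under turns,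
    and g s = b s (seen g b)^-1 recovers g from b. *)
Lemma vr_block_le g h b : Gam1 g -> block g h -> Gt b ->
  vr h <= 8 * vr s ^+ 2 * (vr b * rad g b).
Proof.
move=> H bh Gb; have [t ->] := block_turn H bh; have Gg := G1 H.
have Ggs := Gt_mul Gg Gs; have Gy := Gt_seen Gg Gb; have Gtt := Gt_turn t; have Gi := Gt_inv Gs.
have e : mulG g s = mulG (mulG b s) (invG (seen g b)).
  have Gbs := Gt_mul Gb Gs.
  have <- : mulG (mulG g s) (seen g b) = mulG b s.
    have ? := Gt_inv Ggs; have ? : Gt (mulG (invG (mulG g s)) b) by exact: Gt_mul.
    by rewrite /seen /actG invGK mulGA // mulKVG.
  by rewrite mulGK.
have s0 := Gt_r0 Gs; have b0 := Gt_r0 Gb; have y0 := rad_gt0 Gg Gb.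
have h1 : vr (mulG b s) <= 2 * vr b * vr s := vr_mulG_le Gb Gs.
have h2 : vr (mulG g s) <= 2 * vr (mulG b s) * rad g b.
  rewrite e; apply: le_trans (vr_mulG_le (Gt_mul Gb Gs) (Gt_inv Gy)) _; exact: lexx.
have -> : mulG g (turn_at u t) = mulG (mulG (mulG g s) (turn t)) (invG s).
  by rewrite /turn_at -/s mulGA ?mulGA //; exact: Gt_mul.
have h3 := vr_mulG_le (Gt_mul Ggs Gtt) Gi.
have e4 : vr (mulG (mulG g s) (turn t)) = vr (mulG g s) by rewrite mulG_turnr.
rewrite e4 vr_invG in h3.
have h4 : vr (mulG g s) <= 4 * vr b * vr s * rad g b.
  apply: le_trans h2 _; rewrite ler_pM2r //; lra.
apply: le_trans h3 _.
have : vr (mulG g s) * vr s <= 4 * vr b * vr s * rad g b * vr s by rewrite ler_pM2r.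
by rewrite expr2; lra.
Qed.

Let Gam1_one : Gam1 (oneG R). Proof. by case: sub1. Qed.

Lemma rad_one_le b : Gt b -> rad (oneG R) b <= 4 * vr s ^+ 2 * vr b.
Proof.
move=> Gb; have Gi := Gt_inv Gs; have Gsb := Gt_mul Gi Gb.
have s0 := Gt_r0 Gs.
rewrite /rad /seen /actG mul1G // invGK.
apply: le_trans (vr_mulG_le Gsb Gs) _.
have := vr_mulG_le Gi Gb; rewrite vr_invG => h.
have : vr (mulG (invG s) b) * vr s <= 2 * vr s * vr b * vr s by rewrite ler_pM2r.
by rewrite expr2; lra.
Qed.

(** A small rad bounds r of h (vr_block_le), and a positive value of psi h bounds its
    angle. The two conditions may hold at different points of the neighbourhood, which
    allows the values of minmax at these points to be compared. *)
Lemma near_finite b0 C : exists U S, [/\ nbhs b0 U, finite_set S, S `<=` prodset Gam1 Gam2,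
  (forall b, U b -> vr b <= vr b0 + 1) &
  forall b b' g h, U b -> U b' -> Gt b -> Gt b' -> Gam1 g -> rad g b' <= C -> block g h ->
    0 < psi h b -> S h].
Proof.
pose B := Num.max (8 * vr s ^+ 2 * ((vr b0 + 1) * C)) (`|valpha b0| + 1 + pi).
exists ([set b | vr b < vr b0 + 1] `&` [set b | `|valpha b| < `|valpha b0| + 1]),
  (prodset Gam1 Gam2 `&` bounded_part B); split => //.
- apply: filterI; apply: near_lt; rewrite ?ltrDl //.
    exact: (cvg_vr (@cvg_id _ (nbhs b0))).
  by apply: cvg_norm; exact: (cvg_valpha (@cvg_id _ (nbhs b0))).
- by move=> b [/= h _]; exact: ltW.
move=> b b' g h [_ /= ab] [/= rb _] Gb Gb' H rC bh /psi_gt0[aa _].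
have Gh := prodset_Gt (block_prodset bh).
split; first exact: block_prodset bh.
split => //; last first.
  rewrite le_max; apply/orP; right.
  have := ler_normB (valpha b) (valpha b - valpha h); rewrite subKr; lra.
rewrite le_max; apply/orP; left.
apply: le_trans (vr_block_le H bh Gb') _.
have s0 := Gt_r0 Gs; have b0' := Gt_r0 Gb'; have r0 := rad_gt0 (G1 H) Gb'.
rewrite ler_pM2l; last by rewrite mulr_gt0 // exprn_gt0.
apply: ler_pM => //; exact: ltW.
Qed.

(** The point (1/t) b lies in the polytope exactly when b is below level t. *)
Definition below b t : Prop := exists2 g, Gam1 g & forall h, block g h -> psi h b <= t.

Lemma below_rad g b t : Gam1 g -> Gt b -> (forall h, block g h -> psi h b <= t) ->
  kappa * rad g b <= t.
Proof. by move=> H Gb le; have [h bh hb] := block_large H Gb; apply: le_trans hb _; exact: le. Qed.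

Lemma block_max g b : Gam1 g -> Gt b -> exists h, [/\ block g h, 0 < psi h b &
  forall h', block g h' -> psi h' b <= psi h b].
Proof.
move=> H Gb; have [U [S [Ub Sf _ _ near]]] := near_finite b (rad g b).
have Ub' := nbhs_singleton Ub.
have inS h : block g h -> 0 < psi h b -> S h.
  by move=> bh p; apply: (near b b g).
have [h1 b1 p1] := block_large H Gb.
have {}p1 : 0 < psi h1 b.
  by apply: lt_le_trans p1; rewrite mulr_gt0 ?kappa_gt0 ?rad_gt0 //; exact: G1.
have [||h [bh Sh] hm] := @finite_argmin _ _ (block g `&` S) (fun h => - psi h b).
- by apply: sub_finite_set Sf => h [].
- by exists h1; split => //; exact: inS.
have {}hm h' : block g h' -> psi h' b <= psi h b.
  move=> bh'; have := psi_ge0 h' b; rewrite le_eqVlt => /orP[/eqP<-|p']; first exact: psi_ge0.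
  by rewrite -lerN2; apply: hm; split => //; exact: inS.
by exists h; split => //; apply: lt_le_trans p1 _; exact: hm.
Qed.

(** The orbit points with rad beyond the rad of u divided by kappa have, by block_large,
    a maximum which is not below that at u; only finitely many h compete for the
    others. *)
Lemma below_min b : Gt b -> exists g h, [/\ Gam1 g, block g h, 0 < psi h b,
  forall h', block g h' -> psi h' b <= psi h b & forall t, below b t -> psi h b <= t].
Proof.
move=> Gb; have k0 := kappa_gt0; have k1 := kappa_le1.
pose C := rad (oneG R) b / kappa.
have r0 := rad_gt0 (Gt_one R) Gb.
have [U [S [Ub Sf _ _ near]]] := near_finite b C.
have Ub' := nbhs_singleton Ub.
pose A := [set h | S h /\ exists g, [/\ Gam1 g, block g h, 0 < psi h b &
  forall h', block g h' -> psi h' b <= psi h b]].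
have inA g : Gam1 g -> rad g b <= C -> exists h, A h /\ block g h.
  move=> H rC; have [h [bh ph hm]] := block_max H Gb; exists h; split => //.
  by split; [apply: (near b b g)|exists g].
have [h1 [A1 b1]] : exists h, A h /\ block (oneG R) h.
  by apply: inA => //; rewrite /C ler_pdivlMr //; nra.
have [||h [Sh [g [H bh ph hm]]] hmin] := @finite_argmin _ _ A (fun h => psi h b).
- by apply: sub_finite_set Sf => h [].
- by exists h1.
exists g, h; split => // t [g' H' le].
have [rC|rC] := leP (rad g' b) C.
  by have [h' [A' b']] := inA g' H' rC; apply: le_trans (le _ b'); exact: hmin.
apply: le_trans (hmin _ A1) _; apply: le_trans (psi_le_rad Gam1_one b1 Gb) _.
apply: le_trans (below_rad H' Gb le); move: rC; rewrite /C ltr_pdivrMr // => rC.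
by rewrite mulrC ltW.
Qed.

(** The polytope is the set where this function, extended to be homogeneous, is at
    most one. *)
Definition minmax b : R := inf [set t | below b t].

Lemma minmaxP b : Gt b -> exists g h, [/\ Gam1 g, block g h, psi h b = minmax b,
  forall h', block g h' -> psi h' b <= minmax b & forall t, below b t -> minmax b <= t].
Proof.
move=> Gb; have [g [h [H bh ph hm hmin]]] := below_min Gb.
have e : psi h b = minmax b.
  apply/eqP; rewrite eq_le; apply/andP; split.
    by apply: lb_le_inf => //; exists (psi h b), g.
  by apply: ge_inf; [exists (psi h b)|exists g].
by exists g, h; rewrite -e.
Qed.

Lemma minmax_gt0 b : Gt b -> 0 < minmax b.
Proof.
move=> Gb; have [g [h [H bh e hm _]]] := minmaxP Gb.
apply: lt_le_trans (below_rad H Gb hm).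
by rewrite mulr_gt0 ?kappa_gt0 ?rad_gt0 //; exact: G1.
Qed.

Lemma below_minmax b t : Gt b -> below b t <-> minmax b <= t.
Proof.
move=> Gb; have [g [h [H bh e hm mi]]] := minmaxP Gb; split; first exact: mi.
by move=> mt; exists g => // h' bh'; apply: le_trans mt; exact: hm.
Qed.

(** Besides finiteness, the last property says that minmax varies no more than the
    finitely many functions of S do; continuity follows. *)
Lemma minmax_near b0 : exists U S, [/\ nbhs b0 U, finite_set S, S `<=` prodset Gam1 Gam2,
  (forall b, U b -> Gt b -> exists2 h, S h & psi h b = minmax b) &
  forall b b' e, U b -> U b' -> Gt b -> Gt b' -> 0 <= e ->
    (forall h, S h -> psi h b' <= psi h b + e) -> minmax b' <= minmax b + e].
Proof.
have k0 := kappa_gt0.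
pose K := 4 * vr s ^+ 2 * (vr b0 + 1).
have [U [S [Ub Sf SD Uvr near]]] := near_finite b0 (K / kappa).
have radK b g : U b -> Gt b -> Gam1 g ->
    (forall h, block g h -> psi h b <= minmax b) -> rad g b <= K / kappa.
  move=> Ubb Gb H le; rewrite ler_pdivlMr // mulrC.
  apply: le_trans (below_rad H Gb le) _.
  have [_ [_ [_ _ _ _ mi]]] := minmaxP Gb.
  apply: le_trans (mi (rad (oneG R) b) _) _.
    by exists (oneG R) => // h bh; exact: psi_le_rad.
  apply: le_trans (rad_one_le Gb) _; rewrite /K ler_pM2l; first exact: Uvr.
  by rewrite mulr_gt0 // exprn_gt0 // Gt_r0.
exists U, S; split => //.
  move=> b Ubb Gb; have [g [h [H bh e le _]]] := minmaxP Gb.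
  exists h => //; apply: (near b b g) => //; first exact: radK.
  by rewrite e; exact: minmax_gt0.
move=> b b' e Ubb Ubb' Gb Gb' e0 close.
have [g [h [H bh _ le _]]] := minmaxP Gb; have [_ [_ [_ _ _ _ mi]]] := minmaxP Gb'.
apply: mi; exists g => // h' bh'.
have m0 := minmax_gt0 Gb.
have := psi_ge0 h' b'; rewrite le_eqVlt => /orP[/eqP<-|p']; first by lra.
apply: le_trans (close h' _) _; last by rewrite lerD2r; exact: le.
by apply: (near b' b g) => //; exact: radK.
Qed.

Lemma finite_near (T : topologicalType) (I : eqType) (S : set I) (P : I -> set T) (x : T) :
  finite_set S -> (forall i, S i -> nbhs x (P i)) -> nbhs x [set y | forall i, S i -> P i y].
Proof.
move=> /finite_seqP[l ->]; elim: l => [|i l IH] h; first by apply: filterS filterT => y _ j.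
have h1 := h i (mem_head _ _).
have h2 := IH (fun j jl => h j (mem_behead (s := i :: l) jl)).
apply: filterS (filterI h1 h2) => y [y1 y2] j /=.
by rewrite in_cons => /orP[/eqP ->|/y2].
Qed.

Lemma minmax_continuous : {within @Gt R, continuous minmax}.
Proof.
apply/subspace_continuousP => b0 Gb0.
apply/(@cvgrPdist_le _ R^o) => e e0.
have [U [S [Ub Sf SD _ close]]] := minmax_near b0.
have cl h : S h -> nbhs b0 [set b | `|psi h b0 - psi h b| < e].
  move=> /SD/prodset_Gt Gh.
  have c : {for b0, continuous (psi h)} by apply: cvg_psi; apply: Gt_Lt.
  by move/(@cvgrPdist_lt _ R^o): c; apply.
have near_both : nbhs b0 (U `&` [set b | forall h, S h -> `|psi h b0 - psi h b| < e]).
  by apply: filterI => //; exact: (finite_near Sf cl).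
apply: filterS near_both => b [Ubb cb] Gb /=.
have Ub0 := nbhs_singleton Ub.
rewrite ler_norml; apply/andP; split.
  have : minmax b <= minmax b0 + e; last by lra.
  apply: close => //; first exact: ltW.
  by move=> h /cb /=; rewrite ltr_norml => /andP[] *; lra.
have : minmax b0 <= minmax b + e; last by lra.
apply: close => //; first exact: ltW.
by move=> h /cb /=; rewrite ltr_norml => /andP[] *; lra.
Qed.

Lemma prodset_act g1 g2 h : Gam1 g1 -> Gam2 g2 -> prodset Gam1 Gam2 h ->
  prodset Gam1 Gam2 (actG g1 g2 h).
Proof.
move=> H1 H2 [a1 A1 [a2 A2 <-]]; have [_ _ M1 _] := sub1; have [_ _ M2 I2] := sub2.
exists (mulG g1 a1); first exact: M1.
exists (mulG a2 (invG g2)); first by apply: M2 => //; exact: I2.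
have ? := G1 H1; have ? := G1 A1; have ? := G2 A2; have ? := Gt_inv (G2 H2).
have ? : Gt (mulG g1 a1) by exact: Gt_mul.
by rewrite /actG mulGA // [mulG g1 (mulG _ _)]mulGA.
Qed.

(** The translation by (g1, g2) maps the block of g to the block of g1 g. *)
Lemma below_act g1 g2 b t : Gam1 g1 -> Gam2 g2 -> Gt b ->
  below b t -> below (actG g1 g2 b) t.
Proof.
move=> H1 H2 Gb [g H le]; have [_ _ M1 I1] := sub1; have [_ _ M2 I2] := sub2.
have Gg1 := G1 H1; have Gg2 := G2 H2; have Gg := G1 H.
exists (mulG g1 g); first exact: M1.
move=> h [a1 [a2 [A1 A2 ea ->]]].
have Ga1 := G1 A1; have Ga2 := G2 A2; have Gi1 := Gt_inv Gg1; have Gi2 := Gt_inv Gg2.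
have -> : mulG a1 a2 = actG g1 g2 (mulG (mulG (invG g1) a1) (mulG a2 g2)).
  have ? := Gt_mul Gi1 Ga1; have ? := Gt_mul Ga2 Gg2.
  by rewrite /actG mulGA // mulKVG // mulGA // mulGK //; exact: Gt_mul.
rewrite psi_act //; last by apply: Gt_mul; exact: Gt_mul.
apply: le; exists (mulG (invG g1) a1), (mulG a2 g2); split => //.
- by apply: M1 => //; exact: I1.
- exact: M2.
- by rewrite actD_mul // ea -actD_mul ?mulKG //; exact: Gt_mul.
Qed.

Lemma minmax_act g1 g2 b : Gam1 g1 -> Gam2 g2 -> Gt b -> minmax (actG g1 g2 b) = minmax b.
Proof.
move=> H1 H2 Gb; have [_ _ _ I1] := sub1; have [_ _ _ I2] := sub2.
have Gg1 := G1 H1; have Gg2 := G2 H2.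
congr inf; apply/seteqP; split=> t /=; last exact: below_act.
by move=> /(below_act (I1 _ H1) (I2 _ H2) (Gt_act Gg1 Gg2 Gb)); rewrite actGK.
Qed.

(** * Cells *)
Let D := prodset Gam1 Gam2.

(** The projection of the part of the boundary of the half-space of h that lies on
    the boundary of the polytope. *)
Definition contact h : set (V R) := [set b | Gt b /\ psi h b = minmax b].

(** The projection of the face F_h, by theta_Fset below. *)
Definition cell h : set (V R) := closure_in (@Gt R) (interior_in (@Gt R) (contact h)).

Lemma contact_Gt h : contact h `<=` @Gt R. Proof. by move=> b []. Qed.

Lemma contact_closed h : Gt h -> closed (contact h : set (subspace (@Gt R))).
Proof.
move=> Gh.
have -> : contact h = @Gt R `&` (fun b => psi h b - minmax b) @^-1` [set 0].
  apply/seteqP; split=> b [Gb /= e]; split => //; first by rewrite /= e subrr.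
  by apply/eqP; rewrite -subr_eq0 e.
apply: closedI; first exact: closed_subspaceT.
have c : {within @Gt R, continuous (fun b => psi h b - minmax b)}.
  have cp : {within @Gt R, continuous (psi h)}.
    apply: continuous_in_subspaceT => b /set_mem Gb.
    by apply: cvg_psi; apply: Gt_Lt.
  by move=> b; apply: cvgB; [exact: cp|exact: minmax_continuous].
by apply: (@closed_comp _ _ (from_subspace (@Gt R) (fun b => psi h b - minmax b))) => //; exact: closed_eq.
Qed.

Lemma interior_contact_Gt h : interior_in (@Gt R) (contact h) `<=` @Gt R.
Proof. by move=> b /interior_in_sub[]. Qed.

Lemma cell_contact h : Gt h -> cell h `<=` contact h.
Proof.
move=> /contact_closed/closure_id ch; rewrite [X in _ `<=` X]ch.
exact: (@closureS (subspace (@Gt R)) _ _ (@interior_in_sub _ (@Gt R) (contact h))).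
Qed.

Lemma interior_contact_cell h :
  interior_in (@Gt R) (contact h) `<=` interior_in (@Gt R) (cell h).
Proof.
have o : open (interior_in (@Gt R) (contact h) : set (subspace (@Gt R))) := @open_interior _ _.
have : interior_in (@Gt R) (contact h) `<=` cell h := @subset_closure (subspace (@Gt R)) _.
by rewrite (open_subsetE _ o).
Qed.

Lemma cell_Gt h : cell h `<=` @Gt R.
Proof.
move=> b; rewrite /cell closure_inP; last exact: interior_contact_Gt.
by case.
Qed.

Lemma contact_inj h h' b : Gt h -> Gt h' -> interior_in (@Gt R) (contact h) b ->
  interior_in (@Gt R) (contact h') b -> h = h'.
Proof.
move=> Gh Gh' ib ib'; have Gb := interior_contact_Gt ib.
have [U nU UC] := (interior_inP (contact h) Gb).1 ib.
have [U' nU' UC'] := (interior_inP (contact h') Gb).1 ib'.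
have nUU : nbhs b (U `&` U') by exact: filterI.
apply: (psi_inj_near Gh Gh' Gb nUU) => p [Up Up'] Gp.
have [_ e] := UC p (conj Up Gp); have [_ e'] := UC' p (conj Up' Gp).
by rewrite e e'; split => //; exact: minmax_gt0.
Qed.

(** Near b0 every point is in contact with one of finitely many elements, and an open
    set covered by finitely many closed contact sets meets the interior of one. *)
Lemma cells_near b0 : exists U S, [/\ nbhs b0 U, finite_set S, S `<=` D &
  forall W : set (subspace (@Gt R)), open W -> W !=set0 -> W `<=` U -> W `<=` @Gt R ->
    exists2 h, S h & (W `&` interior_in (@Gt R) (contact h)) !=set0].
Proof.
have [U [S [nU Sf SD att _]]] := minmax_near b0.
exists U, S; split => // W oW W0 WU WG.
apply: (@finite_closed_cover (subspace (@Gt R)) _ S contact W) => //.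
  by move=> h /SD/prodset_Gt; exact: contact_closed.
move=> x Wx; have [h Sh e] := att x (WU _ Wx) (WG _ Wx).
by exists h => //; split => //; exact: WG.
Qed.

(** A common point of the interior of one cell and of another cell is a limit of points
    at which both contact sets have interior. *)
Lemma cell_disjoint h h' : D h -> D h' -> h <> h' ->
  interior_in (@Gt R) (cell h) `&` cell h' = set0.
Proof.
move=> /prodset_Gt Gh /prodset_Gt Gh' ne; apply/seteqP; split=> // b [ib cb].
have [c [ic ic']] : (interior_in (@Gt R) (contact h') `&` interior_in (@Gt R) (cell h)) !=set0.
  by apply: (cb (interior_in (@Gt R) (cell h))); exact: (@nbhs_interior (subspace (@Gt R))).
apply: ne; apply: (contact_inj (b := c)) => //.
by apply: (@interiorS (subspace (@Gt R)) _ _ (cell_contact Gh)).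
Qed.

Lemma cell_cover : closure_in (@Gt R) (\bigcup_(h in D) interior_in (@Gt R) (cell h)) = @Gt R.
Proof.
have subG : \bigcup_(h in D) interior_in (@Gt R) (cell h) `<=` @Gt R.
  by move=> b [h _ /interior_in_sub/cell_Gt].
apply/seteqP; split=> b; first by rewrite closure_inP // => -[].
move=> Gb N nN.
have [U [S [nU Sf SD near]]] := cells_near b.
have nUs : @nbhs _ (subspace (@Gt R)) b U by apply/(nbhs_subspace_ex _ Gb); exists U.
have nG : @nbhs _ (subspace (@Gt R)) b (@Gt R).
  by apply: open_nbhs_nbhs; split => //; exact: open_subspaceT.
pose W : set (subspace (@Gt R)) := (N `&` (U `&` @Gt R))^°.
have bW : W b by apply: filterI => //; exact: filterI.
have WN : W `<=` N `&` (U `&` @Gt R) by exact: interior_subset.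
have [|||h Sh [c [Wc ic]]] := near W (@open_interior (subspace (@Gt R)) _).
- by exists b.
- by move=> x /WN[_ []].
- by move=> x /WN[_ []].
by exists c; split; [exists h; [exact: SD|exact: interior_contact_cell]|case: (WN _ Wc)].
Qed.

(** A cell that meets the neighbourhood contains an open set of contact points there,
    which meets the interior of the contact set of an element of S; by contact_inj the
    two elements are equal. *)
Lemma cell_locally_finite : locally_finite_in (@Gt R) D cell.
Proof.
move=> b Gb; have [U [S [nU Sf SD near]]] := cells_near b.
exists U° => //; first exact: nbhs_interior.
apply: sub_finite_set Sf => h [Dh [c [cc ic]]].
have Gc := cell_Gt cc; have Gh := prodset_Gt Dh.
have nUs : @nbhs _ (subspace (@Gt R)) c U° .
  by apply/(nbhs_subspace_ex _ Gc); exists U° => //; exact: nbhs_interior.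
have [d [id Ud]] := cc _ nUs.
pose W : set (subspace (@Gt R)) := interior_in (@Gt R) (contact h) `&` U°.
have oW : open W.
  apply: openI; first exact: (@open_interior (subspace (@Gt R))).
  by apply: open_subspaceW; exact: open_interior.
have [|||h' Sh' [x [[ix _] ix']]] := near W oW.
- by exists d.
- by move=> x [_ /interior_subset].
- by move=> x [/interior_contact_Gt].
by rewrite (contact_inj Gh (prodset_Gt (SD _ Sh')) ix ix').
Qed.

Lemma cell_act g1 g2 h : Gam1 g1 -> Gam2 g2 -> D h ->
  actG g1 g2 @` cell h = cell (actG g1 g2 h).
Proof.
move=> H1 H2 /prodset_Gt Gh; have Gg1 := G1 H1; have Gg2 := G2 H2.
have Gi1 := Gt_inv Gg1; have Gi2 := Gt_inv Gg2.
have XY x : Gt x -> Gt (actG g1 g2 x) by exact: Gt_act.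
have YX x : Gt x -> Gt (actG (invG g1) (invG g2) x) by exact: Gt_act.
have fK x : Gt x -> actG (invG g1) (invG g2) (actG g1 g2 x) = x by exact: actGK.
have fK' x : Gt x -> actG g1 g2 (actG (invG g1) (invG g2) x) = x by exact: actGKV.
have ct a b : Gt a -> Gt b -> {within @Gt R, continuous (actG a b)}.
  by move=> Ga Gb; apply: continuous_in_subspaceT => x /set_mem Gx; exact: cvg_actG.
have im : actG g1 g2 @` contact h = contact (actG g1 g2 h).
  apply/seteqP; split=> [_ [b [Gb e] <-]|b [Gb e]].
    by split; [exact: XY|rewrite psi_act // minmax_act].
  exists (actG (invG g1) (invG g2) b); last exact: fK'.
  split; first exact: YX.
  have Gy := YX _ Gb.
  by rewrite -(psi_act Gg1 Gg2 Gh Gy) -(minmax_act H1 H2 Gy) fK'.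
rewrite /cell (closure_in_homeo XY YX fK fK' (ct _ _ Gg1 Gg2) (ct _ _ Gi1 Gi2)); last exact: interior_contact_Gt.
rewrite (interior_in_homeo XY YX fK fK' (ct _ _ Gg1 Gg2) (ct _ _ Gi1 Gi2)) ?im //.
exact: contact_Gt.
Qed.

(** * The boundary of the polytope *)
(** The extension of minmax to the cone which is homogeneous of degree one. *)
Definition level a : R := lambda a * minmax (theta a).

Lemma theta_scaleV (r : R) a : 0 < r -> Lt a -> theta (scaleV r a) = theta a.
Proof.
move=> r0 La; have l0 := lambda_gt0 La.
rewrite -[a in LHS]scale_theta // scaleVA theta_scale //; first exact: mulr_gt0.
exact: Gt_theta.
Qed.

Lemma level_scale (r : R) a : 0 < r -> Lt a -> level (scaleV r a) = r * level a.
Proof. by move=> r0 La; rewrite /level theta_scaleV // lambda_scale // mulrA. Qed.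

Lemma level_continuous a : Lt a -> {for a, continuous level}.
Proof.
move=> La; apply: cvgM; first exact: cvg_lambda.
have Gta := Gt_theta La.
move=> W nW.
have [N nN NW] := within_continuousP minmax_continuous Gta nW.
have n1 : nbhs a (@theta R @^-1` N) by apply: (cvg_theta La).
by apply: filterS (filterI n1 (nbhs_Lt La)) => x [Nx Lx]; apply: NW => //; exact: Gt_theta.
Qed.

Lemma PsetE : Pset Gam1 Gam2 u = @Lt R `&` [set a | level a <= 1].
Proof.
apply/seteqP; split=> a.
  move=> [_ [g H <-] Q].
  have Hh h : block g h -> Lt a /\ psi h a <= 1.
    move=> [g1 [g2 [H1 H2 e ->]]]; have := Q g1 g2 H1 H2 e.
    by rewrite HsetE //; apply: Gt_mul; [exact: G1|exact: G2].
  have [La _] := Hh _ (turn_block 0 H).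
  split => //=; have l0 := lambda_gt0 La.
  rewrite /level mulrC -ler_pdivlMr // mul1r.
  apply/(below_minmax _ (Gt_theta La)); exists g => // h /Hh[_].
  by rewrite psi_theta // mulrC -ler_pdivlMr // mul1r.
move=> [La /=]; have l0 := lambda_gt0 La.
rewrite /level mulrC -ler_pdivlMr // mul1r => /(below_minmax _ (Gt_theta La))[g H le].
exists (actD g u); first by exists g.
move=> g1 g2 H1 H2 e; rewrite HsetE; last by apply: Gt_mul; [exact: G1|exact: G2].
split => //=; rewrite psi_theta // mulrC -ler_pdivlMr // mul1r.
by apply: le; exists g1, g2.
Qed.

Let B := bdP Gam1 Gam2 u.

Lemma bdPE : B = @Lt R `&` [set a | level a = 1].
Proof.
by rewrite /B /bdP PsetE; apply: boundary_sub_le; [exact: level_continuous|exact: level_scale].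
Qed.

(** The boundary of the polytope as the graph of lambda = 1 / minmax. *)
Definition section x : V R := scaleV (minmax x)^-1 x.

Lemma section_bdP x : Gt x -> B (section x).
Proof.
move=> Gx; have m0 := minmax_gt0 Gx; have i0 : 0 < (minmax x)^-1 by rewrite invr_gt0.
rewrite bdPE; split; first by apply: Lt_scale => //; exact: Gt_Lt.
rewrite /= level_scale //; last exact: Gt_Lt.
have -> : level x = minmax x.
  by rewrite /level -{2}(scaleV1 x) theta_scale // lambda_Gt // mul1r.
by rewrite mulVf // gt_eqF.
Qed.

Lemma bdP_Lt a : B a -> Lt a. Proof. by rewrite bdPE => -[]. Qed.

Lemma bdP_theta a : B a -> Gt (theta a).
Proof. by move=> /bdP_Lt; exact: Gt_theta. Qed.

Lemma sectionK x : Gt x -> theta (section x) = x.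
Proof. by move=> Gx; rewrite theta_scale // invr_gt0 minmax_gt0. Qed.

Lemma thetaK a : B a -> section (theta a) = a.
Proof.
move=> Ba; have La := bdP_Lt Ba; move: Ba; rewrite bdPE => -[_ /= e].
have m0 := minmax_gt0 (Gt_theta La).
have el : (minmax (theta a))^-1 = lambda a.
  by rewrite -[LHS]mul1r -e /level mulfK // gt_eqF.
by rewrite /section el scale_theta.
Qed.

Lemma section_continuous : {within @Gt R, continuous section}.
Proof.
apply/subspace_continuousP => x Gx.
have m : minmax @ within (@Gt R) (nbhs x) --> minmax x.
  by move/subspace_continuousP: minmax_continuous; apply.
apply: cvg_scaleV; last exact: cvg_within.
by apply: cvgV => //; rewrite gt_eqF // minmax_gt0.
Qed.

Lemma theta_continuous_bdP : {within B, continuous (@theta R)}.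
Proof.
apply: continuous_in_subspaceT => a /set_mem Ba.
by apply: cvg_theta; exact: bdP_Lt.
Qed.

Lemma section_act g1 g2 x : Gam1 g1 -> Gam2 g2 -> Gt x ->
  actL g1 g2 (section x) = section (actG g1 g2 x).
Proof.
move=> H1 H2 Gx; have m0 := minmax_gt0 Gx.
rewrite /actL sectionK // /section minmax_act // lambda_scale ?invr_gt0 //.
by rewrite lambda_Gt // mulr1.
Qed.

Let homeoC A : A `<=` @Gt R -> section @` closure_in (@Gt R) A = closure_in B (section @` A).
Proof.
exact: (closure_in_homeo section_bdP bdP_theta sectionK thetaK section_continuous theta_continuous_bdP).
Qed.

Let homeoI A : A `<=` @Gt R -> section @` interior_in (@Gt R) A = interior_in B (section @` A).
Proof.
exact: (interior_in_homeo section_bdP bdP_theta sectionK thetaK section_continuous theta_continuous_bdP).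
Qed.

(** Both interiors and closures are transported by the homeomorphism, so only the sets
    of contact have to be compared: on the boundary of P, psi h = 1 means that psi h
    and minmax agree on the projection. *)
Lemma FsetE h : D h -> Fset Gam1 Gam2 u h = section @` cell h.
Proof.
move=> /prodset_Gt Gh; rewrite /Fset -/B /cell homeoC ?homeoI; try exact: contact_Gt;
  last exact: interior_contact_Gt.
congr (closure_in B (interior_in B _)).
rewrite HsetE // boundary_sub_le; last first.
- by move=> r a r0 _; apply: psi_scale; exact: ltW.
- by move=> a La; apply: cvg_psi => //; exact: Gt_Lt.
apply/seteqP; split=> a.
  move=> [[La /= e] Ba]; exists (theta a); last exact: thetaK.
  have := Ba; rewrite bdPE => -[_ /= e']; split; first exact: Gt_theta.
  have l0 := lambda_gt0 La; apply: (mulfI (lt0r_neq0 l0)).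
  by rewrite -psi_theta // e -e'.
move=> [x [Gx e] <-]; have Bx := section_bdP Gx; split => //; split; first exact: bdP_Lt.
have m0 := minmax_gt0 Gx.
by rewrite /= psi_scale ?invr_ge0 ?ltW // e mulVf // gt_eqF.
Qed.

Lemma theta_section A : A `<=` @Gt R -> @theta R @` (section @` A) = A.
Proof.
move=> AG; apply/seteqP; split=> [_ [_ [x Ax <-] <-]|x Ax]; first by rewrite sectionK //; exact: AG.
by exists (section x); [exists x|rewrite sectionK //; exact: AG].
Qed.

Lemma theta_Fset h : D h -> @theta R @` Fset Gam1 Gam2 u h = cell h.
Proof. by move=> Dh; rewrite FsetE // theta_section //; exact: cell_Gt. Qed.

Lemma section_inj x y : Gt x -> Gt y -> section x = section y -> x = y.
Proof. by move=> Gx Gy e; rewrite -(sectionK Gx) e sectionK. Qed.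

Lemma bdP_act g1 g2 : Gam1 g1 -> Gam2 g2 -> actL g1 g2 @` B = B.
Proof.
move=> H1 H2; have Gg1 := G1 H1; have Gg2 := G2 H2.
apply/seteqP; split=> [_ [a Ba <-]|a Ba].
  rewrite -(thetaK Ba) section_act //; last exact: bdP_theta.
  by apply: section_bdP; apply: Gt_act => //; exact: bdP_theta.
have Gta := bdP_theta Ba.
have Gi : Gt (actG (invG g1) (invG g2) (theta a)) by apply: Gt_act => //; exact: Gt_inv.
exists (section (actG (invG g1) (invG g2) (theta a))); first exact: section_bdP.
by rewrite section_act // actGKV // thetaK.
Qed.

Lemma Fset_fundamental g : D g ->
  fundamental_domain Gam1 Gam2 (@actL R) B (Fset Gam1 Gam2 u) g.
Proof.
move=> Dg; split.
- move=> g1 g2 H1 H2; have Dh := prodset_act H1 H2 Dg.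
  rewrite -/(actG g1 g2 g) !FsetE // -cell_act //.
  apply/seteqP; split=> [_ [_ [x cx <-] <-]|_ [_ [x cx <-] <-]].
    by rewrite section_act //; [exists (actG g1 g2 x) => //; exists x|exact: cell_Gt cx].
  by exists (section x); [exists x|rewrite section_act //; exact: cell_Gt cx].
- move=> h h' Dh Dh' ne; rewrite !FsetE // -homeoI; last exact: cell_Gt.
  apply/seteqP; split=> // _ [[x ix <-] [y cy e]].
  have Gx := cell_Gt (interior_in_sub ix); have Gy := cell_Gt cy.
  have : (interior_in (@Gt R) (cell h) `&` cell h') x.
    by split => //; rewrite -(section_inj Gy Gx e).
  by rewrite cell_disjoint.
- have -> : \bigcup_(h in D) interior_in B (Fset Gam1 Gam2 u h) =
      section @` (\bigcup_(h in D) interior_in (@Gt R) (cell h)).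
    apply/seteqP; split=> [b [h Dh]|_ [x [h Dh ix] <-]].
      rewrite FsetE // -homeoI; last exact: cell_Gt.
      by move=> [x ix <-]; exists x => //; exists h.
    by exists h => //; rewrite FsetE // -homeoI; [exists x|exact: cell_Gt].
  rewrite -homeoC; last by move=> b [h _ /interior_in_sub/cell_Gt].
  rewrite cell_cover; apply/seteqP; split=> [_ [x Gx <-]|a Ba]; first exact: section_bdP.
  by exists (theta a); [exact: bdP_theta|exact: thetaK].
Qed.

Lemma cell_fundamental g (F' : V R -> set (V R)) : (forall h, D h -> F' h = cell h) -> D g ->
  fundamental_domain Gam1 Gam2 (@actG R) (@Gt R) F' g.
Proof.
move=> FE Dg; split.
- move=> g1 g2 H1 H2; have Dh := prodset_act H1 H2 Dg.
  by rewrite -/(actG g1 g2 g) !FE // cell_act.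
- by move=> h h' Dh Dh' ne; rewrite !FE // cell_disjoint.
- rewrite -[RHS]cell_cover; congr (closure_in _ _).
  by apply: eq_bigcupr => h Dh; rewrite FE.
Qed.

Lemma Fset_locally_finite : locally_finite_in B D (Fset Gam1 Gam2 u).
Proof.
move=> a Ba; have [U nU Uf] := cell_locally_finite (bdP_theta Ba).
exists (@theta R @^-1` U); first exact: (cvg_theta (bdP_Lt Ba)).
apply: sub_finite_set Uf => h [Dh [b [Fb Ub]]]; split => //.
by exists (theta b); split => //; rewrite -theta_Fset //; exists b.
Qed.

Lemma theta_homeomorphism : homeomorphism_on B (@Gt R) (@theta R).
Proof.
split.
- split; first by move=> a; exact: bdP_theta.
    by move=> a b /set_mem Ba /set_mem Bb e; rewrite -(thetaK Ba) e thetaK.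
  by move=> x Gx; exists (section x); [exact: section_bdP|exact: sectionK].
- exact: theta_continuous_bdP.
- by exists section; split; [exact: section_continuous|exact: thetaK].
Qed.

Lemma theta_act g1 g2 a : Gam1 g1 -> Gam2 g2 -> B a ->
  theta (actL g1 g2 a) = actG g1 g2 (theta a).
Proof.
move=> H1 H2 Ba; rewrite -{1}(thetaK Ba) section_act ?sectionK //; try exact: bdP_theta.
by apply: Gt_act; [exact: G1|exact: G2|exact: bdP_theta].
Qed.

(** On the intersection both functions equal minmax, which is positive, so the forms
    with the two images agree there. If the images coincide, the sheets are disjoint
    and the intersection is empty. *)
Lemma cell_geodesic h h' : D h -> D h' -> h <> h' ->
  exists (d : nat) (S : set (V R)),
    [/\ (d < 3)%N, totally_geodesic d S & cell h `&` cell h' `<=` S].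
Proof.
move=> /prodset_Gt Gh /prodset_Gt Gh' ne.
have both b : (cell h `&` cell h') b -> [/\ Gt b, 0 < psi h b & psi h b = psi h' b].
  move=> [/(cell_contact Gh)[Gb e] /(cell_contact Gh')[_ e']].
  by rewrite e e'; split => //; exact: minmax_gt0.
have [e|w0] := eqVneq (pi_cov h - pi_cov h') 0.
  exists 0%N, set0; split => //.
  move=> b /both[Gb p eb]; apply: ne; apply: (same_pi Gh Gh' _ p); last by rewrite -eb.
  by apply/eqP; rewrite -subr_eq0 e.
exists 2%N, (surface (pi_cov h - pi_cov h')); split => //.
  by apply: surface_totally_geodesic; exact/eqP.
move=> b /both[Gb p eb]; split => //.
have := psi_form p; rewrite eb psi_form -?eb // => /oppr_inj e.
rewrite form_sym form_add.
have -> : form (pi_cov b) (- pi_cov h') = - form (pi_cov b) (pi_cov h') by rewrite !formE /=; ring.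
by rewrite !(form_sym (pi_cov b)) e subrr.
Qed.

End MinMax.

(** * From Condition (star) to the tiling *)

(** The second group is cyclic, hence abelian, and so it consists of rotations about u.
    The angles d1 and d2 are multiples of k pi / p1 and k pi / p2 chosen by the Bezout
    identity, and the products are locally finite because the rotations in the second
    group are finitely many up to the central elements of the first. *)
Lemma condition_star_data (R : realType) (Gam1 Gam2 : set (V R)) (u : R[i]) (k p1 p2 : nat) :
  condition_star Gam1 Gam2 u k p1 p2 ->
  [/\ subgroup Gam1 /\ subgroup Gam2, disc u,
      (forall h, Gam2 h -> exists t, h = turn_at u t),
      (forall C, finite_set (prodset Gam1 Gam2 `&` bounded_part C)) &
      exists d1 d2 : R, [/\ (forall n : int, Gam1 (turn_at u (n%:~R * d1))),
        (forall n : int, Gam2 (turn_at u (n%:~R * d2))) & 0 < d1 + d2 < pi]].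
Proof.
move=> [[disc1 disc2 cyc2] [lev1 lev2] [du fix1 fix2] [iso1 iso2] klt].
have sub1 := disc1.1; have sub2 := disc2.1.
have [k0 L1] := level_centre sub1 lev1; have [_ L2] := level_centre sub2 lev2.
have [p10 A1] := isotropy_angles sub1 du k0 L1 iso1.
have [p20 A2] := isotropy_angles sub2 du k0 L2 iso2.
have rot2 := abelian_fixes sub2 du (cyclic_comm cyc2) fix2.
split => //.
  move=> C; apply: (prodset_finite _ disc1 _ du k0 p20) => //.
  - by case: sub2.
  - by move=> n /L1.
  by move=> h /[dup] /rot2[t ->] /A2[n ->]; exists n.
have [a [b ab]] := small_angle R k0 p10 p20 klt.
exists (a%:~R * (k%:R * pi / p1%:R)), (b%:~R * (k%:R * pi / p2%:R)); split => // n.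
  by apply/A1; exists (n * a); rewrite rmorphM mulrA.
by apply/A2; exists (n * b); rewrite rmorphM mulrA.
Qed.

Theorem theoremA (R : realType) (Gam1 Gam2 : set (V R)) (u : R[i])
    (k p1 p2 : nat) (hstar : condition_star Gam1 Gam2 u k p1 p2) :
  let B := bdP Gam1 Gam2 u in
  let F := Fset Gam1 Gam2 u in
  let F' := fun g => @theta R @` F g in
  let D := prodset Gam1 Gam2 in
  (forall g1 g2, Gam1 g1 -> Gam2 g2 -> actL g1 g2 @` B = B) /\
  (forall g, D g -> fundamental_domain Gam1 Gam2 (@actL R) B F g) /\
  locally_finite_in B D F /\
  (homeomorphism_on B (@Gt R) (@theta R) /\
   forall g1 g2 a, Gam1 g1 -> Gam2 g2 -> B a ->
     theta (actL g1 g2 a) = actG g1 g2 (theta a)) /\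
  (forall g, D g -> fundamental_domain Gam1 Gam2 (@actG R) (@Gt R) F' g) /\
  locally_finite_in (@Gt R) D F' /\
  (forall g1 g2 h1 h2, Gam1 g1 -> Gam2 g2 -> Gam1 h1 -> Gam2 h2 ->
     mulG g1 g2 <> mulG h1 h2 ->
     exists (d : nat) (S : set (V R)),
       [/\ (d < 3)%N, totally_geodesic d S &
           F' (mulG g1 g2) `&` F' (mulG h1 h2) `<=` S]).
Proof.
move=> B F F' D.
have [[sub1 sub2] du rot2 fin [d1 [d2 [ang1 ang2 ang0]]]] := condition_star_data hstar.
have cellE h : D h -> F' h = cell Gam1 Gam2 u h.
  exact: (theta_Fset sub1 sub2 du rot2 ang1 ang2 ang0 fin).
have DM g1 g2 : Gam1 g1 -> Gam2 g2 -> D (mulG g1 g2) by move=> H1 H2; exists g1 => //; exists g2.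
split; first by move=> g1 g2; exact: (bdP_act sub1 sub2 du rot2 ang1 ang2 ang0 fin).
split; first by move=> g; exact: (Fset_fundamental sub1 sub2 du rot2 ang1 ang2 ang0 fin).
split; first exact: (Fset_locally_finite sub1 sub2 du rot2 ang1 ang2 ang0 fin).
split.
  split; first exact: (theta_homeomorphism sub1 sub2 du rot2 ang1 ang2 ang0 fin).
  by move=> g1 g2 a; exact: (theta_act sub1 sub2 du rot2 ang1 ang2 ang0 fin).
split.
  by move=> g; exact: (cell_fundamental sub1 sub2 du rot2 ang1 ang2 ang0 fin cellE).
split.
  move=> x Gx; have [U nU Uf] := cell_locally_finite sub1 sub2 du rot2 ang1 ang2 ang0 fin Gx.
  exists U => //; apply: sub_finite_set Uf => h [Dh ne].
  by split => //; rewrite -cellE.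
move=> g1 g2 h1 h2 H1 H2 K1 K2 ne; rewrite !cellE; try exact: DM.
by apply: (cell_geodesic sub1 sub2 du rot2 ang1 ang2 ang0 fin) => //; exact: DM.
Qed.
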